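(* Let $\alpha\ge0$ and let $f\in\mathcal{C}^2(\overline{\mathbb{D}})$ be a solution of the Dirichlet problem $T_\alpha(f)=0$ in $\mathbb{D}$, $f=f^*$ on $\partial\mathbb{D}$. Suppose that $f(0)=0$, $f(\overline{\mathbb{D}})=\overline{\mathbb{D}}$ and $f(\partial\mathbb{D})=\partial\mathbb{D}$. (a) If $\alpha=0$, then for all $\theta\in[0,2\pi]$, $\|D_f(e^{i\theta})\|\ge\frac{2}{\pi}$. (b) If $\alpha>0$, then for all $\theta\in[0,2\pi]$, $$\|D_f(e^{i\theta})\|\ge\lim_{r\to1^-}\frac{d}{dr}\mathcal{M}_\alpha(r)=\frac{\alpha}{2},$$ where, for $r\in[0,1)$, $\mathcal{M}_\alpha(r)=\frac{1}{2\pi}\int_0^{2\pi}K_\alpha(re^{i\epsilon})\,d\epsilon=\frac{[\Gamma(1+\frac{\alpha}{2})]^2}{\Gamma(1+\alpha)}F\left(-\frac{\alpha}{2},-\frac{\alpha}{2};1;r^2\right)$.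
   Context: $\mathbb{D}$ is the open unit disk in $\mathbb{C}$, $\overline{\mathbb{D}}$ its closure; $\mathcal{C}^2(\overline{\mathbb{D}})$ denotes complex-valued functions that are twice continuously differentiable on $\overline{\mathbb{D}}$ (up to the boundary). With $\frac{\partial}{\partial z}=\frac12(\frac{\partial}{\partial x}-i\frac{\partial}{\partial y})$, $\frac{\partial}{\partial\bar z}=\frac12(\frac{\partial}{\partial x}+i\frac{\partial}{\partial y})$ and $\Delta=4\frac{\partial^2}{\partial z\partial\bar z}$, for $\alpha\in\mathbb{R}$ the operator $T_\alpha$ is $$T_{\alpha}=-\frac{\alpha^{2}}{4}(1-|z|^{2})^{-\alpha-1}+\frac{\alpha}{2}(1-|z|^{2})^{-\alpha-1}\left(z\frac{\partial}{\partial z}+\bar z\frac{\partial}{\partial\bar z}\right)+\frac14(1-|z|^2)^{-\alpha}\Delta .$$ The Dirichlet problem means: $T_\alpha(f)=0$ in $\mathbb{D}$, and for a distribution $f^*\in\mathfrak{D}'(\partial\mathbb{D})$ the functions $f_r(e^{i\theta})=f(re^{i\theta})$, $r\in[0,1)$, converge to $f^*$ in $\mathfrak{D}'(\partial\mathbb{D})$ as $r\to1^-$. The kernel is $K_\alpha(z)=c_\alpha\frac{(1-|z|^2)^{\alpha+1}}{|1-z|^{\alpha+2}}$ with $c_\alpha=\frac{(\Gamma(\alpha/2+1))^2}{\Gamma(1+\alpha)}$, $\Gamma$ the Gamma function. $\|D_f(z)\|=|f_z(z)|+|f_{\bar z}(z)|$ (the operator norm of the real Jacobian matrix of $f$). The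 hypergeometric function is $F(a,b;c;x)=\sum_{n=0}^\infty\frac{(a)_n(b)_n}{(c)_n}\frac{x^n}{n!}$ for $|x|<1$, with $(a)_0=1$, $(a)_n=a(a+1)\cdots(a+n-1)$. *)

(* Defs.v *)
From Stdlib Require Import Reals Factorial.
From Coquelicot Require Import Coquelicot.

Open Scope R_scope.

Definition disk (z : C) : Prop := Cmod z < 1.
Definition closed_disk (z : C) : Prop := Cmod z <= 1.
Definition unit_circle (z : C) : Prop := Cmod z = 1.

(* e^{it} *)
Definition circ (t : R) : C := (cos t, sin t).

Definition is_image (f : C -> C) (A B : C -> Prop) : Prop :=
  forall w : C, (exists z : C, A z /\ f z = w) <-> B w.

Definition pdx (f : C -> C) (z : C) : C :=
  (Derive (fun t => Re (f (t, Im z))) (Re z),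
   Derive (fun t => Im (f (t, Im z))) (Re z)).

Definition pdy (f : C -> C) (z : C) : C :=
  (Derive (fun t => Re (f (Re z, t))) (Im z),
   Derive (fun t => Im (f (Re z, t))) (Im z)).

Definition dz (f : C -> C) (z : C) : C :=
  (RtoC (1 / 2) * (pdx f z - Ci * pdy f z))%C.

Definition dzbar (f : C -> C) (z : C) : C :=
  (RtoC (1 / 2) * (pdx f z + Ci * pdy f z))%C.

Definition Laplacian (f : C -> C) (z : C) : C :=
  (RtoC 4 * dz (dzbar f) z)%C.

(* C^k up to the boundary: the partial derivatives, which are taken in the open
   disk only, extend to functions of class C^{k-1} on the closed disk.  The
   values of f outside the closed disk play no role. *)
Fixpoint Ck_closed_disk (k : nat) (f : C -> C) : Prop :=
  (forall z : C, closed_disk z ->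
     filterlim f (within closed_disk (locally z)) (locally (f z))) /\
  match k with
  | O => True
  | S k' =>
      exists fx fy : C -> C,
        Ck_closed_disk k' fx /\ Ck_closed_disk k' fy /\
        forall x y : R, disk (x, y) ->
          is_derive (V := C_R_NormedModule) (fun t : R => f (t, y)) x (fx (x, y)) /\
          is_derive (V := C_R_NormedModule) (fun t : R => f (x, t)) y (fy (x, y))
  end.

(* Limit of g at z from inside the open disk: the value at z of the continuous
   extension of g to the closed disk, whenever there is one. *)
Definition disk_lim (g : C -> C) (z : C) : C :=
  iota (T := C_R_CompleteNormedModule)
    (fun l : C => filterlim g (within disk (locally z)) (locally l)).

(* |f_z| + |f_zbar| on the closed disk; on the unit circle f_z and f_zbar are the
   boundary values of the derivatives taken in the open disk. *)
Definition norm_D (f : C -> C) (z : C) : R :=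
  Cmod (disk_lim (dz f) z) + Cmod (disk_lim (dzbar f) z).

Definition T_op (alpha : R) (f : C -> C) (z : C) : C :=
  let rho := 1 - Cmod z ^ 2 in
  (RtoC (- (alpha ^ 2 / 4) * Rpower rho (- alpha - 1)) * f z
   + RtoC (alpha / 2 * Rpower rho (- alpha - 1))
     * (z * dz f z + Cconj z * dzbar f z)
   + RtoC (1 / 4 * Rpower rho (- alpha)) * Laplacian f z)%C.

(* Functions and distributions on the unit circle are given in the angular
   variable t: test functions are the smooth 2 PI-periodic functions R -> C. *)
Definition Cderive_n (phi : R -> C) (n : nat) (t : R) : C :=
  (Derive_n (fun s => Re (phi s)) n t, Derive_n (fun s => Im (phi s)) n t).

Definition test_function (phi : R -> C) : Prop :=
  (forall t : R, phi (t + 2 * PI) = phi t) /\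
  forall (n : nat) (t : R),
    ex_derive_n (fun s => Re (phi s)) n t /\
    ex_derive_n (fun s => Im (phi s)) n t.

(* A distribution is a linear functional on test functions that is continuous for
   the seminorms sup |phi^(k)|; u is unconstrained on other functions. *)
Definition is_distribution (u : (R -> C) -> C) : Prop :=
  (forall (a b : C) (phi psi : R -> C),
     test_function phi -> test_function psi ->
     u (fun t => a * phi t + b * psi t)%C = (a * u phi + b * u psi)%C) /\
  exists (N : nat) (A : R),
    forall (phi : R -> C) (B : R),
      test_function phi ->
      (forall (k : nat) (t : R), (k <= N)%nat -> Cmod (Cderive_n phi k t) <= B) ->
      Cmod (u phi) <= A * B.

(* A continuous function g on the circle is identified with the distribution
   phi |-> \int_0^{2 PI} g(t) phi(t) dt. *)
Definition regular_distribution (g : R -> C) (phi : R -> C) : C :=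
  RInt (V := C_R_CompleteNormedModule) (fun t => (g t * phi t)%C) 0 (2 * PI).

Definition Dirichlet_solution (alpha : R) (f : C -> C) (fstar : (R -> C) -> C) : Prop :=
  (forall z : C, disk z -> T_op alpha f z = RtoC 0) /\
  forall phi : R -> C, test_function phi ->
    filterlim
      (fun r : R => regular_distribution (fun t => f (RtoC r * circ t)%C) phi)
      (at_left 1) (locally (fstar phi)).

Definition Gamma (x : R) : R :=
  RInt_gen (fun t => Rpower t (x - 1) * exp (- t))
    (at_right 0) (Rbar_locally p_infty).

Fixpoint pochhammer (a : R) (n : nat) : R :=
  match n with
  | O => 1
  | S m => pochhammer a m * (a + INR m)
  end.

Definition hypergeometric (a b c x : R) : R :=
  Series (fun n => pochhammer a n * pochhammer b n / pochhammer c n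
                   * (x ^ n / INR (fact n))).

Definition c_const (alpha : R) : R :=
  Gamma (alpha / 2 + 1) ^ 2 / Gamma (1 + alpha).

Definition K_kernel (alpha : R) (z : C) : R :=
  c_const alpha * (Rpower (1 - Cmod z ^ 2) (alpha + 1)
                   / Rpower (Cmod (RtoC 1 - z)%C) (alpha + 2)).

Definition M_mean (alpha r : R) : R :=
  1 / (2 * PI) * RInt (fun t => K_kernel alpha (RtoC r * circ t)%C) 0 (2 * PI).

(* Main.v *)
Require Import Defs.
From Stdlib Require Import Reals Arith Lra Lia.
From Coquelicot Require Import Coquelicot.

(** For [alpha > 0] the Laplacian term of the equation carries the factor
    [1 - |z|^2], so letting [|z|] tend to 1 in [T_alpha f = 0] leaves
    [r df/dr = (alpha / 2) f] on the circle, where [|f| = 1]; this gives the lower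
    bound.  The mean of the kernel, [F (-alpha/2, -alpha/2; 1; r^2)] and the mean of
    [|1 - r e^{it}|^alpha] are regular solutions of the same radial equation, so they
    agree up to constants.  The last one has a limit at [r = 1], a Wallis integral,
    which equals [Gamma (1 + alpha) / Gamma (1 + alpha/2)^2] because both sides
    satisfy the same recursion and have the same growth; its derivative tends to
    [alpha / 2] times that limit.

    For [alpha = 0], let [u = Re (conj (f zeta) f)] and [w = 1 - u].  Then
    [0 <= w <= 2] and [w] has mean 1, and the Poisson integral of such a weight at
    distance [c] from the origin is at least [(1 - c^2) / PI], the extremal weight
    being twice the indicator of the opposite half circle.  Hence
    [u (c zeta) <= 1 - (1 - c^2) / PI] while [u zeta = 1], and the radial derivative
    of [u] at [zeta] is at least [2 / PI]. *)

(** * The Gamma function *)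

(** The kernel mean cannot be read off at [r = 1]: its factor [(1 - r^2)^(alpha+1)] tends to 0 while
    the integral blows up. Passing to the mean of [|1 - r e^{it}|^alpha] is Euler's transformation
    of the hypergeometric function, and yields a bounded quantity that increases with [r]. The
    radial equation is singular at 0; written for [y] and [p = r y'], regularity becomes [p 0 = 0],
    and this kills the Wronskian. The value at 1 is Gauss's sum [F(-g, -g; 1; 1)] with
    [g = alpha / 2]. It is identified in the spirit of the Bohr-Mollerup theorem: the recursion
    fixes the integers, and a growth comparison over one period fixes the rest.

    In the harmonic case every integral is over a circle inside the open disk. The integral of
    [poisson (c / s)] against [U] on the circle of radius [s] does not depend on [s]: radii close to
    [c] recover the value of [U] at distance [c], radii close to 1 give the bound. The constant
    [2 / PI] is the limit of [(1 - c^2) / (PI (1 - c)) = (1 + c) / PI]. *)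

Lemma exp_le_compat (x y : R) : x <= y -> exp x <= exp y.
Proof.
  intros [H|H]; [left; now apply exp_increasing|rewrite H; lra].
Qed.

Lemma is_derive_Rpower (x p : R) :
  0 < x -> is_derive (fun t => Rpower t p) x (p * Rpower x (p - 1)).
Proof.
  intros Hx. apply is_derive_Reals. now apply derivable_pt_lim_power.
Qed.

Lemma continuous_Rpower (x p : R) : 0 < x -> continuous (fun t => Rpower t p) x.
Proof.
  intros Hx. apply (ex_derive_continuous (V := R_NormedModule)).
  eexists. now apply is_derive_Rpower.
Qed.

Lemma Rpower_pos (x p : R) : 0 < Rpower x p.
Proof. apply exp_pos. Qed.

Lemma Rpower_succ (x p : R) : 0 < x -> Rpower x (p + 1) = Rpower x p * x.
Proof. intros Hx. now rewrite Rpower_plus, Rpower_1. Qed.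

Lemma filter_prod_half_line (P : R * R -> Prop) (a0 b0 : R) :
  0 < a0 -> (forall a b, 0 < a < a0 -> b0 < b -> P (a, b)) ->
  filter_prod (at_right 0) (Rbar_locally p_infty) P.
Proof.
  intros Ha0 H.
  apply Filter_prod with (fun a => 0 < a < a0) (fun b => b0 < b).
  - exists (mkposreal a0 Ha0). intros y Hy Hy0. split; [exact Hy0|].
    change (Rabs (y - 0) < a0) in Hy. rewrite Rminus_0_r in Hy.
    apply Rabs_def2 in Hy; lra.
  - now exists b0.
  - exact H.
Qed.

(** Enlarging the interval increases the integral, so the supremum of the integrals is their limit.
    The second clause is kept because it bounds the limit from below, which gives the positivity of
    [Gamma]. *)
Lemma is_RInt_gen_pos (f : R -> R) (B : R) :
  (forall t, 0 < t -> continuous f t) -> (forall t, 0 < t -> 0 <= f t) ->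
  (forall a b, 0 < a -> a < b -> RInt f a b <= B) ->
  exists l, is_RInt_gen f (at_right 0) (Rbar_locally p_infty) l /\
    forall a b, 0 < a -> a < b -> RInt f a b <= l.
Proof.
  intros Hc Hp HB.
  assert (Hex : forall a b, 0 < a -> 0 < b -> ex_RInt f a b).
  { intros a b Ha Hb. apply (ex_RInt_continuous (V := R_CompleteNormedModule)).
    intros z [Hz _]. apply Hc. apply Rlt_le_trans with (2 := Hz).
    now apply Rmin_glb_lt. }
  destruct (completeness (fun y => exists a b, 0 < a /\ a < b /\ y = RInt f a b))
    as [l [Hub Hlub]].
  { exists B. intros y (a & b & Ha & Hab & ->). now apply HB. }
  { exists (RInt f 1 2), 1, 2. repeat split; lra. }
  exists l. split.
  - intros P [eps Heps].
    assert (Hl : exists a b, 0 < a /\ a < b /\ l - eps < RInt f a b).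
    { apply Classical_Prop.NNPP. intros Hn.
      assert (l <= l - eps).
      { apply Hlub. intros y (a & b & Ha & Hab & ->).
        apply Rnot_lt_le. intros Hlt. apply Hn. now exists a, b. }
      destruct eps as [e He]. simpl in *. lra. }
    destruct Hl as (a0 & b0 & Ha0 & Hab0 & Hl).
    apply filter_prod_half_line with a0 b0; [exact Ha0|].
    intros a b Ha Hb. exists (RInt f a b). split.
    + apply (RInt_correct (V := R_CompleteNormedModule)). apply Hex; simpl; lra.
    + apply Heps. change (Rabs (RInt f a b - l) < eps).
      assert (RInt f a b <= l).
      { apply Hub. exists a, b. repeat split; lra. }
      assert (E : RInt f a b = RInt f a a0 + (RInt f a0 b0 + RInt f b0 b)).
      { rewrite <- (RInt_Chasles f a a0 b); [|apply Hex; lra ..].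
        rewrite <- (RInt_Chasles f a0 b0 b); [|apply Hex; lra ..]. reflexivity. }
      assert (0 <= RInt f a a0).
      { apply RInt_ge_0; [lra|apply Hex; lra|intros; apply Hp; lra]. }
      assert (0 <= RInt f b0 b).
      { apply RInt_ge_0; [lra|apply Hex; lra|intros; apply Hp; lra]. }
      apply Rabs_def1; destruct eps as [e He]; simpl in *; lra.
  - intros a b Ha Hab. apply Hub. now exists a, b.
Qed.

Definition gamma_integrand (x t : R) : R := Rpower t (x - 1) * exp (- t).

Lemma gamma_integrand_pos (x t : R) : 0 < gamma_integrand x t.
Proof. apply Rmult_lt_0_compat; [apply Rpower_pos|apply exp_pos]. Qed.

Lemma gamma_integrand_continuous (x t : R) :
  0 < t -> continuous (gamma_integrand x) t.
Proof.
  intros Ht. apply (continuous_mult (fun t => Rpower t (x - 1)) (fun t => exp (- t))).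
  - now apply continuous_Rpower.
  - apply (ex_derive_continuous (V := R_NormedModule)). auto_derive. trivial.
Qed.

Lemma gamma_integrand_le (x : R) : 1 <= x ->
  exists C, 0 < C /\ forall t, 0 < t -> gamma_integrand x t <= C * exp (- (t / 2)).
Proof.
  (* With [a = 2 * x] the bound [ln t <= t / a + ln a] costs at most [t / 2] after multiplication by
     [x - 1], so half of the exponential decay survives. *)
  intros Hx. set (a := 2 * x). exists (exp ((x - 1) * ln a)).
  split; [apply exp_pos|].
  intros t Ht. unfold gamma_integrand, Rpower. rewrite <- !exp_plus.
  assert (Ha : 0 < a) by (unfold a; lra).
  assert (Hln : ln t <= t / a + ln a).
  { replace t with ((t / a) * a) at 1 by (field; lra).
    rewrite ln_mult; [|apply Rdiv_lt_0_compat; lra|lra].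
    assert (0 < t / a) by (apply Rdiv_lt_0_compat; lra).
    assert (t / a + 1 <= exp (t / a)) by (pose proof (exp_ineq1_le (t / a)); lra).
    assert (ln (t / a) < ln (exp (t / a))) by (apply ln_increasing; lra).
    rewrite ln_exp in *. lra. }
  assert (Hm : (x - 1) * ln t <= (x - 1) * (t / a + ln a))
    by (apply Rmult_le_compat_l; lra).
  assert (H2 : (x - 1) * (t / a) <= t / 2).
  { unfold a. replace ((x - 1) * (t / (2 * x))) with (t / 2 * ((x - 1) / x)) by (field; lra).
    rewrite <- (Rmult_1_r (t / 2)) at 2. apply Rmult_le_compat_l; [lra|].
    apply Rle_div_l; lra. }
  destruct (Rle_lt_or_eq_dec ((x - 1) * ln t + - t) ((x - 1) * ln a + - (t / 2))) as [H|H].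
  - lra.
  - left. now apply exp_increasing.
  - rewrite H. lra.
Qed.

(** For [1 <= x] the integrand is also bounded near 0, so a single exponential majorant serves on
    the whole half line. *)
Lemma is_RInt_gen_Gamma (x : R) : 1 <= x ->
  is_RInt_gen (gamma_integrand x) (at_right 0) (Rbar_locally p_infty) (Gamma x)
  /\ 0 < Gamma x.
Proof.
  intros Hx. destruct (gamma_integrand_le x Hx) as (C & HC & HCb).
  destruct (is_RInt_gen_pos (gamma_integrand x) (2 * C)) as (l & Hl & Hle).
  - apply gamma_integrand_continuous.
  - intros; left; apply gamma_integrand_pos.
  - intros a b Ha Hab.
    assert (HI : is_RInt (fun t => C * exp (- (t / 2))) a b
             (minus (- 2 * C * exp (- (b / 2))) (- 2 * C * exp (- (a / 2))))).
    { apply (is_RInt_derive (fun t => - 2 * C * exp (- (t / 2)))).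
      - intros t _. auto_derive; [trivial|unfold Rdiv; field].
      - intros t _. apply (ex_derive_continuous (V := R_NormedModule)).
        auto_derive. trivial. }
    apply Rle_trans with (RInt (fun t => C * exp (- (t / 2))) a b).
    + apply RInt_le; [lra| |now eexists; apply HI|].
      * apply (ex_RInt_continuous (V := R_CompleteNormedModule)).
        intros z [Hz _]. apply gamma_integrand_continuous.
        rewrite Rmin_left in Hz; lra.
      * intros t Ht. apply HCb. lra.
    + rewrite (is_RInt_unique _ _ _ _ HI). unfold minus, plus, opp; simpl.
      assert (exp (- (a / 2)) < 1).
      { rewrite <- exp_0. apply exp_increasing. lra. }
      pose proof (exp_pos (- (b / 2))). nra.
  - assert (E : Gamma x = l).
    { exact (is_RInt_gen_unique (V := R_CompleteNormedModule) _ _ Hl). }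
    rewrite E. split; [exact Hl|].
    apply Rlt_le_trans with (2 := Hle 1 2 Rlt_0_1 ltac:(lra)).
    apply RInt_gt_0; [lra| |].
    + intros; apply gamma_integrand_pos.
    + intros; apply gamma_integrand_continuous; lra.
Qed.

Lemma Gamma_pos (x : R) : 1 <= x -> 0 < Gamma x.
Proof. intros Hx. now apply is_RInt_gen_Gamma. Qed.

Lemma is_RInt_gen_Derive_half_line (F f : R -> R) (la lb : R) :
  (forall t, 0 < t -> is_derive F t (f t)) -> (forall t, 0 < t -> continuous f t) ->
  filterlim F (at_right 0) (locally la) ->
  filterlim F (Rbar_locally p_infty) (locally lb) ->
  is_RInt_gen f (at_right 0) (Rbar_locally p_infty) (lb - la).
Proof.
  intros HF Hf Ha Hb.
  assert (HD : forall t, 0 < t -> Derive F t = f t)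
    by (intros; now apply is_derive_unique, HF).
  apply is_RInt_gen_ext with (Derive F).
  - apply filter_prod_half_line with 1 1; [lra|]. simpl. intros a b H1 H2 t Ht.
    apply HD. rewrite Rmin_left in Ht; lra.
  - apply is_RInt_gen_Derive; [| |exact Ha|exact Hb].
    + apply filter_prod_half_line with 1 1; [lra|]. simpl. intros a b H1 H2 t Ht.
      rewrite Rmin_left in Ht by lra. eexists. apply HF. lra.
    + apply filter_prod_half_line with 1 1; [lra|]. simpl. intros a b H1 H2 t Ht.
      rewrite Rmin_left in Ht by lra. apply continuous_ext_loc with f.
      * assert (Ht0 : 0 < t) by lra. exists (mkposreal t Ht0). intros y Hy.
        symmetry. apply HD. change (Rabs (y - t) < t) in Hy.
        apply Rabs_def2 in Hy. lra.
      * apply Hf. lra.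
Qed.

Lemma exp_neg_lim (C k : R) : 0 < k ->
  filterlim (fun t => C * exp (- (t / k))) (Rbar_locally p_infty) (locally 0).
Proof.
  intros Hk P [eps Heps]. destruct eps as [e He].
  exists (k * (Rabs C / e)). intros t Ht. apply Heps.
  change (Rabs (C * exp (- (t / k)) - 0) < e). rewrite Rminus_0_r.
  rewrite Rabs_mult, (Rabs_pos_eq (exp _)) by (left; apply exp_pos).
  assert (H1 : Rabs C / e < t / k) by (apply (Rlt_div_r _ _ k Hk); lra).
  assert (H2 : 1 + t / k <= exp (t / k)) by apply exp_ineq1_le.
  assert (H3 : Rabs C < exp (t / k) * e) by (apply (Rlt_div_l _ _ e He); lra).
  rewrite exp_Ropp. apply Rmult_lt_reg_r with (exp (t / k)); [apply exp_pos|].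
  rewrite Rmult_assoc, Rinv_l by (apply Rgt_not_eq, exp_pos). lra.
Qed.

Lemma Gamma_1 : Gamma 1 = 1.
Proof.
  assert (H : is_RInt_gen (gamma_integrand 1) (at_right 0) (Rbar_locally p_infty) (0 - - (1))).
  2: { pose proof (is_RInt_gen_unique (V := R_CompleteNormedModule) _ _ H) as E.
       change (Gamma 1 = 0 - - (1)) in E. lra. }
  apply (is_RInt_gen_Derive_half_line (fun t => - exp (- t))).
  - intros t Ht. unfold gamma_integrand. replace (1 - 1) with 0 by ring. rewrite Rpower_O by exact Ht.
    auto_derive; [trivial|ring].
  - apply (gamma_integrand_continuous 1).
  - apply (filterlim_filter_le_1 (F := locally 0) (G := at_right 0)); [apply filter_le_within|].
    replace (- (1)) with (- exp (- 0)) by (rewrite Ropp_0, exp_0; ring).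
    apply (ex_derive_continuous (V := R_NormedModule) (fun t => - exp (- t))).
    auto_derive. trivial.
  - apply filterlim_ext with (fun t => - (1) * exp (- (t / 1))).
    { intros t. rewrite Rdiv_1_r. ring. }
    apply exp_neg_lim. lra.
Qed.

(** Integration by parts: [x * gamma_integrand x - gamma_integrand (x + 1)] is the derivative of
    [t^x e^{-t}], which vanishes at both ends. *)
Lemma Gamma_succ (x : R) : 1 <= x -> Gamma (x + 1) = x * Gamma x.
Proof.
  intros Hx.
  destruct (is_RInt_gen_Gamma x Hx) as [H1 _].
  destruct (is_RInt_gen_Gamma (x + 1)) as [H2 _]; [lra|].
  assert (H3 : is_RInt_gen (fun t => x * gamma_integrand x t - gamma_integrand (x + 1) t)
                 (at_right 0) (Rbar_locally p_infty) (x * Gamma x - Gamma (x + 1))).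
  { apply (is_RInt_gen_minus (V := R_NormedModule) (fun t => x * gamma_integrand x t)).
    - now apply (is_RInt_gen_scal (V := R_NormedModule)).
    - exact H2. }
  assert (H4 : is_RInt_gen (fun t => x * gamma_integrand x t - gamma_integrand (x + 1) t)
                 (at_right 0) (Rbar_locally p_infty) (0 - 0)).
  { apply (is_RInt_gen_Derive_half_line (gamma_integrand (x + 1))).
    - intros t Ht. unfold gamma_integrand. replace (x + 1 - 1) with x by ring.
      evar_last.
      { apply (is_derive_mult (fun t => Rpower t x) (fun t => exp (- t))).
        - now apply is_derive_Rpower.
        - auto_derive; [trivial|reflexivity].
        - intros; apply Rmult_comm. }
      unfold plus, mult; simpl. ring.
    - intros t Ht. apply (continuous_minus (V := R_NormedModule)).
      + apply (continuous_mult (fun _ => x) (gamma_integrand x)).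
        * apply continuous_const.
        * now apply gamma_integrand_continuous.
      + now apply gamma_integrand_continuous.
    (* On [(0, 1)] one has [t^x e^{-t} <= t], because [t^(x-1) <= 1] for [1 <= x]. *)
    - apply (filterlim_le_le (F := at_right 0) (fun _ => 0) _ (fun t => t) (Finite 0)).
      + exists (mkposreal 1 Rlt_0_1). intros t Ht Ht0.
        change (Rabs (t - 0) < 1) in Ht. rewrite Rminus_0_r in Ht. apply Rabs_def2 in Ht.
        split; [left; apply gamma_integrand_pos|].
        unfold gamma_integrand. replace (x + 1 - 1) with ((x - 1) + 1) by ring.
        rewrite Rpower_succ by exact Ht0.
        assert (Rpower t (x - 1) <= 1).
        { apply Rle_trans with (exp 0); [|rewrite exp_0; lra]. apply exp_le_compat.
          assert (H : ln t < ln 1) by (apply ln_increasing; lra). rewrite ln_1 in H. nra. }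
        assert (exp (- t) <= 1).
        { rewrite <- exp_0. apply exp_le_compat. lra. }
        pose proof (Rpower_pos t (x - 1)). pose proof (exp_pos (- t)).
        assert (Rpower t (x - 1) * exp (- t) <= 1 * 1)
          by (apply Rmult_le_compat; lra). nra.
      + apply (filterlim_const (0:R)).
      + apply (filterlim_filter_le_1 (F := locally 0) (G := at_right 0)); [apply filter_le_within|].
        apply filterlim_id.
    - destruct (gamma_integrand_le (x + 1)) as (C & HC & HCb); [lra|].
      apply (filterlim_le_le (F := Rbar_locally p_infty) (fun _ => 0) _
               (fun t => C * exp (- (t / 2))) (Finite 0)).
      + exists 0. intros t Ht. split; [left; apply gamma_integrand_pos|now apply HCb].
      + apply (filterlim_const (0:R)).
      + apply exp_neg_lim; lra. }
  pose proof (is_RInt_gen_unique (V := R_CompleteNormedModule) _ _ H3) as E3.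
  pose proof (is_RInt_gen_unique (V := R_CompleteNormedModule) _ _ H4) as E4.
  rewrite E3 in E4. lra.
Qed.

(* Tangent line of the concave function [t |-> t^s] at [x]. *)
Lemma Rpower_le_tangent (t x s : R) : 0 < t -> 0 < x -> 0 <= s <= 1 ->
  Rpower t s <= Rpower x s * (1 + s * (t / x - 1)).
Proof.
  intros Ht Hx Hs.
  assert (Hu : 0 < t / x) by now apply Rdiv_lt_0_compat.
  replace t with (x * (t / x)) at 1 by (field; lra).
  rewrite <- Rpower_mult_distr by assumption.
  apply Rmult_le_compat_l; [left; apply Rpower_pos|].
  set (u := t / x) in *. clearbody u.
  assert (Hw : 0 < 1 + s * (u - 1)) by nra.
  set (w := 1 + s * (u - 1)) in *.
  assert (Hln : forall v, 0 < v -> ln v <= v - 1).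
  { intros v Hv. assert (v <= exp (v - 1)) by (pose proof (exp_ineq1_le (v - 1)); lra).
    rewrite <- (ln_exp (v - 1)). destruct (Req_dec v (exp (v - 1))) as [E|E].
    - rewrite <- E. lra.
    - left. apply ln_increasing; lra. }
  (* Jensen's inequality for [ln]: [w] is the mean of [u] and 1 with weights [s] and [1 - s], so the
     weighted sum of the two tangent bounds has right side 0. *)
  assert (H1 : ln (u / w) <= u / w - 1) by (apply Hln, Rdiv_lt_0_compat; lra).
  assert (H2 : ln (1 / w) <= 1 / w - 1) by (apply Hln, Rdiv_lt_0_compat; lra).
  unfold Rdiv in H1, H2. rewrite ln_mult, ln_Rinv in H1 by (auto; now apply Rinv_0_lt_compat).
  rewrite ln_mult, ln_Rinv, ln_1 in H2 by (auto; try lra; now apply Rinv_0_lt_compat).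
  assert (H3 : s * (u * / w - 1) + (1 - s) * (1 * / w - 1) = 0).
  { unfold w in *. field. lra. }
  assert (H4 : s * ln u <= ln w) by nra.
  unfold Rpower. rewrite <- (exp_ln w Hw). now apply exp_le_compat.
Qed.

(** Wendel's inequality. The tangent is taken at [x] because [x = Gamma (x + 1) / Gamma x] is the
    mean of [t] for the density [t^(x-1) e^{-t}], so the linear term integrates to 0. *)
Lemma Gamma_add_le (x s : R) : 1 <= x -> 0 <= s <= 1 ->
  Gamma (x + s) <= Rpower x s * Gamma x.
Proof.
  intros Hx Hs.
  destruct (is_RInt_gen_Gamma x Hx) as [H1 _].
  destruct (is_RInt_gen_Gamma (x + 1)) as [H2 _]; [lra|].
  destruct (is_RInt_gen_Gamma (x + s)) as [H3 _]; [lra|].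
  set (A := Rpower x s).
  assert (H4 : is_RInt_gen (fun t => A * (1 - s) * gamma_integrand x t
                                     + A * s / x * gamma_integrand (x + 1) t)
                 (at_right 0) (Rbar_locally p_infty)
                 (A * (1 - s) * Gamma x + A * s / x * Gamma (x + 1))).
  { apply (is_RInt_gen_plus (V := R_NormedModule) (fun t => A * (1 - s) * gamma_integrand x t)).
    - now apply (is_RInt_gen_scal (V := R_NormedModule)).
    - now apply (is_RInt_gen_scal (V := R_NormedModule)). }
  rewrite Gamma_succ in H4 by exact Hx.
  replace (A * (1 - s) * Gamma x + A * s / x * (x * Gamma x)) with (A * Gamma x) in H4
    by (field; lra).
  apply Rle_trans with (norm (Gamma (x + s))); [apply Rle_abs|].
  refine (RInt_gen_norm (V := R_CompleteNormedModule) _ _ _ _ _ _ H3 H4).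
  - apply filter_prod_half_line with 1 1; [lra|]. simpl. intros; lra.
  - apply filter_prod_half_line with 1 1; [lra|]. simpl. intros a b Ha Hb t Ht.
    assert (Ht0 : 0 < t) by lra.
    change (Rabs (gamma_integrand (x + s) t) <= A * (1 - s) * gamma_integrand x t
               + A * s / x * gamma_integrand (x + 1) t).
    rewrite Rabs_pos_eq by (left; apply gamma_integrand_pos).
    unfold gamma_integrand.
    replace (x + s - 1) with ((x - 1) + s) by ring.
    replace (x + 1 - 1) with ((x - 1) + 1) by ring.
    rewrite (Rpower_plus (x - 1) s), Rpower_succ by exact Ht0.
    pose proof (Rpower_le_tangent t x s Ht0 ltac:(lra) Hs) as HT. fold A in HT.
    pose proof (Rpower_pos t (x - 1)). pose proof (exp_pos (- t)).
    apply Rle_trans with (Rpower t (x - 1) * exp (- t) * (A * (1 + s * (t / x - 1)))).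
    + replace (Rpower t (x - 1) * Rpower t s * exp (- t))
        with (Rpower t (x - 1) * exp (- t) * Rpower t s) by ring.
      apply Rmult_le_compat_l; [nra|exact HT].
    + right. field. lra.
Qed.

(** The companion bound comes from the upper one, based at [x + s] with the complementary exponent
    [1 - s]. *)
Lemma Gamma_add_ge (x s : R) : 1 <= x -> 0 <= s <= 1 ->
  x * Gamma x <= Rpower (x + s) (1 - s) * Gamma (x + s).
Proof.
  intros Hx Hs. rewrite <- Gamma_succ by exact Hx.
  replace (x + 1) with ((x + s) + (1 - s)) by ring. apply Gamma_add_le; lra.
Qed.

(** The central binomial coefficient [binom (2 g) g], continued to real [g]. *)
Definition gamma_ratio (g : R) : R := Gamma (1 + 2 * g) / Gamma (1 + g) ^ 2.

Lemma gamma_ratio_pos (g : R) : 0 <= g -> 0 < gamma_ratio g.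
Proof.
  intros Hg. apply Rdiv_lt_0_compat; [|apply pow_lt]; apply Gamma_pos; lra.
Qed.

Lemma gamma_ratio_rec (g : R) : 0 <= g ->
  (g + 1) * gamma_ratio (g + 1) = 2 * (2 * g + 1) * gamma_ratio g.
Proof.
  intros Hg. unfold gamma_ratio.
  replace (1 + 2 * (g + 1)) with ((1 + 2 * g + 1) + 1) by ring.
  replace (1 + (g + 1)) with ((1 + g) + 1) by ring.
  rewrite !Gamma_succ by lra.
  pose proof (Gamma_pos (1 + g)). field. lra.
Qed.

(** Together with [gamma_ratio_le] this says that [gamma_ratio (m + s) / gamma_ratio m] tends to
    [4^s] as [m] grows. Wendel's inequalities allow shifts of at most 1, so the shift [2 s] of the
    numerator is done in two steps of size [s]. *)
Lemma gamma_ratio_ge (m s : R) : 0 <= m -> 0 <= s <= 1 ->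
  gamma_ratio m * (Rpower 2 s * (2 * m + 1)) ^ 2 <= gamma_ratio (m + s) * (2 * m + 3) ^ 2.
Proof.
  intros Hm Hs. unfold gamma_ratio. set (x := 1 + 2 * m).
  (* The base [x + 2] dominates both [x + s] and [x + s + s], so one [k] serves for both steps. *)
  set (k := Rpower (x + 2) (1 - s)).
  pose proof (Rpower_pos (x + 2) (1 - s)) as Hk. fold k in Hk.
  pose proof (Gamma_pos x ltac:(unfold x; lra)) as P0.
  pose proof (Gamma_pos (x + s) ltac:(unfold x; lra)) as P1.
  pose proof (Gamma_pos (x + s + s) ltac:(unfold x; lra)) as P2.
  pose proof (Gamma_pos (1 + m) ltac:(lra)) as P3.
  pose proof (Gamma_pos (1 + m + s) ltac:(lra)) as P4.
  assert (H1 : x * Gamma x <= k * Gamma (x + s)).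
  { apply Rle_trans with (1 := Gamma_add_ge x s ltac:(unfold x; lra) Hs).
    apply Rmult_le_compat_r; [lra|]. apply Rle_Rpower_l; unfold x; lra. }
  assert (H2 : (x + s) * Gamma (x + s) <= k * Gamma (x + s + s)).
  { apply Rle_trans with (1 := Gamma_add_ge (x + s) s ltac:(unfold x; lra) Hs).
    apply Rmult_le_compat_r; [lra|]. apply Rle_Rpower_l; unfold x; lra. }
  assert (H3 : x ^ 2 * Gamma x <= k ^ 2 * Gamma (x + s + s)).
  { assert (Hx : 1 <= x) by (unfold x; lra).
    apply Rle_trans with (k * (x * Gamma (x + s))); [nra|].
    replace (k ^ 2 * Gamma (x + s + s)) with (k * (k * Gamma (x + s + s))) by ring.
    apply Rmult_le_compat_l; [lra|]. nra. }
  pose proof (Gamma_add_le (1 + m) s ltac:(lra) Hs) as H4.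
  set (p := Rpower (1 + m) s) in *. pose proof (Rpower_pos (1 + m) s) as Hp. fold p in Hp.
  set (T := Rpower 2 s). pose proof (Rpower_pos 2 s) as HT. fold T in HT.
  (* Here [T * p] is [(2 m + 2)^s] and [2 m + 2 <= x + 2], so the exponents [1 - s] and [s]
     recombine to 1. *)
  assert (H5 : k * (T * p) <= x + 2).
  { unfold T, p. rewrite Rpower_mult_distr by lra.
    apply Rle_trans with (k * Rpower (x + 2) s).
    - apply Rmult_le_compat_l; [lra|]. apply Rle_Rpower_l; unfold x; lra.
    - unfold k. rewrite <- Rpower_plus. replace (1 - s + s) with 1 by ring.
      rewrite Rpower_1; unfold x; lra. }
  replace (1 + 2 * (m + s)) with (x + s + s) by (unfold x; ring).
  replace (1 + (m + s)) with (1 + m + s) by ring.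
  replace (2 * m + 1) with x by (unfold x; ring).
  replace (2 * m + 3) with (x + 2) by (unfold x; ring).
  assert (E1 : Gamma (x + s + s) / Gamma (1 + m + s) ^ 2
               >= Gamma (x + s + s) / (p * Gamma (1 + m)) ^ 2).
  { apply Rle_ge, Rmult_le_compat_l; [lra|]. apply Rinv_le_contravar; [apply pow_lt; lra|].
    apply pow_incr. lra. }
  apply Rle_trans with (Gamma (x + s + s) / (p * Gamma (1 + m)) ^ 2 * (x + 2) ^ 2).
  2: { apply Rmult_le_compat_r; [apply pow2_ge_0|lra]. }
  apply Rle_trans with (Gamma (x + s + s) / (p * Gamma (1 + m)) ^ 2 * (k * (T * p)) ^ 2).
  2: { apply Rmult_le_compat_l; [left; apply Rdiv_lt_0_compat; [lra|apply pow_lt; nra]|].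
       apply pow_incr. split; [|exact H5]. left. apply Rmult_lt_0_compat; nra. }
  replace (Gamma x / Gamma (1 + m) ^ 2 * (T * x) ^ 2)
    with (T ^ 2 / Gamma (1 + m) ^ 2 * (x ^ 2 * Gamma x)) by (field; lra).
  replace (Gamma (x + s + s) / (p * Gamma (1 + m)) ^ 2 * (k * (T * p)) ^ 2)
    with (T ^ 2 / Gamma (1 + m) ^ 2 * (k ^ 2 * Gamma (x + s + s))) by (field; lra).
  apply Rmult_le_compat_l; [|exact H3].
  left. apply Rdiv_lt_0_compat; apply pow_lt; lra.
Qed.

Lemma gamma_ratio_le (m s : R) : 0 <= m -> 0 <= s <= 1 ->
  gamma_ratio (m + s) * (m + 1) ^ 2 <= gamma_ratio m * (Rpower 2 s * (m + 2)) ^ 2.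
Proof.
  intros Hm Hs. unfold gamma_ratio. set (x := 1 + 2 * m).
  set (k := Rpower (m + 2) (1 - s)).
  pose proof (Rpower_pos (m + 2) (1 - s)) as Hk. fold k in Hk.
  pose proof (Gamma_pos x ltac:(unfold x; lra)) as P0.
  pose proof (Gamma_pos (x + s) ltac:(unfold x; lra)) as P1.
  pose proof (Gamma_pos (x + s + s) ltac:(unfold x; lra)) as P2.
  pose proof (Gamma_pos (1 + m) ltac:(lra)) as P3.
  pose proof (Gamma_pos (1 + m + s) ltac:(lra)) as P4.
  set (q := Rpower (2 * (m + 2)) s). pose proof (Rpower_pos (2 * (m + 2)) s) as Hq. fold q in Hq.
  assert (H1 : Gamma (x + s) <= q * Gamma x).
  { apply Rle_trans with (1 := Gamma_add_le x s ltac:(unfold x; lra) Hs).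
    apply Rmult_le_compat_r; [lra|]. apply Rle_Rpower_l; unfold x; lra. }
  assert (H2 : Gamma (x + s + s) <= q * Gamma (x + s)).
  { apply Rle_trans with (1 := Gamma_add_le (x + s) s ltac:(unfold x; lra) Hs).
    apply Rmult_le_compat_r; [lra|]. apply Rle_Rpower_l; unfold x; lra. }
  assert (H3 : Gamma (x + s + s) <= q ^ 2 * Gamma x) by nra.
  assert (H4 : (1 + m) * Gamma (1 + m) <= k * Gamma (1 + m + s)).
  { apply Rle_trans with (1 := Gamma_add_ge (1 + m) s ltac:(lra) Hs).
    apply Rmult_le_compat_r; [lra|]. apply Rle_Rpower_l; lra. }
  set (T := Rpower 2 s). pose proof (Rpower_pos 2 s) as HT. fold T in HT.
  assert (H5 : q * k = T * (m + 2)).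
  { unfold q, k, T. rewrite <- Rpower_mult_distr by lra.
    rewrite Rmult_assoc, <- Rpower_plus. replace (s + (1 - s)) with 1 by ring.
    rewrite Rpower_1; lra. }
  replace (1 + 2 * (m + s)) with (x + s + s) by (unfold x; ring).
  replace (1 + (m + s)) with (1 + m + s) by ring.
  rewrite <- H5.
  apply Rle_trans with (q ^ 2 * Gamma x / Gamma (1 + m + s) ^ 2 * (m + 1) ^ 2).
  { apply Rmult_le_compat_r; [apply pow2_ge_0|]. apply Rmult_le_compat_r; [|exact H3].
    left. apply Rinv_0_lt_compat, pow_lt; lra. }
  replace (q ^ 2 * Gamma x / Gamma (1 + m + s) ^ 2 * (m + 1) ^ 2)
    with (q ^ 2 * Gamma x / (Gamma (1 + m + s) * Gamma (1 + m)) ^ 2 * ((1 + m) * Gamma (1 + m)) ^ 2)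
    by (field; lra).
  replace (Gamma x / Gamma (1 + m) ^ 2 * (q * k) ^ 2)
    with (q ^ 2 * Gamma x / (Gamma (1 + m + s) * Gamma (1 + m)) ^ 2 * (k * Gamma (1 + m + s)) ^ 2)
    by (field; lra).
  apply Rmult_le_compat_l.
  - left. apply Rdiv_lt_0_compat; [apply Rmult_lt_0_compat; [apply pow_lt; lra|lra]|].
    apply pow_lt; nra.
  - apply pow_incr. split; [nra|exact H4].
Qed.

(** * Characterization of [gamma_ratio] by its recursion and growth *)

Lemma le_of_le_add_inv (a b c : R) :
  (forall m : nat, a <= b + c / (INR m + 1)) -> a <= b.
Proof.
  intros H. apply Rnot_lt_le. intros Hlt.
  destruct (INR_unbounded (c / (a - b))) as [m Hm].
  specialize (H m). pose proof (pos_INR m).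
  assert (c / (a - b) < INR m + 1) by lra.
  apply (Rlt_div_l c (INR m + 1) (a - b)) in H1; [|lra].
  assert (c / (INR m + 1) < a - b) by (apply Rlt_div_l; lra). lra.
Qed.

(* The quotient [l / gamma_ratio] has period 1 and is squeezed to 1 at infinity. *)
Lemma gamma_ratio_unique (l : R -> R) :
  l 0 = 1 ->
  (forall g, 0 <= g -> (g + 1) * l (g + 1) = 2 * (2 * g + 1) * l g) ->
  (forall g h, 0 <= g <= h -> l h * Rpower 4 g <= l g * Rpower 4 h) ->
  forall g, 0 <= g -> l g = gamma_ratio g.
Proof.
  intros Hl0 Hrec Hmon.
  assert (R0 : gamma_ratio 0 = 1).
  { unfold gamma_ratio. rewrite Rmult_0_r, Rplus_0_r, Gamma_1. field. }
  assert (Hstep : forall g (c : R), 0 <= g -> l g = c * gamma_ratio g ->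
                    l (g + 1) = c * gamma_ratio (g + 1)).
  { intros g c Hg E. apply Rmult_eq_reg_l with (g + 1); [|lra].
    rewrite Hrec, E by exact Hg.
    replace ((g + 1) * (c * gamma_ratio (g + 1))) with (c * ((g + 1) * gamma_ratio (g + 1))) by ring.
    rewrite gamma_ratio_rec by exact Hg. ring. }
  assert (Hn : forall (m : nat) s c, 0 <= s -> l s = c * gamma_ratio s ->
                 l (INR m + s) = c * gamma_ratio (INR m + s)).
  { induction m as [|m IH]; intros s c Hs E.
    - simpl. now rewrite Rplus_0_l.
    - rewrite S_INR. replace (INR m + 1 + s) with (INR m + s + 1) by ring.
      apply Hstep; [pose proof (pos_INR m); lra|now apply IH]. }
  assert (Hnat : forall m : nat, l (INR m) = gamma_ratio (INR m)).
  { intros m. rewrite <- (Rplus_0_r (INR m)), (Hn m 0 1) by lra. ring. }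
  assert (Hs : forall s, 0 <= s <= 1 -> l s = gamma_ratio s).
  { intros s Hs. set (c := l s / gamma_ratio s).
    pose proof (gamma_ratio_pos s (proj1 Hs)) as Ps.
    assert (Ec : l s = c * gamma_ratio s) by (unfold c; field; lra).
    enough (c = 1) by (rewrite Ec; nra).
    assert (T4 : forall y, Rpower 4 y = Rpower 2 y ^ 2).
    { intros y. replace 4 with (2 * 2) by ring. rewrite <- Rpower_mult_distr by lra. ring. }
    pose proof (Rpower_pos 2 s) as HT. set (T := Rpower 2 s) in *.
    apply Rle_antisym.
    (* For [c <= 1], compare [l] at [M] and [M + s]. The constant 8 comes from
       [(2 M + 3)^2 - (2 M + 1)^2 = 8 (M + 1)]. *)
    - apply le_of_le_add_inv with 8. intros m.
      pose proof (pos_INR m) as Hm. set (M := INR m) in *.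
      pose proof (gamma_ratio_pos M Hm) as PM.
      pose proof (gamma_ratio_pos (M + s) ltac:(lra)) as PMs.
      pose proof (gamma_ratio_ge M s Hm Hs) as Hge.
      pose proof (Hmon M (M + s) ltac:(lra)) as H1.
      rewrite Rpower_plus, !T4 in H1. fold T in H1.
      unfold M in H1. rewrite (Hn m s c), Hnat in H1 by (auto; lra). fold M in H1.
      pose proof (Rpower_pos 2 M) as HTM.
      assert (H2 : c * gamma_ratio (M + s) <= gamma_ratio M * T ^ 2).
      { apply Rmult_le_reg_r with (Rpower 2 M ^ 2); [nra|]. nra. }
      assert (H3 : c * (2 * M + 1) ^ 2 <= (2 * M + 3) ^ 2).
      { apply Rmult_le_reg_l with (gamma_ratio (M + s)); [exact PMs|].
        fold T in Hge. apply Rle_trans with (2 := Hge).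
        replace ((T * (2 * M + 1)) ^ 2) with (T ^ 2 * (2 * M + 1) ^ 2) by ring.
        pose proof (pow2_ge_0 (2 * M + 1)). nra. }
      apply Rmult_le_reg_r with ((2 * M + 1) ^ 2); [nra|].
      apply Rle_trans with (1 := H3).
      apply Rle_trans with ((2 * M + 1) ^ 2 + 8 / (M + 1) * (2 * M + 1) ^ 2); [|right; ring].
      assert (H4 : 8 * (M + 1) <= 8 / (M + 1) * (2 * M + 1) ^ 2).
      { apply Rmult_le_reg_r with (M + 1); [lra|].
        replace (8 / (M + 1) * (2 * M + 1) ^ 2 * (M + 1)) with (8 * (2 * M + 1) ^ 2)
          by (field; lra). nra. }
      nra.
    (* For [1 <= c], compare [l] at [M + s] and [M + 1], where the recursion supplies [l (M + 1)].
       The gap [2 (M + 2)^2 - (2 M + 1) (M + 1) = 5 M + 7] leaves ample room for the constant 8. *)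
    - apply le_of_le_add_inv with 8. intros m.
      pose proof (pos_INR m) as Hm. set (M := INR m) in *.
      pose proof (gamma_ratio_pos M Hm) as PM.
      pose proof (gamma_ratio_pos (M + s) ltac:(lra)) as PMs.
      pose proof (gamma_ratio_le M s Hm Hs) as Hle. fold T in Hle.
      pose proof (Hmon (M + s) (M + 1) ltac:(lra)) as H1.
      pose proof (Hrec M Hm) as H0.
      rewrite !Rpower_plus, !T4, !Rpower_1 in H1 by lra. fold T in H1.
      unfold M in H0, H1. rewrite (Hn m s c) in H1 by (auto; lra).
      rewrite Hnat in H0. fold M in H0, H1.
      pose proof (Rpower_pos 2 M) as HTM.
      assert (H2 : l (M + 1) * T ^ 2 <= 4 * (c * gamma_ratio (M + s))).
      { apply Rmult_le_reg_r with (Rpower 2 M ^ 2); [nra|]. nra. }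
      assert (H3 : (2 * M + 1) * (M + 1) <= 2 * c * (M + 2) ^ 2).
      { apply Rmult_le_reg_r with (gamma_ratio M * T ^ 2); [nra|].
        assert (0 <= c).
        { apply Rnot_lt_le. intros Hc.
          assert (l (M + 1) > 0) by nra. nra. }
        apply Rle_trans with (2 * c * (gamma_ratio (M + s) * (M + 1) ^ 2)).
        - replace ((2 * M + 1) * (M + 1) * (gamma_ratio M * T ^ 2))
            with ((2 * (2 * M + 1) * gamma_ratio M) * (T ^ 2 * (M + 1)) / 2) by field.
          rewrite <- H0. pose proof (pow2_ge_0 (M + 1)). nra.
        - replace (2 * c * (M + 2) ^ 2 * (gamma_ratio M * T ^ 2))
            with (2 * c * (gamma_ratio M * (T * (M + 2)) ^ 2)) by ring.
          apply Rmult_le_compat_l; [lra|exact Hle]. }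
      apply Rmult_le_reg_r with (2 * (M + 2) ^ 2); [nra|].
      assert (H4 : 16 * (M + 2) <= 8 / (M + 1) * (2 * (M + 2) ^ 2)).
      { apply Rmult_le_reg_r with (M + 1); [lra|].
        replace (8 / (M + 1) * (2 * (M + 2) ^ 2) * (M + 1)) with (16 * (M + 2) ^ 2)
          by (field; lra). nra. }
      nra. }
  intros g Hg. destruct (nfloor_ex g Hg) as [m Hm].
  replace g with (INR m + (g - INR m)) by ring.
  rewrite (Hn m (g - INR m) 1); [ring|lra|]. rewrite Hs by lra. ring.
Qed.

(** * Integrals of powers of [|1 - r e^{it}|] *)

Ltac solve_continuous :=
  lazymatch goal with
  | |- continuous (fun _ => ?c) _ => apply continuous_const
  | |- continuous (fun x => x) _ => apply continuous_id
  | |- continuous (fun p => fst p) (_, _) => apply continuous_fst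
  | |- continuous (fun p => snd p) (_, _) => apply continuous_snd
  | |- continuous (fun x => @?f x + @?g x) _ =>
      apply (continuous_plus (V := R_NormedModule) f g); solve_continuous
  | |- continuous (fun x => @?f x - @?g x) _ =>
      apply (continuous_minus (V := R_NormedModule) f g); solve_continuous
  | |- continuous (fun x => - @?f x) _ =>
      apply (continuous_opp (V := R_NormedModule) f); solve_continuous
  | |- continuous (fun x => @?f x * @?g x) _ =>
      apply (continuous_mult (K := R_AbsRing) f g); solve_continuous
  | |- continuous (fun x => @?f x ^ 2) ?a =>
      apply (continuous_ext (fun x => f x * f x)); [intros; simpl; ring|];
      apply (continuous_mult (K := R_AbsRing) f f); solve_continuous
  | |- continuous (fun x => cos (@?f x)) _ =>
      apply (continuous_comp f cos); [solve_continuous|apply continuous_cos]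
  | |- continuous (fun x => sin (@?f x)) _ =>
      apply (continuous_comp f sin); [solve_continuous|apply continuous_sin]
  | |- continuous (fun x => Rpower (@?f x) ?c) _ =>
      apply (continuous_comp f (fun y => Rpower y c)); [solve_continuous|apply continuous_Rpower]
  | |- continuous (fun x => / @?f x) _ =>
      apply (continuous_comp f Rinv); [solve_continuous|apply continuous_Rinv]
  | |- _ => idtac
  end.

(** * Integrals of continuous functions and their parameters *)

Lemma ex_RInt_cont (f : R -> R) (a b : R) :
  (forall t, continuous f t) -> ex_RInt f a b.
Proof. intros H. apply (ex_RInt_continuous (V := R_CompleteNormedModule)). auto. Qed.

Lemma RInt_lin (f g : R -> R) (u v a b : R) :
  (forall t, continuous f t) -> (forall t, continuous g t) ->
  RInt (fun t => u * f t + v * g t) a b = u * RInt f a b + v * RInt g a b.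
Proof.
  intros Hf Hg.
  rewrite (RInt_plus (V := R_CompleteNormedModule) (fun t => u * f t) (fun t => v * g t)).
  - rewrite (RInt_scal (V := R_CompleteNormedModule) f) by now apply ex_RInt_cont.
    rewrite (RInt_scal (V := R_CompleteNormedModule) g) by now apply ex_RInt_cont.
    reflexivity.
  - apply ex_RInt_cont. intros t. solve_continuous. apply Hf.
  - apply ex_RInt_cont. intros t. solve_continuous. apply Hg.
Qed.

Lemma RInt_le_cont (f g : R -> R) (a b : R) : a <= b ->
  (forall t, continuous f t) -> (forall t, continuous g t) ->
  (forall t, f t <= g t) -> RInt f a b <= RInt g a b.
Proof. intros. apply RInt_le; auto using ex_RInt_cont. Qed.

Lemma RInt_derive_periodic (F f : R -> R) (a b : R) :
  (forall t, is_derive F t (f t)) -> (forall t, continuous f t) -> F a = F b ->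
  RInt f a b = 0.
Proof.
  intros HF Hf E. apply is_RInt_unique.
  replace 0 with (minus (F b) (F a)).
  - apply (is_RInt_derive F); auto.
  - rewrite E. apply (minus_eq_zero (G := R_NormedModule)).
Qed.

Lemma is_derive_RInt_cont2 (f df : R -> R -> R) (a b x : R) :
  locally x (fun y => forall t, is_derive (fun u => f u t) y (df y t)) ->
  locally x (fun y => forall t, continuous (f y) t) ->
  (forall t, continuous (fun p : R * R => df (fst p) (snd p)) (x, t)) ->
  is_derive (fun u => RInt (f u) a b) x (RInt (df x) a b).
Proof.
  intros Hd Hc Hdf.
  assert (Hx : forall t, is_derive (fun u => f u t) x (df x t)) by exact (locally_singleton _ _ Hd).
  rewrite <- (RInt_ext (fun t => Derive (fun u => f u t) x))
    by (intros; now apply is_derive_unique).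
  apply (is_derive_RInt_param f).
  - revert Hd. apply filter_imp. intros y Hy t _. eexists. apply Hy.
  - intros t _. apply continuity_2d_pt_ext_loc with df.
    + destruct Hd as [eps Heps]. exists eps. intros u v Hu _.
      symmetry. apply is_derive_unique. now apply Heps.
    + apply continuity_2d_pt_filterlim. apply Hdf.
  - revert Hc. apply filter_imp. intros y Hy. now apply ex_RInt_cont.
Qed.

(** This is [|1 - r e^{it}|^2]. The lemmas about it admit negative [r], so that 0 is an interior
    point for derivatives in [r]. *)
Definition sqdist (r t : R) : R := 1 - 2 * r * cos t + r ^ 2.

Lemma sqdist_ge (r t : R) : -1 < r < 1 -> (1 - Rabs r) ^ 2 <= sqdist r t.
Proof.
  intros Hr. unfold sqdist. pose proof (COS_bound t).
  destruct (Rle_dec 0 r); [rewrite Rabs_pos_eq by lra|rewrite Rabs_left by lra]; nra.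
Qed.

Lemma sqdist_pos (r t : R) : -1 < r < 1 -> 0 < sqdist r t.
Proof.
  intros Hr. apply Rlt_le_trans with (2 := sqdist_ge r t Hr).
  assert (Rabs r < 1) by (apply Rabs_def1; lra). apply pow_lt. lra.
Qed.

Lemma sqdist_le4 (r t : R) : -1 < r < 1 -> sqdist r t <= 4.
Proof. intros Hr. unfold sqdist. pose proof (COS_bound t). nra. Qed.

(** Classically [2 PI F(b, b; 1; r^2)]. The value [b = 1] belongs to the Poisson kernel,
    [b = a / 2 + 1] to [K_kernel a], and [b = - (a / 2)] to the mean of [|1 - r e^{it}|^a]. *)
Definition J (b r : R) : R := RInt (fun t => Rpower (sqdist r t) (- b)) 0 (2 * PI).

Lemma sqdist_pow_continuous (r b t : R) :
  -1 < r < 1 -> continuous (fun t => Rpower (sqdist r t) b) t.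
Proof.
  intros Hr. unfold sqdist. solve_continuous. now apply sqdist_pos.
Qed.

Lemma locally_unit_interval (r : R) : -1 < r < 1 -> locally r (fun y => -1 < y < 1).
Proof.
  intros [H1 H2]. apply filter_and.
  - now apply (open_gt (-1)).
  - now apply (open_lt 1).
Qed.

Lemma Rpower_pred (x p : R) : 0 < x -> Rpower x (p - 1) = Rpower x p / x.
Proof.
  intros Hx. unfold Rminus. rewrite Rpower_plus, Rpower_Ropp, Rpower_1 by exact Hx.
  reflexivity.
Qed.

(** With [D = sqdist r t], the identity [r (2 r - 2 cos t) = D - (1 - r^2)] expresses the derivative
    through [J] again. The product form [r * d] includes [r = 0]. *)
Lemma is_derive_J (b r : R) : -1 < r < 1 ->
  exists d : R, is_derive (J b) r d /\ r * d = b * ((1 - r ^ 2) * J (b + 1) r - J b r).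
Proof.
  intros Hr. eexists. split.
  - apply (is_derive_RInt_cont2 (fun r t => Rpower (sqdist r t) (- b))
             (fun r t => - b * Rpower (sqdist r t) (- b - 1) * (2 * r - 2 * cos t))).
    + generalize (locally_unit_interval r Hr). apply filter_imp. intros y Hy t.
      evar_last.
      * apply (is_derive_comp (fun u => Rpower u (- b)) (fun u => sqdist u t)).
        -- now apply is_derive_Rpower, sqdist_pos.
        -- unfold sqdist. auto_derive; [trivial|reflexivity].
      * unfold scal; simpl; unfold mult; simpl. ring.
    + generalize (locally_unit_interval r Hr). apply filter_imp. intros y Hy t.
      now apply sqdist_pow_continuous.
    + intros t. unfold sqdist. solve_continuous. now apply sqdist_pos.
  - unfold J. rewrite <- (Rmult_1_l (RInt (fun t => Rpower (sqdist r t) (- b)) 0 (2 * PI))).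
    replace (- (b + 1)) with (- b - 1) by ring.
    transitivity (b * (1 - r ^ 2) * RInt (fun t => Rpower (sqdist r t) (- b - 1)) 0 (2 * PI)
       + - b * RInt (fun t => Rpower (sqdist r t) (- b)) 0 (2 * PI)); [|ring].
    rewrite <- RInt_lin by (intros; now apply sqdist_pow_continuous).
    rewrite <- (RInt_scal (V := R_CompleteNormedModule)).
    + apply RInt_ext. intros t _. unfold scal; simpl; unfold mult; simpl.
      replace (Rpower (sqdist r t) (- b)) with (Rpower (sqdist r t) (- b - 1) * sqdist r t).
      * unfold sqdist. ring.
      * rewrite <- Rpower_succ by now apply sqdist_pos. f_equal. ring.
    + apply ex_RInt_cont. intros t. unfold sqdist. solve_continuous. now apply sqdist_pos.
Qed.

Lemma continuous_J (b r : R) : -1 < r < 1 -> continuous (J b) r.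
Proof.
  intros Hr. destruct (is_derive_J b r Hr) as (d & Hd & _).
  apply (ex_derive_continuous (V := R_NormedModule)). now exists d.
Qed.

Lemma is_derive_J' (b r : R) : 0 < r < 1 ->
  is_derive (J b) r (b * ((1 - r ^ 2) * J (b + 1) r - J b r) / r).
Proof.
  intros Hr. destruct (is_derive_J b r) as (d & Hd & E); [lra|].
  rewrite <- E.
  assert (Ed : r * d / r = d) by (field; lra). rewrite Ed. exact Hd.
Qed.

Lemma J_zero (b : R) : J b 0 = 2 * PI.
Proof.
  unfold J. rewrite (RInt_ext _ (fun _ => 1)).
  - rewrite (RInt_const (V := R_CompleteNormedModule)). unfold scal; simpl; unfold mult; simpl. ring.
  - intros t _. unfold sqdist. replace (1 - 2 * 0 * cos t + 0 ^ 2) with 1 by ring.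
    unfold Rpower. now rewrite ln_1, Rmult_0_r, exp_0.
Qed.

Lemma J_pos (b r : R) : -1 < r < 1 -> 0 < J b r.
Proof.
  intros Hr. apply RInt_gt_0.
  - pose proof PI_RGT_0. lra.
  - intros; apply Rpower_pos.
  - intros; now apply sqdist_pow_continuous.
Qed.

(* Integration of the derivative of [2 r sin t D^(-b-1)], with [D = sqdist r t]. *)
Lemma J_three_term (b r : R) : -1 < r < 1 ->
  (b + 1) * (1 - r ^ 2) ^ 2 * J (b + 2) r
  = (2 * b + 1) * (1 + r ^ 2) * J (b + 1) r - b * J b r.
Proof.
  intros Hr.
  set (c1 := - (b + 1) * (1 - r ^ 2) ^ 2).
  set (c2 := (2 * b + 1) * (1 + r ^ 2)).
  assert (H0 : RInt (fun t => 1 * (- c1 * Rpower (sqdist r t) (- (b + 2))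
                 + - c2 * Rpower (sqdist r t) (- (b + 1)))
                 + b * Rpower (sqdist r t) (- b)) 0 (2 * PI) = 0).
  { apply (RInt_derive_periodic
      (fun t => 2 * r * sin t * Rpower (sqdist r t) (- (b + 1)))).
    - intros t. pose proof (sqdist_pos r t Hr) as HD.
      evar_last.
      + apply (is_derive_mult (fun t => 2 * r * sin t) (fun t => Rpower (sqdist r t) (- (b + 1)))).
        * auto_derive; [trivial|reflexivity].
        * apply (is_derive_comp (fun u => Rpower u (- (b + 1))) (sqdist r)).
          -- now apply is_derive_Rpower.
          -- unfold sqdist. auto_derive; [trivial|reflexivity].
        * intros; apply Rmult_comm.
      + unfold plus, scal; simpl; unfold mult; simpl. unfold c1, c2.
        replace (- (b + 1) - 1) with (- (b + 2)) by ring.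
        replace (- (b + 1)) with (- (b + 2) + 1) by ring.
        replace (- b) with (- (b + 2) + 1 + 1) by ring.
        rewrite !Rpower_succ by exact HD.
        set (E := Rpower (sqdist r t) (- (b + 2))).
        pose proof (sin2_cos2 t) as S. unfold Rsqr in S.
        assert (S' : sin t * sin t = 1 - cos t * cos t) by lra.
        unfold sqdist. ring_simplify.
        replace (sin t ^ 2) with (1 - cos t * cos t) by (rewrite <- S'; simpl; ring). ring.
    - intros t. unfold sqdist. solve_continuous; now apply sqdist_pos.
    - rewrite sin_0, sin_2PI. ring. }
  rewrite RInt_lin in H0.
  - rewrite RInt_lin in H0 by (intros; now apply sqdist_pow_continuous).
    fold (J (b + 2) r) (J (b + 1) r) (J b r) in H0. unfold c1, c2 in *. lra.
  - intros t. unfold sqdist. solve_continuous; now apply sqdist_pos.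
  - intros; now apply sqdist_pow_continuous.
Qed.

(** * The radial equation *)

(* The equation [T_alpha y = 0] for a radial function, as a first-order system
   for [y] and [p = r y']. *)
Definition radial_sol (a : R) (y p : R -> R) : Prop :=
  (forall r, 0 < r < 1 ->
     is_derive y r (p r / r) /\
     is_derive p r (r * (a ^ 2 * y r - 2 * a * p r) / (1 - r ^ 2))) /\
  continuous y 0 /\ continuous p 0 /\ p 0 = 0.

Lemma const_of_derive_zero (f : R -> R) (r : R) :
  0 < r -> (forall x, 0 < x < r -> is_derive f x 0) ->
  (forall x, 0 <= x <= r -> continuous f x) -> f r = f 0.
Proof.
  intros Hr Hd Hc.
  destruct (MVT_gen f 0 r (fun _ => 0)) as (c & _ & E).
  - intros x Hx. rewrite Rmin_left, Rmax_right in Hx by lra. now apply Hd.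
  - intros x Hx. rewrite Rmin_left, Rmax_right in Hx by lra.
    apply continuity_pt_filterlim. now apply Hc.
  - lra.
Qed.

Lemma is_derive_Rpower_one_minus_sqr (c r : R) : -1 < r < 1 ->
  is_derive (fun r => Rpower (1 - r ^ 2) c) r
    (- 2 * c * r * Rpower (1 - r ^ 2) c / (1 - r ^ 2)).
Proof.
  intros Hr. assert (H : 0 < 1 - r ^ 2) by nra. evar_last.
  - apply (is_derive_comp (fun u => Rpower u c) (fun r => 1 - r ^ 2)).
    + now apply is_derive_Rpower.
    + auto_derive; [trivial|reflexivity].
  - rewrite Rpower_pred by exact H. unfold scal; simpl; unfold mult; simpl.
    field. simpl in H. lra.
Qed.

Lemma is_derive_continuous (f : R -> R) (x d : R) : is_derive f x d -> continuous f x.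
Proof.
  intros H. apply (ex_derive_continuous (V := R_NormedModule)). now exists d.
Qed.

(** Abel's formula: the Wronskian [y1 p2 - y2 p1] is a multiple of [(1 - r^2)^a]. It vanishes at 0
    with [p1] and [p2], hence everywhere, and then [y2 / y1] has derivative 0. *)
Lemma radial_sol_unique (a : R) (y1 p1 y2 p2 : R -> R) :
  radial_sol a y1 p1 -> radial_sol a y2 p2 ->
  (forall r, 0 <= r < 1 -> 0 < y1 r) ->
  forall r, 0 <= r < 1 -> y2 r * y1 0 = y1 r * y2 0.
Proof.
  intros (H1 & Cy1 & Cp1 & E1) (H2 & Cy2 & Cp2 & E2) Hpos.
  assert (HW : forall r, 0 < r < 1 -> y1 r * p2 r - y2 r * p1 r = 0).
  { intros r Hr.
    set (g := fun r => Rpower (1 - r ^ 2) (- a) * (y1 r * p2 r - y2 r * p1 r)).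
    assert (Hg : g r = g 0).
    { apply const_of_derive_zero; [lra| |].
      - intros x Hx. assert (Hx1 : 0 < x < 1) by lra.
        destruct (H1 x Hx1) as [A1 B1]. destruct (H2 x Hx1) as [A2 B2].
        unfold g. evar_last.
        + apply (is_derive_mult (fun r => Rpower (1 - r ^ 2) (- a))
                   (fun r => y1 r * p2 r - y2 r * p1 r)).
          * apply is_derive_Rpower_one_minus_sqr. lra.
          * apply (is_derive_minus (V := R_NormedModule) (fun r => y1 r * p2 r) (fun r => y2 r * p1 r)).
            -- apply (is_derive_mult y1 p2); [exact A1|exact B2|intros; apply Rmult_comm].
            -- apply (is_derive_mult y2 p1); [exact A2|exact B1|intros; apply Rmult_comm].
          * intros; apply Rmult_comm.
        + unfold minus, plus, opp, mult; simpl.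
          assert (1 - x ^ 2 <> 0) by nra. field. simpl in *. lra.
      - intros x Hx. unfold g.
        assert (Cx : forall y : R -> R, continuous y 0 -> (0 < x < 1 -> ex_derive y x) -> continuous y x).
        { intros y C0 Hd. destruct (Req_dec x 0) as [->|Hne]; [exact C0|].
          apply (ex_derive_continuous (V := R_NormedModule)). apply Hd. lra. }
        assert (continuous y1 x) by (apply Cx; [exact Cy1|intros Hx1; exact (ex_intro _ _ (proj1 (H1 x Hx1)))]).
        assert (continuous y2 x) by (apply Cx; [exact Cy2|intros Hx1; exact (ex_intro _ _ (proj1 (H2 x Hx1)))]).
        assert (continuous p1 x) by (apply Cx; [exact Cp1|intros Hx1; exact (ex_intro _ _ (proj2 (H1 x Hx1)))]).
        assert (continuous p2 x) by (apply Cx; [exact Cp2|intros Hx1; exact (ex_intro _ _ (proj2 (H2 x Hx1)))]).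
        solve_continuous; try assumption. nra. }
    unfold g in Hg at 2. rewrite E1, E2, !Rmult_0_r, Rminus_0_r, Rmult_0_r in Hg.
    unfold g in Hg. apply Rmult_integral in Hg as [Hg|Hg]; [|exact Hg].
    pose proof (Rpower_pos (1 - r ^ 2) (- a)). lra. }
  intros r [Hr0 Hr1]. destruct Hr0 as [Hr0|<-]; [|ring].
  assert (Hq : y2 r / y1 r = y2 0 / y1 0).
  { apply (const_of_derive_zero (fun r => y2 r / y1 r)); [lra| |].
    - intros x Hx. assert (Hx1 : 0 < x < 1) by lra.
      destruct (H1 x Hx1) as [A1 _]. destruct (H2 x Hx1) as [A2 _].
      pose proof (Hpos x ltac:(lra)) as Px. evar_last.
      + apply (is_derive_div y2 y1); [exact A2|exact A1|lra].
      + transitivity ((y1 x * p2 x - y2 x * p1 x) / (x * (y1 x) ^ 2)); [field; lra|].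
        rewrite HW by exact Hx1. unfold Rdiv. ring.
    - intros x Hx. pose proof (Hpos x ltac:(lra)) as Px.
      destruct (Req_dec x 0) as [E|Hne].
      + subst x. unfold Rdiv. solve_continuous; [exact Cy2|exact Cy1|lra].
      + unfold Rdiv. solve_continuous; [| |lra].
        * apply is_derive_continuous with (p2 x / x). apply (proj1 (H2 x ltac:(lra))).
        * apply is_derive_continuous with (p1 x / x). apply (proj1 (H1 x ltac:(lra))). }
  pose proof (Hpos r ltac:(lra)). pose proof (Hpos 0 ltac:(lra)).
  apply (f_equal (fun z => z * (y1 r * y1 0))) in Hq. field_simplify in Hq; lra.
Qed.

(** This is [r] times the derivative of [J b], the second unknown of the radial system. *)
Definition J_p (b r : R) : R := b * ((1 - r ^ 2) * J (b + 1) r - J b r).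

(** The angular mean of [Delta D^(-b) = 4 b^2 D^(-b-1)]. Differentiating the formula for [J_p]
    produces [J (b + 2)], which [J_three_term] eliminates. *)
Lemma is_derive_J_p (b r : R) : 0 < r < 1 ->
  is_derive (J_p b) r (4 * b ^ 2 * r * J (b + 1) r).
Proof.
  intros Hr.
  pose proof (is_derive_J' b r Hr) as HA. pose proof (is_derive_J' (b + 1) r Hr) as HB.
  pose proof (J_three_term b r ltac:(lra)) as H3.
  replace (b + 1 + 1) with (b + 2) in HB by ring.
  evar_last.
  - apply (is_derive_scal (fun r => (1 - r ^ 2) * J (b + 1) r - J b r)).
    apply (is_derive_minus (V := R_NormedModule) (fun r => (1 - r ^ 2) * J (b + 1) r) (J b));
      [|exact HA].
    apply (is_derive_mult (fun r => 1 - r ^ 2) (J (b + 1))); [|exact HB|intros; apply Rmult_comm].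
    auto_derive; [trivial|reflexivity].
  - unfold minus, plus, opp, mult; simpl. change (r * (r * 1)) with (r ^ 2).
    apply Rmult_eq_reg_r with r; [|lra].
    transitivity (b * ((- 2 * r ^ 2 - (b + 1) * (1 - r ^ 2)) * J (b + 1) r
        + (b + 1) * (1 - r ^ 2) ^ 2 * J (b + 2) r - b * ((1 - r ^ 2) * J (b + 1) r - J b r))).
    + field. lra.
    + rewrite H3. ring.
Qed.

Lemma continuous_J_p (b r : R) : -1 < r < 1 -> continuous (J_p b) r.
Proof.
  intros Hr. unfold J_p. solve_continuous; now apply continuous_J.
Qed.

Lemma J_p_zero (b : R) : J_p b 0 = 0.
Proof. unfold J_p. rewrite !J_zero. ring. Qed.

(** The definition of [J_p] gives [4 b^2 (1 - r^2) J (b + 1) = 4 b p + 4 b^2 y], and for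
    [b = - (a / 2)] the right side is [a^2 y - 2 a p]. *)
Lemma radial_sol_J (a : R) : radial_sol a (J (- (a / 2))) (J_p (- (a / 2))).
Proof.
  split; [|split; [|split]].
  - intros r Hr. split; [now apply is_derive_J'|].
    evar_last; [now apply is_derive_J_p|]. unfold J_p. field. nra.
  - apply continuous_J. lra.
  - apply continuous_J_p. lra.
  - apply J_p_zero.
Qed.

(** [T_a] annihilates its kernel and commutes with rotations, so the angular mean must solve the
    radial equation; here this is verified directly. The second function is [r] times the derivative
    of the first. *)
Lemma radial_sol_kernel (a : R) :
  radial_sol a (fun r => Rpower (1 - r ^ 2) (a + 1) * J (a / 2 + 1) r)
    (fun r => - 2 * (a + 1) * r ^ 2 * (Rpower (1 - r ^ 2) a * J (a / 2 + 1) r)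
              + Rpower (1 - r ^ 2) (a + 1) * J_p (a / 2 + 1) r).
Proof.
  set (b := a / 2 + 1).
  split; [|split; [|split]].
  - intros r Hr. assert (H : 0 < 1 - r ^ 2) by nra.
    pose proof (is_derive_J' b r Hr) as HA. fold (J_p b r) in HA.
    pose proof (is_derive_J_p b r Hr) as HP.
    assert (HE : forall c, is_derive (fun r => Rpower (1 - r ^ 2) c) r
       (- 2 * c * r * Rpower (1 - r ^ 2) c / (1 - r ^ 2)))
      by (intros; apply is_derive_Rpower_one_minus_sqr; lra).
    split.
    + evar_last.
      * apply (is_derive_mult (fun r => Rpower (1 - r ^ 2) (a + 1)) (J b));
          [apply HE|exact HA|intros; apply Rmult_comm].
      * unfold plus, mult; simpl. change (r * (r * 1)) with (r ^ 2).
        rewrite !Rpower_succ by exact H. field. lra.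
    + evar_last.
      * apply (is_derive_plus (V := R_NormedModule)
          (fun r => - 2 * (a + 1) * r ^ 2 * (Rpower (1 - r ^ 2) a * J b r))
          (fun r => Rpower (1 - r ^ 2) (a + 1) * J_p b r)).
        -- apply (is_derive_mult (fun r => - 2 * (a + 1) * r ^ 2)
              (fun r => Rpower (1 - r ^ 2) a * J b r)).
           ++ auto_derive; [trivial|reflexivity].
           ++ apply (is_derive_mult (fun r => Rpower (1 - r ^ 2) a) (J b));
                [apply HE|exact HA|intros; apply Rmult_comm].
           ++ intros; apply Rmult_comm.
        -- apply (is_derive_mult (fun r => Rpower (1 - r ^ 2) (a + 1)) (J_p b));
             [apply HE|exact HP|intros; apply Rmult_comm].
      * unfold plus, mult; simpl. change (r * (r * 1)) with (r ^ 2).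
        rewrite !Rpower_succ by exact H. unfold J_p.
        replace a with (2 * b - 2) by (unfold b; field). field. lra.
  - assert (H01 : 0 < 1 - 0 ^ 2) by lra.
    solve_continuous; [exact H01|apply continuous_J; lra].
  - assert (H01 : 0 < 1 - 0 ^ 2) by lra.
    solve_continuous; try exact H01; [apply continuous_J|apply continuous_J_p]; lra.
  - rewrite J_p_zero. ring.
Qed.

(** Euler's transformation [F(b, b; 1; x) = (1 - x)^(1 - 2 b) F(1 - b, 1 - b; 1; x)] at
    [b = a / 2 + 1]: both sides are regular solutions with the same value at 0. *)
Lemma kernel_mean_eq (a r : R) : 0 <= r < 1 ->
  Rpower (1 - r ^ 2) (a + 1) * J (a / 2 + 1) r = J (- (a / 2)) r.
Proof.
  intros Hr.
  pose proof (radial_sol_unique a _ _ _ _ (radial_sol_J a) (radial_sol_kernel a)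
    (fun r H => J_pos _ r ltac:(lra)) r Hr) as E.
  simpl in E. rewrite !J_zero in E.
  replace (1 - 0 * (0 * 1)) with 1 in E by ring.
  replace (Rpower 1 (a + 1)) with 1 in E
    by (unfold Rpower; now rewrite ln_1, Rmult_0_r, exp_0).
  pose proof PI_RGT_0. apply Rmult_eq_reg_r with (2 * PI); [|lra]. simpl. lra.
Qed.

(** * The hypergeometric series *)

(** Since [(1)_n = n!], the coefficients of [F(a, a; 1; x)] are squares, hence nonnegative. *)
Definition hyper_coef (a : R) (n : nat) : R := (pochhammer a n / INR (fact n)) ^ 2.

Lemma hypergeometric_PSeries (a x : R) : hypergeometric a a 1 x = PSeries (hyper_coef a) x.
Proof.
  assert (E : forall n, pochhammer 1 n = INR (fact n)).
  { induction n as [|n IH]; [reflexivity|].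
    change (pochhammer 1 n * (1 + INR n) = INR (S n * fact n)).
    rewrite IH, mult_INR, S_INR. ring. }
  apply Series_ext. intros n. rewrite E. unfold hyper_coef.
  field. apply INR_fact_neq_0.
Qed.

Lemma hyper_coef_succ (a : R) (n : nat) :
  (INR n + 1) ^ 2 * hyper_coef a (S n) = (a + INR n) ^ 2 * hyper_coef a n.
Proof.
  unfold hyper_coef.
  change (pochhammer a (S n)) with (pochhammer a n * (a + INR n)).
  change (fact (S n)) with (S n * fact n)%nat. rewrite mult_INR, S_INR.
  pose proof (pos_INR n). field. split; [apply INR_fact_neq_0|lra].
Qed.

Lemma hyper_coef_pos (a : R) (n : nat) : 0 <= hyper_coef a n.
Proof. apply pow2_ge_0. Qed.

Lemma eventually_decreasing_bounded (u : nat -> R) (N : nat) :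
  (forall n, 0 <= u n) -> (forall n, (N <= n)%nat -> u (S n) <= u n) ->
  exists B, forall n, u n <= B.
Proof.
  intros Hp Hd. exists (sum_f_R0 u N).
  assert (Hs : forall m n, (n <= m)%nat -> u n <= sum_f_R0 u m).
  { induction m as [|m IH]; intros n Hn.
    - replace n with 0%nat by lia. simpl. lra.
    - simpl. destruct (Nat.eq_dec n (S m)) as [->|Hne].
      + assert (0 <= sum_f_R0 u m) by (apply cond_pos_sum; exact Hp). lra.
      + specialize (IH n ltac:(lia)). specialize (Hp (S m)). lra. }
  intros n. destruct (Nat.le_gt_cases n N) as [H|H]; [now apply Hs|].
  apply Rle_trans with (u N); [|now apply Hs].
  replace n with (N + (n - N))%nat by lia.
  induction (n - N)%nat as [|k IH]; [rewrite Nat.add_0_r; lra|].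
  rewrite Nat.add_succ_r. apply Rle_trans with (2 := IH). apply Hd. lia.
Qed.

(** The ratio of consecutive coefficients is [((a + n) / (n + 1))^2], at most 1 once [n >= - a]. *)
Lemma hyper_coef_bounded (a : R) : a <= 0 -> exists B, forall n, hyper_coef a n <= B.
Proof.
  intros Ha. destruct (INR_unbounded (- a)) as [N HN].
  apply eventually_decreasing_bounded with N; [apply hyper_coef_pos|].
  intros n Hn. apply le_INR in Hn. pose proof (pos_INR n).
  pose proof (hyper_coef_pos a n).
  apply Rmult_le_reg_l with ((INR n + 1) ^ 2); [nra|]. rewrite hyper_coef_succ.
  apply Rmult_le_compat_r; [assumption|]. apply pow_incr. lra.
Qed.

Lemma CV_radius_hyper (a x : R) : a <= 0 -> Rabs x < 1 ->
  Rbar_lt (Rabs x) (CV_radius (hyper_coef a)).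
Proof.
  intros Ha Hx. apply Rbar_lt_le_trans with 1; [exact Hx|].
  destruct (hyper_coef_bounded a Ha) as [B HB].
  apply (proj1 (CV_radius_bounded (hyper_coef a))). exists B. intros n.
  rewrite pow1, Rmult_1_r, Rabs_pos_eq by apply hyper_coef_pos. apply HB.
Qed.

Definition hyper_y (a x : R) : R := PSeries (hyper_coef a) x.
Definition hyper_y1 (a x : R) : R := PSeries (PS_derive (hyper_coef a)) x.
Definition hyper_y2 (a x : R) : R := PSeries (PS_derive (PS_derive (hyper_coef a))) x.

Lemma is_derive_hyper_y (a x : R) : a <= 0 -> Rabs x < 1 ->
  is_derive (hyper_y a) x (hyper_y1 a x).
Proof. intros Ha Hx. apply is_derive_PSeries. now apply CV_radius_hyper. Qed.

Lemma is_derive_hyper_y1 (a x : R) : a <= 0 -> Rabs x < 1 ->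
  is_derive (hyper_y1 a) x (hyper_y2 a x).
Proof.
  intros Ha Hx. apply is_derive_PSeries. rewrite CV_radius_derive.
  now apply CV_radius_hyper.
Qed.

(** The series [y1 + x y2 = (x y')'] has coefficients [(n + 1)^2 u_(n+1)], which the recursion turns
    into [(n^2 + 2 a n + a^2) u_n]; the three summands are the series [x (x y')'], [2 a x y'] and
    [a^2 y]. *)
Lemma hyper_ode (a x : R) : a <= 0 -> Rabs x < 1 ->
  (1 - x) * (hyper_y1 a x + x * hyper_y2 a x) = 2 * a * x * hyper_y1 a x + a ^ 2 * hyper_y a x.
Proof.
  intros Ha Hx.
  set (u := hyper_coef a). set (u1 := PS_derive u). set (u2 := PS_derive u1).
  pose proof (CV_radius_hyper a x Ha Hx) as Hcv. fold u in Hcv.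
  assert (E0 : ex_pseries u x) by now apply CV_radius_inside.
  assert (E1 : ex_pseries u1 x) by (apply CV_radius_inside; unfold u1; now rewrite CV_radius_derive).
  assert (E2 : ex_pseries u2 x)
    by (apply CV_radius_inside; unfold u2, u1; now rewrite !CV_radius_derive).
  set (c := PS_plus u1 (PS_incr_1 u2)).
  assert (Ec : ex_pseries c x)
    by (apply ex_pseries_plus; [exact E1|now apply ex_pseries_incr_1]).
  assert (Hc : PSeries c x = hyper_y1 a x + x * hyper_y2 a x).
  { unfold c. rewrite PSeries_plus, PSeries_incr_1; auto. now apply ex_pseries_incr_1. }
  assert (Hcn : forall n, c n = (INR n + 1) ^ 2 * u (S n)).
  { intros [|n]; unfold c, PS_plus, PS_incr_1, u2, u1, PS_derive; unfold plus; simpl.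
    - unfold zero; simpl. ring.
    - destruct n; simpl; ring. }
  assert (H : PSeries c x = PSeries (PS_plus (PS_incr_1 c)
      (PS_plus (PS_scal (2 * a) (PS_incr_1 u1)) (PS_scal (a ^ 2) u))) x).
  { apply PSeries_ext. intros n. rewrite Hcn. unfold u at 1. rewrite hyper_coef_succ. fold u.
    unfold PS_plus, PS_scal, PS_incr_1. unfold plus, scal; simpl; unfold mult; simpl.
    destruct n as [|n].
    - unfold zero; simpl. ring.
    - rewrite Hcn. unfold u1, PS_derive. rewrite S_INR. ring. }
  rewrite !PSeries_plus, !PSeries_scal, !PSeries_incr_1, Hc in H.
  - fold (hyper_y1 a x) (hyper_y a x) in H. change (PSeries u1 x) with (hyper_y1 a x) in H.
    change (PSeries u x) with (hyper_y a x) in H. lra.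
  - apply (ex_pseries_scal (2 * a)); [apply Rmult_comm|now apply ex_pseries_incr_1].
  - apply (ex_pseries_scal (a ^ 2)); [apply Rmult_comm|exact E0].
  - now apply ex_pseries_incr_1.
  - apply ex_pseries_plus.
    + apply (ex_pseries_scal (2 * a)); [apply Rmult_comm|now apply ex_pseries_incr_1].
    + apply (ex_pseries_scal (a ^ 2)); [apply Rmult_comm|exact E0].
Qed.

(** Under [x = r^2] the operator [r d/dr] becomes [2 x d/dx]. So [p] is [2 x y1], with derivative
    [4 r (y1 + x y2)], to which [hyper_ode] applies. *)
Lemma radial_sol_hyper (a : R) : 0 <= a ->
  radial_sol a (fun r => hyper_y (- (a / 2)) (r ^ 2))
    (fun r => 2 * r ^ 2 * hyper_y1 (- (a / 2)) (r ^ 2)).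
Proof.
  intros Ha. set (b := - (a / 2)). assert (Hb : b <= 0) by (unfold b; lra).
  assert (Hsq : forall r, -1 < r < 1 -> Rabs (r ^ 2) < 1).
  { intros r Hr. rewrite Rabs_pos_eq by apply pow2_ge_0. nra. }
  assert (HD : forall r, -1 < r < 1 ->
    is_derive (fun r => hyper_y b (r ^ 2)) r (2 * r * hyper_y1 b (r ^ 2))).
  { intros r Hr. evar_last.
    - apply (is_derive_comp (hyper_y b) (fun r => r ^ 2)).
      + apply is_derive_hyper_y; auto.
      + auto_derive; [trivial|reflexivity].
    - unfold scal; simpl; unfold mult; simpl. ring. }
  assert (HD1 : forall r, -1 < r < 1 ->
    is_derive (fun r => hyper_y1 b (r ^ 2)) r (2 * r * hyper_y2 b (r ^ 2))).
  { intros r Hr. evar_last.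
    - apply (is_derive_comp (hyper_y1 b) (fun r => r ^ 2)).
      + apply is_derive_hyper_y1; auto.
      + auto_derive; [trivial|reflexivity].
    - unfold scal; simpl; unfold mult; simpl. ring. }
  split; [|split; [|split]].
  - intros r Hr. split.
    + evar_last; [apply HD; lra|]. field. lra.
    + evar_last.
      * apply (is_derive_mult (fun r => 2 * r ^ 2) (fun r => hyper_y1 b (r ^ 2))).
        -- auto_derive; [trivial|reflexivity].
        -- apply HD1. lra.
        -- intros; apply Rmult_comm.
      * pose proof (hyper_ode b (r ^ 2) Hb (Hsq r ltac:(lra))) as HO.
        unfold plus, mult; simpl. change (r * (r * 1)) with (r ^ 2).
        assert (0 < 1 - r ^ 2) by nra.
        apply Rmult_eq_reg_r with (1 - r ^ 2); [|lra].
        transitivity (4 * r * ((1 - r ^ 2) * (hyper_y1 b (r ^ 2) + r ^ 2 * hyper_y2 b (r ^ 2)))).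
        -- simpl. ring.
        -- rewrite HO. replace a with (- 2 * b) by (unfold b; field). field. lra.
  - apply is_derive_continuous with (2 * 0 * hyper_y1 b (0 ^ 2)). apply HD. lra.
  - solve_continuous.
    apply is_derive_continuous with (2 * 0 * hyper_y2 b (0 ^ 2)). apply HD1. lra.
  - ring.
Qed.

Lemma J_hyper (a r : R) : 0 <= a -> 0 <= r < 1 ->
  J (- (a / 2)) r = 2 * PI * hyper_y (- (a / 2)) (r ^ 2).
Proof.
  intros Ha Hr.
  pose proof (radial_sol_unique a _ _ _ _ (radial_sol_J a) (radial_sol_hyper a Ha)
    (fun r H => J_pos _ r ltac:(lra)) r Hr) as E.
  simpl in E. rewrite !J_zero, Rmult_0_l in E.
  assert (E0 : hyper_y (- (a / 2)) 0 = 1).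
  { unfold hyper_y. rewrite PSeries_0. unfold hyper_coef. simpl. field. }
  rewrite E0 in E. simpl. lra.
Qed.

Lemma hyper_y_incr (a x x' : R) : a <= 0 -> 0 <= x <= x' -> x' < 1 -> hyper_y a x <= hyper_y a x'.
Proof.
  intros Ha Hx Hx'. apply Series_le.
  - intros n. pose proof (hyper_coef_pos a n). split.
    + apply Rmult_le_pos; [assumption|]. now apply pow_le.
    + apply Rmult_le_compat_l; [assumption|]. now apply pow_incr.
  - apply (proj1 (ex_pseries_R _ _)). apply CV_radius_inside, CV_radius_hyper; [exact Ha|].
    rewrite Rabs_pos_eq; lra.
Qed.

Lemma at_left_1_interval (x : R) : x < 1 -> at_left 1 (fun r => x < r < 1).
Proof.
  intros Hx. assert (He : 0 < 1 - x) by lra.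
  exists (mkposreal _ He). intros y Hy Hy1. change (Rabs (y - 1) < 1 - x) in Hy.
  apply Rabs_def2 in Hy. lra.
Qed.

Lemma filterlim_at_left_incr (f : R -> R) (B : R) :
  (forall x y, 0 < x <= y -> y < 1 -> f x <= f y) -> (forall x, 0 < x < 1 -> f x <= B) ->
  exists l, filterlim f (at_left 1) (locally l).
Proof.
  intros Hm HB.
  destruct (completeness (fun z => exists x, 0 < x < 1 /\ z = f x)) as [l [Hub Hlub]].
  - exists B. intros z (x & Hx & ->). now apply HB.
  - exists (f (/ 2)), (/ 2). split; [lra|reflexivity].
  - exists l. intros P [eps Heps]. destruct eps as [e He]. simpl in *.
    assert (Hl : exists x, 0 < x < 1 /\ l - e < f x).
    { apply Classical_Prop.NNPP. intros Hn. assert (l <= l - e); [|lra].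
      apply Hlub. intros z (x & Hx & ->). apply Rnot_lt_le. intros Hlt.
      apply Hn. now exists x. }
    destruct Hl as (x & Hx & Hlx). unfold filtermap.
    generalize (at_left_1_interval x (proj2 Hx)). apply filter_imp. intros y Hy.
    apply Heps. change (Rabs (f y - l) < e).
    assert (f y <= l) by (apply Hub; exists y; split; [lra|reflexivity]).
    pose proof (Hm x y ltac:(lra) ltac:(lra)). apply Rabs_def1; lra.
Qed.

(** The Poisson kernel has mean 1. In the case [b = 0] of [J_three_term] the term with [J 0] drops
    out, and what remains makes the derivative vanish. *)
Lemma J_poisson (r : R) : 0 <= r < 1 -> (1 - r ^ 2) * J 1 r = 2 * PI.
Proof.
  intros [[Hr|<-] Hr1]; [|rewrite J_zero; ring].
  transitivity ((1 - 0 ^ 2) * J 1 0); [|rewrite J_zero; ring].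
  apply (const_of_derive_zero (fun r => (1 - r ^ 2) * J 1 r)); [exact Hr| |].
  - intros x Hx. evar_last.
    + apply (is_derive_mult (fun r => 1 - r ^ 2) (J 1)).
      * auto_derive; [trivial|reflexivity].
      * apply is_derive_J'. lra.
      * intros; apply Rmult_comm.
    + pose proof (J_three_term 0 x ltac:(lra)) as H3.
      rewrite !Rplus_0_l in H3. replace (1 + 1) with 2 by ring.
      unfold plus, mult; simpl. change (x * (x * 1)) with (x ^ 2).
      apply Rmult_eq_reg_r with x; [|lra].
      transitivity (- 2 * x ^ 2 * J 1 x + (1 * (1 - x ^ 2) ^ 2 * J 2 x - (1 - x ^ 2) * J 1 x)).
      * field. lra.
      * rewrite H3. ring.
  - intros x Hx. solve_continuous. apply continuous_J. lra.
Qed.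

(* Since [D^(g-1) <= eps D^-1 + C], this is the approximate identity property of
   the Poisson kernel for [D^g], which vanishes at the boundary point. *)
Lemma J_one_minus_lim (g : R) : 0 < g ->
  filterlim (fun r => (1 - r ^ 2) * J (1 - g) r) (at_left 1) (locally 0).
Proof.
  intros Hg P [eps Heps]. destruct eps as [e He]. simpl in Heps.
  set (e' := e / (8 * PI)). pose proof PI_RGT_0 as Hpi.
  assert (He' : 0 < e') by (apply Rdiv_lt_0_compat; lra).
  (* The split point satisfies [d^g = e']: for [D <= d] one has [D^(g-1) <= e' / D], and for
     [d < D <= 4] one has [D^(g-1) <= 4^g / d = C]. *)
  set (d := Rpower e' (/ g)). pose proof (Rpower_pos e' (/ g)) as Hd. fold d in Hd.
  set (C := Rpower 4 g / d). assert (HC : 0 < C) by (apply Rdiv_lt_0_compat; [apply Rpower_pos|exact Hd]).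
  assert (Hb : forall D, 0 < D <= 4 -> Rpower D (g - 1) <= e' * Rpower D (- (1)) + C * 1).
  { intros D HD. rewrite Rpower_pred, Rpower_Ropp, Rpower_1 by lra.
    assert (0 < / D) by (apply Rinv_0_lt_compat; lra).
    destruct (Rle_dec D d) as [Hle|Hgt].
    - assert (Rpower D g <= e').
      { replace e' with (Rpower d g).
        - apply Rle_Rpower_l; lra.
        - unfold d. rewrite Rpower_mult. rewrite Rinv_l, Rpower_1 by lra. reflexivity. }
      unfold Rdiv. nra.
    - assert (Rpower D g <= Rpower 4 g) by (apply Rle_Rpower_l; lra).
      assert (/ D <= / d) by (apply Rinv_le_contravar; lra).
      assert (Rpower D g / D <= C).
      { unfold C, Rdiv. pose proof (Rpower_pos D g). apply Rmult_le_compat; lra. }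
      nra. }
  assert (HJ : forall r, 0 < r < 1 -> J (1 - g) r <= e' * J 1 r + C * (2 * PI)).
  { intros r Hr. unfold J. replace (- (1 - g)) with (g - 1) by ring.
    assert (E : RInt (fun _ => 1) 0 (2 * PI) = 2 * PI).
    { rewrite (RInt_const (V := R_CompleteNormedModule)).
      unfold scal; simpl; unfold mult; simpl. ring. }
    rewrite <- E at 3. rewrite <- RInt_lin.
    - apply RInt_le_cont; [lra| | |].
      + intros; apply sqdist_pow_continuous; lra.
      + intros t. unfold sqdist. solve_continuous. apply sqdist_pos; lra.
      + intros t. apply Hb. split; [apply sqdist_pos|apply sqdist_le4]; lra.
    - intros; apply sqdist_pow_continuous; lra.
    - intros; apply continuous_const. }
  (* Beyond this radius [(1 - r) 8 PI C < e], so the part with [C] is below [e / 2]; the part with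
     [e'] equals [e / 4]. *)
  assert (Hx : Rmax 0 (1 - e / (8 * PI * C)) < 1).
  { apply Rmax_lub_lt; [lra|]. assert (0 < e / (8 * PI * C)) by (apply Rdiv_lt_0_compat; nra). lra. }
  unfold filtermap. generalize (at_left_1_interval _ Hx). apply filter_imp. intros r [Hr Hr1].
  assert (0 < r) by (apply Rle_lt_trans with (2 := Hr); apply Rmax_l).
  assert (Hr2 : 1 - e / (8 * PI * C) < r) by (apply Rle_lt_trans with (2 := Hr); apply Rmax_r).
  apply Heps. change (Rabs ((1 - r ^ 2) * J (1 - g) r - 0) < e). rewrite Rminus_0_r.
  pose proof (J_pos (1 - g) r ltac:(lra)).
  rewrite Rabs_pos_eq by (apply Rmult_le_pos; [nra|lra]).
  assert (H1 : (1 - r ^ 2) * J (1 - g) r <= (1 - r ^ 2) * (e' * J 1 r + C * (2 * PI)))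
    by (apply Rmult_le_compat_l; [nra|apply HJ; lra]).
  pose proof (J_poisson r ltac:(lra)) as HP.
  replace ((1 - r ^ 2) * (e' * J 1 r + C * (2 * PI)))
    with (e' * ((1 - r ^ 2) * J 1 r) + (1 - r ^ 2) * C * (2 * PI)) in H1 by ring.
  rewrite HP in H1.
  assert (H2 : e' * (2 * PI) = e / 4) by (unfold e'; field; lra).
  assert (H3 : (1 - r) * (8 * PI * C) < e).
  { assert (H3 : 1 - r < e / (8 * PI * C)) by lra.
    apply (Rlt_div_r (1 - r) e (8 * PI * C)) in H3; [exact H3|nra]. }
  assert (H4 : (1 - r ^ 2) * C * (2 * PI) <= 2 * (1 - r) * C * (2 * PI)).
  { apply Rmult_le_compat_r; [lra|]. apply Rmult_le_compat_r; nra. }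
  lra.
Qed.

(** * Boundary behaviour of the kernel mean *)

Lemma Rpower_le_4 (D g : R) : 0 < D <= 4 -> 0 <= g -> Rpower D g <= Rpower 4 g.
Proof. intros HD Hg. apply Rle_Rpower_l; lra. Qed.

(** The Wallis integral [(1 / (2 PI)) int (2 - 2 cos t)^g dt], encoded as a limit, so that no
    exchange of limit and integral has to be justified. *)
Definition J_lim (g : R) : R :=
  iota (T := R_CompleteNormedModule)
    (fun l => filterlim (fun r => J (- g) r / (2 * PI)) (at_left 1) (locally l)).

(** The limit exists because the mean increases with [r], being a power series in [r^2] with
    nonnegative coefficients, and is bounded by [4^g]. *)
Lemma J_lim_correct (g : R) : 0 <= g ->
  filterlim (fun r => J (- g) r / (2 * PI)) (at_left 1) (locally (J_lim g)).
Proof.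
  intros Hg. pose proof PI_RGT_0 as Hpi.
  assert (E : forall r, 0 <= r < 1 -> J (- g) r / (2 * PI) = hyper_y (- g) (r ^ 2)).
  { intros r Hr. pose proof (J_hyper (2 * g) r ltac:(lra) Hr) as H.
    replace (2 * g / 2) with g in H by field. rewrite H. field. lra. }
  destruct (filterlim_at_left_incr (fun r => J (- g) r / (2 * PI)) (Rpower 4 g)) as [l Hl].
  - intros x y Hx Hy. rewrite !E by lra. apply hyper_y_incr; [lra|nra|nra].
  - intros x Hx. apply Rle_div_l; [lra|].
    unfold J. rewrite Ropp_involutive.
    replace (Rpower 4 g * (2 * PI)) with (RInt (fun _ => Rpower 4 g) 0 (2 * PI)).
    + apply RInt_le_cont; [lra| |intros; apply continuous_const|].
      * intros; apply sqdist_pow_continuous; lra.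
      * intros t. apply Rpower_le_4; [|exact Hg].
        split; [apply sqdist_pos|apply sqdist_le4]; lra.
    + rewrite (RInt_const (V := R_CompleteNormedModule)).
      unfold scal; simpl; unfold mult; simpl. ring.
  - assert (El : J_lim g = l)
      by exact (iota_filterlim_locally (V := R_CompleteNormedModule) _ l Hl).
    rewrite El. exact Hl.
Qed.

(** * Limits from the left at 1, and the value of [J_lim] *)

Lemma filterlim_at_left_id : filterlim (fun r : R => r) (at_left 1) (locally 1).
Proof.
  apply (filterlim_filter_le_1 (F := locally 1) (G := at_left 1)); [apply filter_le_within|].
  apply filterlim_id.
Qed.

Lemma continuous_at_left (f : R -> R) : continuous f 1 -> filterlim f (at_left 1) (locally (f 1)).
Proof.
  intros Hf. apply filterlim_comp with (1 := filterlim_at_left_id). exact Hf.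
Qed.

Lemma filterlim_at_left_plus (f g : R -> R) (a b : R) :
  filterlim f (at_left 1) (locally a) -> filterlim g (at_left 1) (locally b) ->
  filterlim (fun r => f r + g r) (at_left 1) (locally (a + b)).
Proof.
  intros Hf Hg. apply filterlim_comp_2 with (1 := Hf) (2 := Hg).
  apply (filterlim_plus (V := R_NormedModule)).
Qed.

Lemma filterlim_at_left_mult (f g : R -> R) (a b : R) :
  filterlim f (at_left 1) (locally a) -> filterlim g (at_left 1) (locally b) ->
  filterlim (fun r => f r * g r) (at_left 1) (locally (a * b)).
Proof.
  intros Hf Hg. apply filterlim_comp_2 with (1 := Hf) (2 := Hg).
  apply (filterlim_mult (K := R_AbsRing)).
Qed.

Lemma filterlim_at_left_ext (f g : R -> R) (l : R) :
  (forall r, 0 < r < 1 -> f r = g r) ->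
  filterlim f (at_left 1) (locally l) -> filterlim g (at_left 1) (locally l).
Proof.
  intros E. apply filterlim_ext_loc.
  generalize (at_left_1_interval 0 Rlt_0_1). apply filter_imp. exact E.
Qed.

Lemma filterlim_at_left_unique (f : R -> R) (a b : R) :
  filterlim f (at_left 1) (locally a) -> filterlim f (at_left 1) (locally b) -> a = b.
Proof. apply (filterlim_locally_unique (V := R_NormedModule)). Qed.

Lemma filterlim_at_left_le (f g : R -> R) (a b : R) :
  (forall r, 0 < r < 1 -> f r <= g r) ->
  filterlim f (at_left 1) (locally a) -> filterlim g (at_left 1) (locally b) -> a <= b.
Proof.
  intros H Hf Hg. apply (filterlim_le (F := at_left 1) f g (Finite a) (Finite b)); auto.
  generalize (at_left_1_interval 0 Rlt_0_1). apply filter_imp. exact H.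
Qed.

Lemma J_lim_zero : J_lim 0 = 1.
Proof.
  apply (filterlim_at_left_unique _ _ _ (J_lim_correct 0 (Rle_refl 0))).
  apply filterlim_at_left_ext with (fun _ => 1).
  - intros r Hr. pose proof PI_RGT_0.
    rewrite Ropp_0. unfold J. rewrite (RInt_ext _ (fun _ => 1)).
    + rewrite (RInt_const (V := R_CompleteNormedModule)).
      unfold scal; simpl; unfold mult; simpl. field. lra.
    + intros t _. rewrite Ropp_0. apply Rpower_O, sqdist_pos. lra.
  - apply filterlim_const.
Qed.

(** Since [D <= 4], the function [(D / 4)^g] decreases in [g]. This is the growth control required
    by [gamma_ratio_unique]. *)
Lemma J_lim_incr (g h : R) : 0 <= g <= h -> J_lim h * Rpower 4 g <= J_lim g * Rpower 4 h.
Proof.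
  intros Hgh. pose proof PI_RGT_0 as Hpi.
  apply filterlim_at_left_le with
    (fun r => J (- h) r / (2 * PI) * Rpower 4 g) (fun r => J (- g) r / (2 * PI) * Rpower 4 h).
  - intros r Hr.
    enough (Rpower 4 g * J (- h) r + 0 * J (- h) r <= Rpower 4 h * J (- g) r + 0 * J (- g) r).
    { replace (J (- h) r / (2 * PI) * Rpower 4 g)
        with (/ (2 * PI) * (Rpower 4 g * J (- h) r)) by (field; lra).
      replace (J (- g) r / (2 * PI) * Rpower 4 h)
        with (/ (2 * PI) * (Rpower 4 h * J (- g) r)) by (field; lra).
      apply Rmult_le_compat_l; [left; apply Rinv_0_lt_compat|]; lra. }
    unfold J. rewrite !Ropp_involutive.
    assert (Hc : forall b t, continuous (fun t => Rpower (sqdist r t) b) t)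
      by (intros; apply sqdist_pow_continuous; lra).
    rewrite <- !RInt_lin by auto. apply RInt_le_cont; [lra| | |].
    + intros t. unfold sqdist. solve_continuous; apply sqdist_pos; lra.
    + intros t. unfold sqdist. solve_continuous; apply sqdist_pos; lra.
    + intros t. rewrite !Rmult_0_l, !Rplus_0_r.
      pose proof (sqdist_pos r t ltac:(lra)). pose proof (sqdist_le4 r t ltac:(lra)).
      replace h with (g + (h - g)) by ring. rewrite !Rpower_plus.
      pose proof (Rpower_le_4 (sqdist r t) (h - g) ltac:(lra) ltac:(lra)).
      pose proof (Rpower_pos 4 g). pose proof (Rpower_pos (sqdist r t) g).
      replace (Rpower 4 g * (Rpower (sqdist r t) g * Rpower (sqdist r t) (h - g)))
        with (Rpower 4 g * Rpower (sqdist r t) g * Rpower (sqdist r t) (h - g)) by ring.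
      replace (Rpower 4 g * Rpower 4 (h - g) * Rpower (sqdist r t) g)
        with (Rpower 4 g * Rpower (sqdist r t) g * Rpower 4 (h - g)) by ring.
      apply Rmult_le_compat_l; nra.
  - apply filterlim_at_left_mult; [apply J_lim_correct; lra|apply filterlim_const].
  - apply filterlim_at_left_mult; [apply J_lim_correct; lra|apply filterlim_const].
Qed.

(** Let [r] tend to 1 in [J_three_term] with [b = - (g + 1)]: the factor [1 + r^2] becomes 2 and the
    term with [(1 - r^2)^2] disappears. *)
Lemma J_lim_rec (g : R) : 0 <= g -> (g + 1) * J_lim (g + 1) = 2 * (2 * g + 1) * J_lim g.
Proof.
  intros Hg. pose proof PI_RGT_0 as Hpi.
  (* From [D^(g-1) <= 4^g D^(-1)] and the mean of the Poisson kernel, one factor [1 - r^2] keeps the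
     integral bounded and the other sends the product to 0. *)
  assert (Hz : filterlim (fun r => (1 - r ^ 2) ^ 2 * J (1 - g) r) (at_left 1) (locally 0)).
  { apply (filterlim_le_le (F := at_left 1) (fun _ => 0) _
             (fun r => (1 - r ^ 2) * (Rpower 4 g * (2 * PI))) (Finite 0)).
    - generalize (at_left_1_interval 0 Rlt_0_1). apply filter_imp. intros r Hr.
      pose proof (J_pos (1 - g) r ltac:(lra)). split.
      { apply Rmult_le_pos; [apply pow2_ge_0|lra]. }
      rewrite <- (J_poisson r) by lra.
      replace ((1 - r ^ 2) ^ 2 * J (1 - g) r)
        with ((1 - r ^ 2) * ((1 - r ^ 2) * J (1 - g) r)) by ring.
      replace (Rpower 4 g * ((1 - r ^ 2) * J 1 r)) with ((1 - r ^ 2) * (Rpower 4 g * J 1 r)) by ring.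
      apply Rmult_le_compat_l; [nra|]. apply Rmult_le_compat_l; [nra|].
      rewrite <- (Rplus_0_r (Rpower 4 g * J 1 r)), <- (Rmult_0_l (J 1 r)).
      unfold J. rewrite <- RInt_lin by (intros; apply sqdist_pow_continuous; lra).
      apply RInt_le_cont; [lra| | |].
      + intros; apply sqdist_pow_continuous; lra.
      + intros t. unfold sqdist. solve_continuous; apply sqdist_pos; lra.
      + intros t. rewrite Rmult_0_l, Rplus_0_r.
        pose proof (sqdist_pos r t ltac:(lra)) as HD. pose proof (sqdist_le4 r t ltac:(lra)).
        replace (- (1 - g)) with (g + - (1)) by ring. rewrite Rpower_plus.
        apply Rmult_le_compat_r; [left; apply Rpower_pos|]. apply Rpower_le_4; lra.
    - apply (filterlim_const (0 : R)).
    - replace (Finite 0) with (Finite ((1 - 1 ^ 2) * (Rpower 4 g * (2 * PI)))) by (f_equal; ring).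
      apply (continuous_at_left (fun r => (1 - r ^ 2) * (Rpower 4 g * (2 * PI)))).
      solve_continuous. }
  apply filterlim_at_left_unique with (fun r => (g + 1) * (J (- (g + 1)) r / (2 * PI))).
  - apply filterlim_at_left_mult; [apply filterlim_const|apply J_lim_correct; lra].
  - replace (2 * (2 * g + 1) * J_lim g)
      with ((2 * g + 1) * (1 + 1 ^ 2) * J_lim g + - g / (2 * PI) * 0) by ring.
    apply filterlim_at_left_ext with
      (fun r => (2 * g + 1) * (1 + r ^ 2) * (J (- g) r / (2 * PI))
                + - g / (2 * PI) * ((1 - r ^ 2) ^ 2 * J (1 - g) r)).
    + intros r Hr. pose proof (J_three_term (- (g + 1)) r ltac:(lra)) as H3.
      replace (- (g + 1) + 2) with (1 - g) in H3 by ring.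
      replace (- (g + 1) + 1) with (- g) in H3 by ring.
      apply Rmult_eq_reg_r with (2 * PI); [|lra].
      transitivity ((2 * g + 1) * (1 + r ^ 2) * J (- g) r - g * (1 - r ^ 2) ^ 2 * J (1 - g) r).
      * field. lra.
      * transitivity ((g + 1) * J (- (g + 1)) r); [nra|field; lra].
    + apply filterlim_at_left_plus.
      * apply filterlim_at_left_mult; [|now apply J_lim_correct].
        apply (continuous_at_left (fun r => (2 * g + 1) * (1 + r ^ 2))). solve_continuous.
      * apply filterlim_at_left_mult; [apply filterlim_const|exact Hz].
Qed.

Lemma J_lim_eq (g : R) : 0 <= g -> J_lim g = gamma_ratio g.
Proof.
  apply gamma_ratio_unique; [apply J_lim_zero|apply J_lim_rec|apply J_lim_incr].
Qed.

(** * The kernel mean expressed through [J] *)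

Lemma Cmod_circ (r t : R) : 0 <= r -> Cmod (RtoC r * circ t)%C = r.
Proof.
  intros Hr. rewrite Cmod_mult, Cmod_R, Rabs_pos_eq by exact Hr.
  unfold Cmod, circ; simpl. pose proof (sin2_cos2 t) as H. unfold Rsqr in H.
  replace (cos t * (cos t * 1) + sin t * (sin t * 1)) with 1 by lra.
  rewrite sqrt_1. ring.
Qed.

Lemma Cmod_one_minus_circ (r t : R) : Cmod (RtoC 1 - RtoC r * circ t)%C = sqrt (sqdist r t).
Proof.
  unfold Cmod. f_equal. unfold circ, sqdist; simpl.
  pose proof (sin2_cos2 t) as H. unfold Rsqr in H. nra.
Qed.

Lemma K_kernel_circ (a r t : R) : 0 <= r < 1 ->
  K_kernel a (RtoC r * circ t)%C
  = c_const a * Rpower (1 - r ^ 2) (a + 1) * Rpower (sqdist r t) (- (a / 2 + 1)).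
Proof.
  intros Hr. unfold K_kernel. rewrite Cmod_circ, Cmod_one_minus_circ by lra.
  rewrite <- Rpower_sqrt by (apply sqdist_pos; lra). rewrite Rpower_mult.
  rewrite Rpower_Ropp. replace (/ 2 * (a + 2)) with (a / 2 + 1) by field.
  unfold Rdiv. ring.
Qed.

Lemma M_mean_J (a r : R) : 0 <= r < 1 ->
  M_mean a r = c_const a / (2 * PI) * J (- (a / 2)) r.
Proof.
  intros Hr. unfold M_mean. rewrite <- (kernel_mean_eq a r Hr).
  set (c := c_const a * Rpower (1 - r ^ 2) (a + 1)).
  rewrite (RInt_ext _ (fun t => c * Rpower (sqdist r t) (- (a / 2 + 1)))).
  - rewrite (RInt_scal (V := R_CompleteNormedModule)).
    + unfold scal; simpl; unfold mult; simpl. unfold c, J. pose proof PI_RGT_0.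
      simpl. field. lra.
    + apply ex_RInt_cont. intros; apply sqdist_pow_continuous; lra.
  - intros t _. unfold c. now apply K_kernel_circ.
Qed.

Lemma M_mean_hypergeometric (a r : R) : 0 <= a -> 0 <= r < 1 ->
  M_mean a r = Gamma (1 + a / 2) ^ 2 / Gamma (1 + a)
               * hypergeometric (- (a / 2)) (- (a / 2)) 1 (r ^ 2).
Proof.
  intros Ha Hr. rewrite M_mean_J, J_hyper, hypergeometric_PSeries by assumption.
  unfold c_const, hyper_y. rewrite (Rplus_comm (a / 2) 1).
  pose proof PI_RGT_0. pose proof (Gamma_pos (1 + a) ltac:(lra)). field. lra.
Qed.

Lemma is_derive_M_mean (a r : R) : 0 < r < 1 ->
  is_derive (M_mean a) r (c_const a / (2 * PI) * (J_p (- (a / 2)) r / r)).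
Proof.
  intros Hr. apply is_derive_ext_loc with (fun r => c_const a / (2 * PI) * J (- (a / 2)) r).
  - assert (H : locally r (fun y => 0 < y < 1)).
    { apply filter_and; [apply (open_gt 0)|apply (open_lt 1)]; lra. }
    revert H. apply filter_imp. intros y Hy. symmetry. apply M_mean_J. lra.
  - apply (is_derive_scal (J (- (a / 2)))). now apply is_derive_J'.
Qed.

(** The formula for [J_p] splits the derivative in two. The part with [(1 - r^2) J (1 - a / 2)]
    tends to 0 because [a > 0]; in the other part the limit [gamma_ratio (a / 2)] cancels
    [c_const a], its inverse. *)
Lemma Derive_M_mean_lim (a : R) : 0 < a ->
  filterlim (Derive (M_mean a)) (at_left 1) (locally (a / 2)).
Proof.
  intros Ha. pose proof PI_RGT_0 as Hpi.
  apply filterlim_at_left_ext with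
    (fun r => c_const a * (a / 2) * / r *
       (J (- (a / 2)) r / (2 * PI) + - / (2 * PI) * ((1 - r ^ 2) * J (1 - a / 2) r))).
  - intros r Hr. symmetry. apply is_derive_unique.
    evar_last; [now apply is_derive_M_mean|].
    unfold J_p. replace (- (a / 2) + 1) with (1 - a / 2) by ring. field. lra.
  - assert (E : c_const a * (a / 2) * / 1 * (J_lim (a / 2) + - / (2 * PI) * 0) = a / 2).
    + rewrite J_lim_eq by lra. unfold c_const, gamma_ratio.
      replace (1 + 2 * (a / 2)) with (1 + a) by field. rewrite (Rplus_comm (a / 2) 1).
      pose proof (Gamma_pos (1 + a) ltac:(lra)). pose proof (Gamma_pos (1 + a / 2) ltac:(lra)).
      field. lra.
    + refine (eq_ind _ (fun l => filterlim _ (at_left 1) (locally l)) _ _ E).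
      apply filterlim_at_left_mult.
      * apply (continuous_at_left (fun r => c_const a * (a / 2) * / r)). solve_continuous. lra.
      * apply filterlim_at_left_plus; [apply J_lim_correct; lra|].
        apply filterlim_at_left_mult; [apply filterlim_const|apply J_one_minus_lim; lra].
Qed.

(** * Harmonic functions in polar coordinates *)

Definition cont2 (f : R -> R -> R) (s t : R) : Prop :=
  continuous (fun p : R * R => f (fst p) (snd p)) (s, t).

Lemma cont2_snd (f : R -> R -> R) (s t : R) : cont2 f s t -> continuous (f s) t.
Proof.
  intros H. apply (continuous_comp_2 (fun _ : R => s) (fun t : R => t) f t).
  - apply continuous_const.
  - apply continuous_id.
  - exact H.
Qed.

(* [U] is a harmonic function in polar coordinates, [Ur] its radial derivative,
   [s * Ut] its angular derivative; the last two equations are the Cauchy-Riemann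
   equations of the holomorphic function [Ur - i Ut], up to a rotation. *)
Record polar_harmonic (U Ur Ut X Y : R -> R -> R) : Prop := {
  ph_U_s : forall s t, -1 < s < 1 -> is_derive (fun s => U s t) s (Ur s t);
  ph_U_t : forall s t, -1 < s < 1 -> is_derive (U s) t (s * Ut s t);
  ph_Ur_s : forall s t, -1 < s < 1 -> is_derive (fun s => Ur s t) s (Y s t);
  ph_Ut_s : forall s t, -1 < s < 1 -> is_derive (fun s => Ut s t) s (X s t);
  ph_Ur_t : forall s t, -1 < s < 1 -> is_derive (Ur s) t (s * X s t + Ut s t);
  ph_Ut_t : forall s t, -1 < s < 1 -> is_derive (Ut s) t (- s * Y s t - Ur s t);
  ph_U_cont : forall s t, -1 < s < 1 -> cont2 U s t;
  ph_Ur_cont : forall s t, -1 < s < 1 -> cont2 Ur s t;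
  ph_Ut_cont : forall s t, -1 < s < 1 -> cont2 Ut s t;
  ph_X_cont : forall s t, -1 < s < 1 -> cont2 X s t;
  ph_Y_cont : forall s t, -1 < s < 1 -> cont2 Y s t;
  ph_U_per : forall s t, U s (t + 2 * PI) = U s t;
  ph_Ur_per : forall s, Ur s (2 * PI) = Ur s 0;
  ph_Ut_per : forall s, Ut s (2 * PI) = Ut s 0
}.

(** With [z = r e^{it}], [poisson] and [conj_poisson] are the real and imaginary parts of
    [(1 + z) / (1 - z)]. *)
Definition poisson (r t : R) : R := (1 - r ^ 2) * / sqdist r t.
Definition conj_poisson (r t : R) : R := 2 * r * sin t * / sqdist r t.

(** Radial derivatives of the two kernels. By the Cauchy-Riemann equations they also give the
    angular derivatives, with the roles exchanged. *)
Definition poisson_r (r t : R) : R :=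
  (2 * cos t * (1 + r ^ 2) - 4 * r) * / (sqdist r t ^ 2).
Definition conj_poisson_r (r t : R) : R :=
  2 * sin t * (1 - r ^ 2) * / (sqdist r t ^ 2).

Lemma is_derive_poisson_r (r t : R) : -1 < r < 1 ->
  is_derive (fun r => poisson r t) r (poisson_r r t).
Proof.
  intros Hr. pose proof (sqdist_pos r t Hr) as HD.
  unfold poisson, poisson_r, sqdist in *. auto_derive; [simpl in *; lra|].
  field. simpl in *. lra.
Qed.

Lemma is_derive_conj_poisson_r (r t : R) : -1 < r < 1 ->
  is_derive (fun r => conj_poisson r t) r (conj_poisson_r r t).
Proof.
  intros Hr. pose proof (sqdist_pos r t Hr) as HD.
  unfold conj_poisson, conj_poisson_r, sqdist in *. auto_derive; [simpl in *; lra|].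
  field. simpl in *. lra.
Qed.

Lemma is_derive_poisson_t (r t : R) : -1 < r < 1 ->
  is_derive (poisson r) t (- (r * conj_poisson_r r t)).
Proof.
  intros Hr. pose proof (sqdist_pos r t Hr) as HD.
  unfold poisson, conj_poisson_r, sqdist in *. auto_derive; [simpl in *; lra|].
  field. simpl in *. lra.
Qed.

Lemma is_derive_conj_poisson_t (r t : R) : -1 < r < 1 ->
  is_derive (conj_poisson r) t (r * poisson_r r t).
Proof.
  intros Hr. pose proof (sqdist_pos r t Hr) as HD.
  unfold conj_poisson, poisson_r, sqdist in *. auto_derive; [simpl in *; lra|].
  pose proof (sin2_cos2 t) as H. unfold Rsqr in H.
  assert (E : sin t * sin t = 1 - cos t * cos t) by lra.
  apply Rmult_eq_reg_r with ((1 - 2 * r * cos t + r ^ 2) ^ 2); [|apply pow_nonzero; lra].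
  transitivity (2 * r * cos t * (1 - 2 * r * cos t + r ^ 2) - 4 * r ^ 2 * (sin t * sin t));
    [field; simpl in *; lra|].
  rewrite E. field. simpl in *. lra.
Qed.

Lemma poisson_cont2 (r t : R) : -1 < r < 1 -> cont2 poisson r t.
Proof.
  intros Hr. pose proof (sqdist_pos r t Hr) as HD. unfold cont2, poisson, sqdist in *.
  solve_continuous. simpl in *. lra.
Qed.

Lemma conj_poisson_cont2 (r t : R) : -1 < r < 1 -> cont2 conj_poisson r t.
Proof.
  intros Hr. pose proof (sqdist_pos r t Hr) as HD. unfold cont2, conj_poisson, sqdist in *.
  solve_continuous. simpl in *. lra.
Qed.

Lemma poisson_r_cont2 (r t : R) : -1 < r < 1 -> cont2 poisson_r r t.
Proof.
  intros Hr. pose proof (sqdist_pos r t Hr) as HD. unfold cont2, poisson_r, sqdist in *.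
  solve_continuous. apply pow_nonzero. simpl in *. lra.
Qed.

Lemma conj_poisson_r_cont2 (r t : R) : -1 < r < 1 -> cont2 conj_poisson_r r t.
Proof.
  intros Hr. pose proof (sqdist_pos r t Hr) as HD. unfold cont2, conj_poisson_r, sqdist in *.
  solve_continuous. apply pow_nonzero. simpl in *. lra.
Qed.

(** * Rules for joint continuity and derivatives *)

Lemma cont2_comp_fst (f : R -> R -> R) (k : R -> R) (s t : R) :
  continuous k s -> cont2 f (k s) t -> cont2 (fun s t => f (k s) t) s t.
Proof.
  intros Hk Hf.
  apply (continuous_comp_2 (fun p : R * R => k (fst p)) (fun p : R * R => snd p) f (s, t)).
  - apply (continuous_comp fst k); [apply continuous_fst|exact Hk].
  - apply continuous_snd.
  - exact Hf.
Qed.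

Lemma cont2_mult (f g : R -> R -> R) (s t : R) :
  cont2 f s t -> cont2 g s t -> cont2 (fun s t => f s t * g s t) s t.
Proof.
  intros Hf Hg. apply (continuous_mult (K := R_AbsRing)
    (fun p : R * R => f (fst p) (snd p)) (fun p : R * R => g (fst p) (snd p))); assumption.
Qed.

Lemma cont2_plus (f g : R -> R -> R) (s t : R) :
  cont2 f s t -> cont2 g s t -> cont2 (fun s t => f s t + g s t) s t.
Proof.
  intros Hf Hg. apply (continuous_plus (V := R_NormedModule)
    (fun p : R * R => f (fst p) (snd p)) (fun p : R * R => g (fst p) (snd p))); assumption.
Qed.

Lemma cont2_fst (k : R -> R) (s t : R) : continuous k s -> cont2 (fun s _ => k s) s t.
Proof. intros H. apply (continuous_comp fst k); [apply continuous_fst|exact H]. Qed.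

Lemma continuous_mult_const (b s : R) : continuous (fun s : R => b * s) s.
Proof. solve_continuous. Qed.

Lemma is_derive_multR (f g : R -> R) (x df dg : R) :
  is_derive f x df -> is_derive g x dg ->
  is_derive (fun x => f x * g x) x (df * g x + f x * dg).
Proof. intros Hf Hg. apply (is_derive_mult f g); auto. intros; apply Rmult_comm. Qed.

Lemma is_derive_plusR (f g : R -> R) (x df dg : R) :
  is_derive f x df -> is_derive g x dg -> is_derive (fun x => f x + g x) x (df + dg).
Proof. intros Hf Hg. apply (is_derive_plus (V := R_NormedModule) f g); auto. Qed.

Lemma is_derive_minusR (f g : R -> R) (x df dg : R) :
  is_derive f x df -> is_derive g x dg -> is_derive (fun x => f x - g x) x (df - dg).
Proof. intros Hf Hg. apply (is_derive_minus (V := R_NormedModule) f g); auto. Qed.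

Lemma is_derive_compR (f g : R -> R) (x df dg : R) :
  is_derive f (g x) df -> is_derive g x dg -> is_derive (fun x => f (g x)) x (dg * df).
Proof. intros Hf Hg. apply (is_derive_comp f g); auto. Qed.

Ltac solve_cont2 :=
  lazymatch goal with
  | |- cont2 (fun s t => @?f s t + @?g s t) _ _ => apply (cont2_plus f g); solve_cont2
  | |- cont2 (fun s t => @?f s t * @?g s t) _ _ => apply (cont2_mult f g); solve_cont2
  | |- _ => idtac
  end.

Section Harmonic.

Variables U Ur Ut X Y : R -> R -> R.
Hypothesis HU : polar_harmonic U Ur Ut X Y.

(* Cauchy's theorem for the product of the holomorphic functions with real
   parts [poisson] and [s * Ur]. *)
Lemma green_zero (b s : R) : 0 <= b -> 0 < s < 1 -> b * s < 1 ->
  RInt (fun t => poisson (b * s) t * Ur s t + conj_poisson (b * s) t * Ut s t) 0 (2 * PI) = 0.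
Proof.
  intros Hb Hs Hbs.
  set (h := fun s t => s * (poisson (b * s) t * Ur s t + conj_poisson (b * s) t * Ut s t)).
  set (dh := fun s t => (poisson (b * s) t * Ur s t + conj_poisson (b * s) t * Ut s t)
    + s * ((b * poisson_r (b * s) t * Ur s t + poisson (b * s) t * Y s t)
           + (b * conj_poisson_r (b * s) t * Ut s t + conj_poisson (b * s) t * X s t))).
  assert (Hb1 : forall x, 0 <= x <= s -> -1 < b * x < 1) by (intros; split; nra).
  assert (cb : forall k x, continuous (fun s : R => k * s) x)
    by (intros; apply continuous_mult_const).
  assert (ch : forall x t, -1 < x < 1 -> -1 < b * x < 1 -> cont2 h x t).
  { intros x t Hx Hbx. unfold h. apply (cont2_mult (fun s _ => s)).
    { apply cont2_fst, continuous_id. }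
    apply cont2_plus; apply cont2_mult.
    - apply (cont2_comp_fst poisson); [apply cb|now apply poisson_cont2].
    - now apply (ph_Ur_cont _ _ _ _ _ HU).
    - apply (cont2_comp_fst conj_poisson); [apply cb|now apply conj_poisson_cont2].
    - now apply (ph_Ut_cont _ _ _ _ _ HU). }
  assert (cdh : forall x t, -1 < x < 1 -> -1 < b * x < 1 -> cont2 dh x t).
  { intros x t Hx Hbx. unfold dh.
    assert (c1 : cont2 (fun s t => poisson (b * s) t) x t)
      by (apply (cont2_comp_fst poisson); [apply cb|now apply poisson_cont2]).
    assert (c2 : cont2 (fun s t => conj_poisson (b * s) t) x t)
      by (apply (cont2_comp_fst conj_poisson); [apply cb|now apply conj_poisson_cont2]).
    assert (c3 : cont2 (fun s t => poisson_r (b * s) t) x t)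
      by (apply (cont2_comp_fst poisson_r); [apply cb|now apply poisson_r_cont2]).
    assert (c4 : cont2 (fun s t => conj_poisson_r (b * s) t) x t)
      by (apply (cont2_comp_fst conj_poisson_r); [apply cb|now apply conj_poisson_r_cont2]).
    destruct HU.
    assert (cc : forall k : R, cont2 (fun _ _ => k) x t)
      by (intros; apply (cont2_fst (fun _ => k)), continuous_const).
    assert (ci : cont2 (fun s _ => s) x t) by apply (cont2_fst (fun s => s)), continuous_id.
    solve_cont2; auto. }
  assert (dhh : forall x t, -1 < x < 1 -> -1 < b * x < 1 ->
            is_derive (fun s => h s t) x (dh x t)).
  { intros x t Hx Hbx. unfold h, dh. destruct HU.
    assert (db : is_derive (fun s : R => b * s) x b) by (auto_derive; [trivial|ring]).
    evar_last.
    - apply is_derive_multR; [apply is_derive_id|].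
      apply is_derive_plusR; apply is_derive_multR; eauto.
      + apply (is_derive_compR (fun r => poisson r t) (fun s => b * s));
          [now apply is_derive_poisson_r|exact db].
      + apply (is_derive_compR (fun r => conj_poisson r t) (fun s => b * s));
          [now apply is_derive_conj_poisson_r|exact db].
    - unfold one; simpl. ring. }
  assert (Hloc : forall x, 0 <= x <= s -> locally x (fun y => -1 < y < 1 /\ -1 < b * y < 1)).
  { intros x Hx. apply filter_and; [apply locally_unit_interval; lra|].
    refine (cb b x (fun z => -1 < z < 1) _). apply locally_unit_interval. auto. }
  assert (HD : forall x, 0 <= x <= s ->
    is_derive (fun s => RInt (h s) 0 (2 * PI)) x (RInt (dh x) 0 (2 * PI))).
  { intros x Hx. apply (is_derive_RInt_cont2 h dh).
    - generalize (Hloc x Hx). apply filter_imp. intros y [H1 H2] t. now apply dhh.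
    - generalize (Hloc x Hx). apply filter_imp. intros y [H1 H2] t.
      apply cont2_snd. now apply ch.
    - intros t. apply cdh; [lra|auto]. }
  assert (HD0 : forall x, 0 <= x <= s -> RInt (dh x) 0 (2 * PI) = 0).
  { intros x Hx. specialize (Hb1 x Hx).
    (* Cauchy-Riemann for the holomorphic product [s (poisson + i conj_poisson) (Ur - i Ut)]: the
       radial derivative of its real part [h] is the angular derivative of its imaginary part
       divided by [s]. *)
    apply (RInt_derive_periodic
      (fun t => conj_poisson (b * x) t * Ur x t - poisson (b * x) t * Ut x t)).
    - intros t. destruct HU. evar_last.
      + apply is_derive_minusR; apply is_derive_multR.
        * now apply is_derive_conj_poisson_t.
        * apply ph_Ur_t0. lra.
        * now apply is_derive_poisson_t.
        * apply ph_Ut_t0. lra.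
      + unfold dh. ring.
    - intros t. apply cont2_snd, cdh; [lra|auto].
    - destruct HU. rewrite ph_Ur_per0, ph_Ut_per0.
      unfold conj_poisson, poisson, sqdist. rewrite sin_0, cos_0, sin_2PI, cos_2PI. reflexivity. }
  assert (E : RInt (h s) 0 (2 * PI) = RInt (h 0) 0 (2 * PI)).
  { apply (const_of_derive_zero (fun s => RInt (h s) 0 (2 * PI))); [lra| |].
    - intros x Hx. evar_last; [apply HD|apply HD0]; lra.
    - intros x Hx. apply is_derive_continuous with (1 := HD x Hx). }
  (* The factor [s] in [h] makes the constant 0; it is divided out at the end, where [s > 0]. *)
  assert (E0 : RInt (h 0) 0 (2 * PI) = RInt (fun _ => 0) 0 (2 * PI)).
  { apply RInt_ext. intros t _. apply Rmult_0_l. }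
  rewrite E0, (RInt_const (V := R_CompleteNormedModule)) in E. unfold h in E.
  rewrite (RInt_scal (V := R_CompleteNormedModule)
    (fun t => poisson (b * s) t * Ur s t + conj_poisson (b * s) t * Ut s t)) in E.
  - unfold scal in E; simpl in E; unfold mult in E; simpl in E.
    rewrite Rmult_0_r in E. apply Rmult_integral in E. destruct E as [E|E]; [lra|exact E].
  - apply ex_RInt_cont. intros t.
    apply (cont2_snd (fun s t => poisson (b * s) t * Ur s t + conj_poisson (b * s) t * Ut s t)).
    assert (-1 < b * s < 1) by (apply Hb1; lra).
    apply cont2_plus; apply cont2_mult.
    + apply (cont2_comp_fst poisson); [apply cb|now apply poisson_cont2].
    + apply (ph_Ur_cont _ _ _ _ _ HU). lra.
    + apply (cont2_comp_fst conj_poisson); [apply cb|now apply conj_poisson_cont2].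
    + apply (ph_Ut_cont _ _ _ _ _ HU). lra.
Qed.

Lemma mean_const (s : R) : 0 < s < 1 ->
  RInt (U s) 0 (2 * PI) = RInt (U 0) 0 (2 * PI).
Proof.
  intros Hs.
  assert (HD : forall x, -1 < x < 1 ->
    is_derive (fun s => RInt (U s) 0 (2 * PI)) x (RInt (Ur x) 0 (2 * PI))).
  { intros x Hx. destruct HU. apply (is_derive_RInt_cont2 U Ur).
    - generalize (locally_unit_interval x Hx). apply filter_imp. auto.
    - generalize (locally_unit_interval x Hx). apply filter_imp. intros y Hy t.
      apply cont2_snd. auto.
    - intros t. now apply ph_Ur_cont0. }
  apply (const_of_derive_zero (fun s => RInt (U s) 0 (2 * PI))); [lra| |].
  - intros x Hx. evar_last; [apply HD; lra|].
    (* For [b = 0] the Poisson kernel is 1 and its conjugate is 0, so [green_zero] becomes the mean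
       value property. *)
    transitivity (RInt (fun t => poisson (0 * x) t * Ur x t + conj_poisson (0 * x) t * Ut x t)
                    0 (2 * PI)).
    + apply RInt_ext. intros t _. rewrite Rmult_0_l.
      unfold poisson, conj_poisson, sqdist. simpl. field.
    + apply green_zero; lra.
  - intros x Hx. apply is_derive_continuous with (RInt (Ur x) 0 (2 * PI)). apply HD. lra.
Qed.

(** Both integrals should equal the value at distance [c], by Poisson's formula on two circles;
    instead, the derivative in the radius is shown to vanish. This uses [green_zero] with
    [b = c / x^2], chosen so that [b * x = c / x]. *)
Lemma poisson_dilation (c s S : R) : 0 < c < s -> s <= S < 1 ->
  RInt (fun t => poisson (c / S) t * U S t) 0 (2 * PI)
  = RInt (fun t => poisson (c / s) t * U s t) 0 (2 * PI).
Proof.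
  intros Hc HS. destruct (proj1 HS) as [HsS| ->]; [|reflexivity].
  set (k := fun s t => poisson (c / s) t * U s t).
  set (dk := fun s t => - (c * / s ^ 2) * poisson_r (c / s) t * U s t + poisson (c / s) t * Ur s t).
  assert (Hr : forall x, c < x < 1 -> -1 < c / x < 1).
  { intros x Hx. assert (0 < c / x) by (apply Rdiv_lt_0_compat; lra).
    split; [lra|]. apply Rlt_div_l; lra. }
  assert (cd : forall x, c < x -> continuous (fun s : R => c / s) x)
    by (intros; unfold Rdiv; solve_continuous; lra).
  assert (Hloc : forall x, c < x < 1 -> locally x (fun y => c < y < 1)).
  { intros x Hx. apply filter_and; [apply (open_gt c)|apply (open_lt 1)]; lra. }
  assert (ck : forall x t, c < x < 1 -> cont2 k x t).
  { intros x t Hx. apply cont2_mult.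
    - apply (cont2_comp_fst poisson _ _ _ (cd x ltac:(lra))). apply poisson_cont2; auto.
    - apply (ph_U_cont _ _ _ _ _ HU). lra. }
  assert (cdk : forall x t, c < x < 1 -> cont2 dk x t).
  { intros x t Hx. apply cont2_plus; apply cont2_mult.
    - apply cont2_mult.
      + apply (cont2_fst (fun s => - (c * / s ^ 2))). solve_continuous. apply pow_nonzero; lra.
      + apply (cont2_comp_fst poisson_r _ _ _ (cd x ltac:(lra))). apply poisson_r_cont2; auto.
    - apply (ph_U_cont _ _ _ _ _ HU). lra.
    - apply (cont2_comp_fst poisson _ _ _ (cd x ltac:(lra))). apply poisson_cont2; auto.
    - apply (ph_Ur_cont _ _ _ _ _ HU). lra. }
  assert (HD : forall x, c < x < 1 ->
    is_derive (fun s => RInt (k s) 0 (2 * PI)) x (RInt (dk x) 0 (2 * PI))).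
  { intros x Hx. apply (is_derive_RInt_cont2 k dk).
    - generalize (Hloc x Hx). apply filter_imp. intros y Hy t. unfold k, dk.
      evar_last.
      + apply is_derive_multR; [|apply (ph_U_s _ _ _ _ _ HU); lra].
        apply (is_derive_compR (fun r => poisson r t) (fun s => c / s)).
        * apply is_derive_poisson_r; auto.
        * auto_derive; [lra|reflexivity].
      + simpl. field. lra.
    - generalize (Hloc x Hx). apply filter_imp. intros y Hy t. apply cont2_snd; auto.
    - intros t. now apply cdk. }
  assert (HD0 : forall x, c < x < 1 -> RInt (dk x) 0 (2 * PI) = 0).
  { intros x Hx. specialize (Hr x Hx).
    set (k1 := fun t => c / x * poisson_r (c / x) t * U x t + conj_poisson (c / x) t * (x * Ut x t)).
    set (k2 := fun t => poisson (c / x) t * Ur x t + conj_poisson (c / x) t * Ut x t).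
    assert (c1 : forall t, continuous k1 t).
    { intros t. unfold k1.
      assert (continuous (poisson_r (c / x)) t) by now apply cont2_snd, poisson_r_cont2.
      assert (continuous (conj_poisson (c / x)) t) by now apply cont2_snd, conj_poisson_cont2.
      assert (continuous (U x) t) by (apply cont2_snd, (ph_U_cont _ _ _ _ _ HU); lra).
      assert (continuous (Ut x) t) by (apply cont2_snd, (ph_Ut_cont _ _ _ _ _ HU); lra).
      solve_continuous; assumption. }
    assert (c2 : forall t, continuous k2 t).
    { intros t. unfold k2.
      assert (continuous (poisson (c / x)) t) by now apply cont2_snd, poisson_cont2.
      assert (continuous (conj_poisson (c / x)) t) by now apply cont2_snd, conj_poisson_cont2.
      assert (continuous (Ur x) t) by (apply cont2_snd, (ph_Ur_cont _ _ _ _ _ HU); lra).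
      assert (continuous (Ut x) t) by (apply cont2_snd, (ph_Ut_cont _ _ _ _ _ HU); lra).
      solve_continuous; assumption. }
    (* The term with [conj_poisson * Ut] is added and subtracted: [k1] is then the angular
       derivative of [conj_poisson (c / x) t * U x t], and [k2] is the integrand of [green_zero]. *)
    rewrite (RInt_ext _ (fun t => - / x * k1 t + 1 * k2 t)).
    - rewrite RInt_lin by assumption.
      assert (E1 : RInt k1 0 (2 * PI) = 0).
      { apply (RInt_derive_periodic (fun t => conj_poisson (c / x) t * U x t)).
        - intros t. apply is_derive_multR; [now apply is_derive_conj_poisson_t|].
          apply (ph_U_t _ _ _ _ _ HU). lra.
        - exact c1.
        - unfold conj_poisson. rewrite sin_0, sin_2PI. ring. }
      assert (E2 : RInt k2 0 (2 * PI) = 0).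
      { unfold k2. replace (c / x) with (c / x ^ 2 * x) by (field; lra).
        apply green_zero.
        - left. apply Rdiv_lt_0_compat; [lra|apply pow_lt; lra].
        - lra.
        - replace (c / x ^ 2 * x) with (c / x) by (field; lra). lra. }
      rewrite E1, E2. simpl. ring.
    - intros t _.
      assert (E : dk x t = - / x * k1 t + 1 * k2 t); [unfold dk, k1, k2; field; lra|exact E]. }
  destruct (MVT_gen (fun s => RInt (k s) 0 (2 * PI)) s S (fun _ => 0)) as (z & _ & E).
  - intros x Hx. rewrite Rmin_left, Rmax_right in Hx by lra.
    evar_last; [apply HD|apply HD0]; lra.
  - intros x Hx. rewrite Rmin_left, Rmax_right in Hx by lra.
    apply continuity_pt_filterlim.
    apply (is_derive_continuous _ _ _ (HD x ltac:(lra))).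
  - unfold k in E. lra.
Qed.

End Harmonic.

(** * A Schwarz lemma at the boundary *)

Lemma RInt_extR (f g : R -> R) (a b : R) :
  (forall t, f t = g t) -> RInt f a b = RInt g a b.
Proof. intros H. apply RInt_ext. auto. Qed.

Lemma RInt_constR (a b c : R) : RInt (fun _ => c) a b = (b - a) * c.
Proof. rewrite (RInt_const (V := R_CompleteNormedModule)). reflexivity. Qed.

Lemma poisson_continuous (r t : R) : -1 < r < 1 -> continuous (poisson r) t.
Proof. intros Hr. now apply cont2_snd, poisson_cont2. Qed.

Lemma poisson_mean (r : R) : 0 <= r < 1 -> RInt (poisson r) 0 (2 * PI) = 2 * PI.
Proof.
  intros Hr. transitivity ((1 - r ^ 2) * J 1 r); [unfold J|now apply J_poisson].
  rewrite <- (RInt_scal (V := R_CompleteNormedModule)).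
  - apply RInt_ext. intros t _. unfold poisson.
    rewrite Rpower_Ropp, Rpower_1 by (apply sqdist_pos; lra). reflexivity.
  - apply ex_RInt_cont. intros; apply sqdist_pow_continuous; lra.
Qed.

Lemma poisson_pos (r t : R) : 0 <= r < 1 -> 0 <= poisson r t.
Proof.
  intros Hr. left. apply Rmult_lt_0_compat; [nra|].
  apply Rinv_0_lt_compat, sqdist_pos. lra.
Qed.

(** Because [D = (1 - r)^2 + 2 r (1 - cos t)]. It measures how the kernel concentrates at [t = 0] as
    [r] tends to 1. *)
Lemma poisson_one_minus_cos (r t : R) : 0 < r < 1 ->
  poisson r t * (1 - cos t) <= (1 - r ^ 2) / (2 * r).
Proof.
  intros Hr. pose proof (sqdist_pos r t ltac:(lra)) as HD.
  apply Rmult_le_reg_r with (2 * r * sqdist r t); [nra|].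
  replace (poisson r t * (1 - cos t) * (2 * r * sqdist r t))
    with ((1 - r ^ 2) * (2 * r * (1 - cos t))) by (unfold poisson; field; lra).
  replace ((1 - r ^ 2) / (2 * r) * (2 * r * sqdist r t)) with ((1 - r ^ 2) * sqdist r t)
    by (field; lra).
  apply Rmult_le_compat_l; [nra|]. unfold sqdist. nra.
Qed.

(* The weight [w] minimizing the Poisson integral is [2] on the half circle
   [cos t < 0] and [0] elsewhere. *)
Lemma poisson_bathtub (w : R -> R) (r : R) : 0 < r < 1 ->
  (forall t, continuous w t) -> (forall t, 0 <= w t <= 2) ->
  RInt w 0 (2 * PI) = 2 * PI ->
  2 * (1 - r ^ 2) <= RInt (fun t => poisson r t * w t) 0 (2 * PI).
Proof.
  intros Hr Hc Hw Hm. pose proof PI_RGT_0 as Hpi.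
  (* The value of the kernel where [cos t = 0], the threshold of the extremal weight:
     [poisson r t - k] has the sign of [cos t]. *)
  set (k := (1 - r ^ 2) / (1 + r ^ 2)).
  set (h := fun t => poisson r t * w t + - k * w t).
  assert (Hh : forall t, continuous h t).
  { intros t. pose proof (poisson_continuous r t ltac:(lra)). unfold h.
    solve_continuous; try assumption; apply Hc. }
  assert (Ek : forall t, poisson r t - k = 2 * r * cos t * (k * / sqdist r t)).
  { intros t. pose proof (sqdist_pos r t ltac:(lra)). unfold poisson, k.
    replace (2 * r * cos t) with (1 + r ^ 2 - sqdist r t) by (unfold sqdist; ring).
    field. pose proof (pow2_ge_0 r). simpl in *. lra. }
  assert (Hk : 0 < k) by (apply Rdiv_lt_0_compat; nra).
  assert (HkD : forall t, 0 < k * / sqdist r t).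
  { intros t. apply Rmult_lt_0_compat; [exact Hk|]. apply Rinv_0_lt_compat, sqdist_pos. lra. }
  assert (Hpos : forall t, 0 <= cos t -> 0 <= h t).
  { intros t Ht. replace (h t) with ((poisson r t - k) * w t) by (unfold h; ring).
    rewrite Ek. specialize (HkD t). specialize (Hw t).
    apply Rmult_le_pos; [|lra]. apply Rmult_le_pos; nra. }
  assert (Hex : forall a b, ex_RInt h a b) by (intros; now apply ex_RInt_cont).
  assert (Hmid : 2 * (1 - r ^ 2) - 2 * PI * k <= RInt h (PI / 2) (3 * (PI / 2))).
  (* For [cos t <= 0] one has [D <= 2 (1 - cos t)], so [2 * poisson r t] is at least
     [(1 - r^2) / (1 - cos t)]. This minorant has the antiderivative [- (1 - r^2) cot (t / 2)], and
     its integral over the half circle is [2 (1 - r^2)]. *)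
  { set (q := fun t => (1 - r ^ 2) / (1 - cos t) - 2 * k).
    assert (Hcos : forall t, PI / 2 <= t <= 3 * (PI / 2) -> cos t <= 0)
      by (intros; apply cos_le_0; lra).
    assert (HI : is_RInt q (PI / 2) (3 * (PI / 2)) (2 * (1 - r ^ 2) - 2 * PI * k)).
    { evar_last.
      - apply (is_RInt_derive
          (fun t => - (1 - r ^ 2) * (sin t / (1 - cos t)) - 2 * k * t) q).
        + intros t Ht. rewrite Rmin_left, Rmax_right in Ht by lra.
          specialize (Hcos t Ht). unfold q. auto_derive; [lra|].
          pose proof (sin2_cos2 t) as HS. unfold Rsqr in HS.
          assert (E : sin t * sin t = 1 - cos t * cos t) by lra.
          apply Rmult_eq_reg_r with ((1 - cos t) ^ 2); [|apply pow_nonzero; lra].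
          transitivity (- (1 - r ^ 2) * (cos t * (1 - cos t) - sin t * sin t)
                        - 2 * k * (1 - cos t) ^ 2); [field; lra|].
          rewrite E. field. lra.
        + intros t Ht. rewrite Rmin_left, Rmax_right in Ht by lra.
          specialize (Hcos t Ht). unfold q, Rdiv. solve_continuous. lra.
      - unfold minus, plus, opp; simpl.
        rewrite sin_PI2, cos_PI2, sin_3PI2, cos_3PI2. field. }
    rewrite <- (is_RInt_unique _ _ _ _ HI).
    apply RInt_le; [lra|now eexists; apply HI|apply Hex|].
    intros t Ht. specialize (Hcos t ltac:(lra)).
    replace (h t) with ((poisson r t - k) * w t) by (unfold h; ring).
    apply Rle_trans with ((poisson r t - k) * 2).
    - enough ((1 - r ^ 2) / (1 - cos t) <= poisson r t * 2) by (unfold q; lra).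
      pose proof (sqdist_pos r t ltac:(lra)) as HD.
      replace (poisson r t * 2) with ((1 - r ^ 2) * / (sqdist r t / 2))
        by (unfold poisson; field; lra).
      apply Rmult_le_compat_l; [nra|]. apply Rinv_le_contravar; [lra|].
      unfold sqdist. nra.
    - assert (poisson r t - k <= 0) by (rewrite Ek; specialize (HkD t); assert (2 * r * cos t <= 0) by nra; nra).
      specialize (Hw t). nra. }
  assert (H1 : 0 <= RInt h 0 (PI / 2)).
  { apply RInt_ge_0; [lra|apply Hex|]. intros t Ht. apply Hpos, cos_ge_0; lra. }
  assert (H2 : 0 <= RInt h (3 * (PI / 2)) (2 * PI)).
  { apply RInt_ge_0; [lra|apply Hex|]. intros t Ht. apply Hpos.
    replace (cos t) with (cos (t - 2 * PI)); [apply cos_ge_0; lra|].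
    rewrite <- (cos_period (t - 2 * PI) 1). f_equal. simpl. ring. }
  assert (E : RInt h 0 (2 * PI)
    = RInt h 0 (PI / 2) + (RInt h (PI / 2) (3 * (PI / 2)) + RInt h (3 * (PI / 2)) (2 * PI))).
  { rewrite <- (RInt_Chasles (V := R_CompleteNormedModule) h 0 (PI / 2) (2 * PI)) by apply Hex.
    rewrite <- (RInt_Chasles (V := R_CompleteNormedModule) h (PI / 2) (3 * (PI / 2)) (2 * PI))
      by apply Hex.
    reflexivity. }
  assert (E2 : RInt h 0 (2 * PI)
    = 1 * RInt (fun t => poisson r t * w t) 0 (2 * PI) + - k * RInt w 0 (2 * PI)).
  { rewrite <- RInt_lin.
    - apply RInt_ext. intros t _. unfold h. now rewrite Rmult_1_l.
    - intros t. pose proof (poisson_continuous r t ltac:(lra)).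
      solve_continuous; [assumption|apply Hc].
    - exact Hc. }
  rewrite Hm in E2. lra.
Qed.

Section Schwarz.

Variables U Ur Ut X Y : R -> R -> R.
Hypothesis HU : polar_harmonic U Ur Ut X Y.

Let Ucont (s t : R) : -1 < s < 1 -> continuous (U s) t.
Proof. intros Hs. now apply cont2_snd, (ph_U_cont _ _ _ _ _ HU). Qed.

Lemma locally_upper_bound (c e : R) : -1 < c < 1 -> 0 < e ->
  exists d, 0 < d /\ forall s t, Rabs (s - c) < d -> Rabs t < d -> U c 0 - e < U s t.
Proof.
  intros Hc He.
  destruct (ph_U_cont _ _ _ _ _ HU c 0 Hc (fun z => U c 0 - e < z)) as [d Hd].
  - apply (open_gt (U c 0 - e)). simpl. lra.
  - exists d. split; [apply cond_pos|]. intros s t Hs Ht.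
    apply (Hd (s, t)). split; [exact Hs|]. change (Rabs (t - 0) < d). now rewrite Rminus_0_r.
Qed.

(** One half of the approximate identity property: as [s] decreases to [c], the kernel
    [poisson (c / s)] concentrates at [t = 0]. *)
Lemma poisson_upper (c e : R) : 0 < c < 1 -> 0 < e ->
  (forall s t, 0 < s < 1 -> U s t <= 1) -> (forall s t, 0 < s < 1 -> -1 <= U s t) ->
  exists s0, c < s0 < 1 /\ forall s, c < s < s0 ->
    RInt (fun t => poisson (c / s) t * (1 - U s t)) 0 (2 * PI) <= 2 * PI * (1 - U c 0 + 2 * e).
Proof.
  intros Hc He Hub Hlb. pose proof PI_RGT_0 as Hpi.
  destruct (locally_upper_bound c e ltac:(lra) He) as (d0 & Hd0 & HdU).
  set (d := Rmin d0 1). assert (Hd : 0 < d <= d0).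
  { split; [apply Rmin_glb_lt; lra|apply Rmin_l]. }
  assert (Hd1 : d <= 1) by apply Rmin_r.
  assert (H3 : 3 < 2 * PI) by (pose proof PI2_3_2; lra).
  set (k := 1 - cos d). assert (Hk : 0 < k).
  { assert (H : cos d < cos 0) by (apply cos_decreasing_1; lra).
    rewrite cos_0 in H. unfold k. lra. }
  (* Near 0, and near [2 * PI] by periodicity, continuity gives the bound; elsewhere
     [1 - cos t >= k], so the last term absorbs the trivial bound [1 - U s t <= 2]. *)
  assert (Hw : forall s t, c < s < 1 -> s - c < d0 -> 0 < t < 2 * PI ->
            1 - U s t <= 1 - U c 0 + e + 2 / k * (1 - cos t)).
  { intros s t Hs Hsd Ht.
    assert (Hsd' : Rabs (s - c) < d0) by (rewrite Rabs_pos_eq; lra).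
    assert (Hcos : 0 <= 2 / k * (1 - cos t)).
    { apply Rmult_le_pos; [left; apply Rdiv_lt_0_compat; lra|].
      pose proof (COS_bound t). lra. }
    destruct (Rlt_dec t d) as [Ht1|Ht1].
    - assert (U c 0 - e < U s t) by (apply HdU; [exact Hsd'|rewrite Rabs_pos_eq; lra]). lra.
    - destruct (Rlt_dec (2 * PI - d) t) as [Ht2|Ht2].
      + assert (U c 0 - e < U s (t - 2 * PI)).
        { apply HdU; [exact Hsd'|]. rewrite Rabs_left; lra. }
        rewrite <- (ph_U_per _ _ _ _ _ HU s (t - 2 * PI)) in H.
        replace (t - 2 * PI + 2 * PI) with t in H by ring. lra.
      + assert (cos t <= cos d).
        { destruct (Rle_dec t PI) as [HtP|HtP].
          - apply cos_decr_1; lra.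
          - replace (cos t) with (cos (2 * PI - t)); [apply cos_decr_1; lra|].
            rewrite cos_minus, cos_2PI, sin_2PI. ring. }
        assert (H2 : 2 <= 2 / k * (1 - cos t)).
        { replace 2 with (2 / k * k) at 1 by (field; lra).
          apply Rmult_le_compat_l; [left; apply Rdiv_lt_0_compat; lra|unfold k; lra]. }
        specialize (Hlb s t ltac:(lra)). specialize (Hub c 0 Hc). lra. }
  (* The third bound yields [1 - c / s <= e k / 4], which makes the contribution of [1 - cos t] at
     most [e]; the fourth keeps [c / s] above [1 / 2]. *)
  set (m := Rmin (Rmin d0 (1 - c)) (Rmin (c * (e * k / 4)) c)).
  assert (Hek : 0 < e * k / 4) by nra.
  assert (Hm : 0 < m) by (repeat apply Rmin_glb_lt; nra).
  assert (Hm1 : m <= d0) by (eapply Rle_trans; apply Rmin_l).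
  assert (Hm2 : m <= 1 - c) by (eapply Rle_trans; [apply Rmin_l|apply Rmin_r]).
  assert (Hm3 : m <= c * (e * k / 4)) by (eapply Rle_trans; [apply Rmin_r|apply Rmin_l]).
  assert (Hm4 : m <= c) by (eapply Rle_trans; [apply Rmin_r|apply Rmin_r]).
  exists (c + m / 2). split; [lra|]. intros s Hs.
  assert (Hr : / 2 < c / s < 1).
  { split; [apply Rlt_div_r; lra|apply Rlt_div_l; lra]. }
  set (r := c / s) in *.
  assert (Hrk : (1 - r ^ 2) / (2 * r) * (2 / k) <= e).
  { assert (H1r : 1 - r <= e * k / 4).
    { apply Rmult_le_reg_r with s; [lra|].
      replace ((1 - r) * s) with (s - c) by (unfold r; field; lra). nra. }
    assert ((1 - r ^ 2) / (2 * r) <= 2 * (1 - r)) by (apply Rle_div_l; nra).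
    apply Rle_trans with (2 * (1 - r) * (2 / k)).
    - apply Rmult_le_compat_r; [left; apply Rdiv_lt_0_compat; lra|assumption].
    - apply Rmult_le_reg_r with k; [exact Hk|].
      replace (2 * (1 - r) * (2 / k) * k) with (4 * (1 - r)) by (field; lra). lra. }
  set (A := 1 - U c 0 + e).
  assert (cp : forall t, continuous (poisson r) t) by (intros; apply poisson_continuous; lra).
  apply Rle_trans with (RInt (fun t => A * poisson r t + e * 1) 0 (2 * PI)).
  - apply RInt_le; [lra| | |].
    + apply ex_RInt_cont. intros t. pose proof (Ucont s t ltac:(lra)).
      solve_continuous; [apply cp|assumption].
    + apply ex_RInt_cont. intros t. solve_continuous. apply cp.
    + intros t Ht. specialize (Hw s t ltac:(lra) ltac:(lra) Ht). fold A in Hw.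
      pose proof (poisson_pos r t ltac:(lra)) as Hp.
      apply Rle_trans with (poisson r t * (A + 2 / k * (1 - cos t))).
      * now apply Rmult_le_compat_l.
      * pose proof (poisson_one_minus_cos r t ltac:(lra)) as Hpc.
        assert (0 < 2 / k) by (apply Rdiv_lt_0_compat; lra).
        assert (poisson r t * (1 - cos t) * (2 / k) <= e)
          by (apply Rle_trans with (2 := Hrk); apply Rmult_le_compat_r; lra).
        lra.
  - rewrite RInt_lin by (auto; intros; apply continuous_const).
    rewrite poisson_mean, RInt_constR by lra. unfold A. lra.
Qed.

(** [poisson_bathtub] is applied to [1 - U] at radius [S], [poisson_dilation] carries the integral
    to radii close to [c], where [poisson_upper] evaluates it; [S] tends to 1 last. *)
Lemma schwarz_bound (c : R) : 0 < c < 1 ->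
  (forall s t, 0 < s < 1 -> -1 <= U s t <= 1) -> (forall t, U 0 t = 0) ->
  (1 - c ^ 2) / PI <= 1 - U c 0.
Proof.
  intros Hc Hb H0. pose proof PI_RGT_0 as Hpi.
  assert (Hmean : forall s, 0 < s < 1 -> RInt (fun t => 1 - U s t) 0 (2 * PI) = 2 * PI).
  { intros s Hs.
    rewrite (RInt_extR _ (fun t => 1 * 1 + - (1) * U s t)) by (intros; ring).
    rewrite RInt_lin by (intros; (apply continuous_const || (apply Ucont; lra))).
    rewrite (mean_const _ _ _ _ _ HU s Hs).
    rewrite (RInt_extR (U 0) (fun _ => 0)) by (intros; apply H0).
    rewrite !RInt_constR. simpl. ring. }
  assert (Hlow : forall S, c < S < 1 -> 2 * (1 - (c / S) ^ 2) <= 2 * PI * (1 - U c 0)).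
  { intros S HS.
    assert (Hr : forall s, c < s < 1 -> 0 < c / s < 1).
    { intros s Hs. split; [apply Rdiv_lt_0_compat; lra|apply Rlt_div_l; lra]. }
    apply Rle_trans with (RInt (fun t => poisson (c / S) t * (1 - U S t)) 0 (2 * PI)).
    - apply (poisson_bathtub (fun t => 1 - U S t)); [now apply Hr| | |].
      + intros t. pose proof (Ucont S t ltac:(lra)). solve_continuous. assumption.
      + intros t. specialize (Hb S t ltac:(lra)). lra.
      + apply Hmean. lra.
    - assert (Heq : forall s, c < s <= S ->
        RInt (fun t => poisson (c / S) t * (1 - U S t)) 0 (2 * PI)
        = RInt (fun t => poisson (c / s) t * (1 - U s t)) 0 (2 * PI)).
      { assert (Hsplit : forall s, c < s < 1 ->
          RInt (fun t => poisson (c / s) t * (1 - U s t)) 0 (2 * PI)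
          = 2 * PI - RInt (fun t => poisson (c / s) t * U s t) 0 (2 * PI)).
        { intros s Hs. specialize (Hr s Hs).
          rewrite (RInt_extR _ (fun t => 1 * poisson (c / s) t + - (1) * (poisson (c / s) t * U s t)))
            by (intros; ring).
          assert (cp : forall t, continuous (poisson (c / s)) t)
            by (intros; apply poisson_continuous; lra).
          rewrite RInt_lin.
          - rewrite poisson_mean by lra. simpl. ring.
          - exact cp.
          - intros t. pose proof (Ucont s t ltac:(lra)). solve_continuous; [apply cp|assumption]. }
        intros s Hs. rewrite !Hsplit by lra.
        rewrite (poisson_dilation _ _ _ _ _ HU c s S) by lra. reflexivity. }
      apply le_epsilon. intros e He.
      destruct (poisson_upper c (e / (4 * PI)) Hc) as (s0 & Hs0 & Hs0b).
      + apply Rdiv_lt_0_compat; lra.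
      + intros; now apply Hb.
      + intros; now apply Hb.
      + set (s := (c + Rmin s0 S) / 2).
        assert (c < Rmin s0 S) by (apply Rmin_glb_lt; lra).
        pose proof (Rmin_l s0 S). pose proof (Rmin_r s0 S).
        rewrite (Heq s) by (unfold s; lra).
        apply Rle_trans with (1 := Hs0b s ltac:(unfold s; lra)).
        right. field. lra. }
  set (K := PI * (1 - U c 0)).
  assert (HK : 0 <= K) by (specialize (Hb c 0 Hc); apply Rmult_le_pos; lra).
  assert (HL : 1 - c ^ 2 <= K).
  { apply filterlim_at_left_le with (fun s => 1 - c ^ 2 * / s ^ 2) (fun _ => K).
    (* For [s <= c] the left side is nonpositive, so the comparison extends to all of [(0, 1)]. *)
    - intros s Hs. destruct (Rlt_dec c s) as [H|H].
      + specialize (Hlow s ltac:(lra)). fold K in Hlow.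
        replace (c ^ 2 * / s ^ 2) with ((c / s) ^ 2) by (field; lra). unfold K. lra.
      + assert (1 <= c ^ 2 * / s ^ 2); [|lra].
        apply Rmult_le_reg_r with (s ^ 2); [nra|].
        rewrite Rmult_assoc, Rinv_l by (apply pow_nonzero; lra). nra.
    - evar_last.
      + apply (continuous_at_left (fun s => 1 - c ^ 2 * / s ^ 2)).
        solve_continuous. simpl. lra.
      + f_equal. field.
    - apply filterlim_const. }
  apply Rle_div_l; [lra|]. unfold K in HL. lra.
Qed.

(** By the mean value theorem [1 - U c 0] is at most [(L + e) (1 - c)] for [c] near 1, while
    [schwarz_bound] makes it at least [(1 - c) (1 + c) / PI]. Divide by [1 - c] and let [c] tend to
    1. *)
Lemma schwarz_boundary_derivative (L : R) :
  (forall s t, 0 < s < 1 -> -1 <= U s t <= 1) -> (forall t, U 0 t = 0) ->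
  filterlim (fun s => U s 0) (at_left 1) (locally 1) ->
  filterlim (fun s => Ur s 0) (at_left 1) (locally L) ->
  2 / PI <= L.
Proof.
  intros Hb H0 HU1 HL. pose proof PI_RGT_0 as Hpi. apply le_epsilon. intros e He.
  assert (Hloc : at_left 1 (fun s => Ur s 0 < L + e)).
  { refine (HL (fun z => z < L + e) _). apply (open_lt (L + e)). simpl. lra. }
  destruct Hloc as [d Hd].
  assert (HM : forall c S, 0 < c < S -> 1 - d < c -> S < 1 -> U S 0 <= U c 0 + (L + e) * (S - c)).
  { intros c S Hc Hdc HS.
    destruct (MVT_gen (fun s => U s 0) c S (fun s => Ur s 0)) as (z & Hz & E).
    - intros x Hx. rewrite Rmin_left, Rmax_right in Hx by lra.
      apply (ph_U_s _ _ _ _ _ HU). lra.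
    - intros x Hx. rewrite Rmin_left, Rmax_right in Hx by lra.
      apply continuity_pt_filterlim.
      apply (is_derive_continuous (fun s => U s 0) x (Ur x 0)).
      apply (ph_U_s _ _ _ _ _ HU). lra.
    - rewrite Rmin_left, Rmax_right in Hz by lra.
      assert (Ur z 0 < L + e).
      { apply Hd; [|lra]. change (Rabs (z - 1) < d). apply Rabs_def1; lra. }
      assert (Ur z 0 * (S - c) <= (L + e) * (S - c)) by (apply Rmult_le_compat_r; lra). lra. }
  assert (HC : forall c, 0 < c < 1 -> 1 - d < c -> 1 + c <= (L + e) * PI).
  { intros c Hc Hdc.
    assert (H1 : 1 <= U c 0 + (L + e) * (1 - c)).
    { apply (filterlim_le (F := at_left 1) (fun s => U s 0)
               (fun s => U c 0 + (L + e) * (s - c)) (Finite 1)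
               (Finite (U c 0 + (L + e) * (1 - c)))).
      - generalize (at_left_1_interval c (proj2 Hc)). apply filter_imp. intros s Hs.
        apply HM; lra.
      - exact HU1.
      - apply (continuous_at_left (fun s => U c 0 + (L + e) * (s - c))). solve_continuous. }
    pose proof (schwarz_bound c Hc Hb H0) as HS.
    apply (Rle_div_l (1 - c ^ 2) (1 - U c 0) PI) in HS; [|lra].
    apply Rmult_le_reg_r with (1 - c); [lra|].
    assert (PI * (1 - U c 0) <= PI * ((L + e) * (1 - c))) by (apply Rmult_le_compat_l; lra).
    lra. }
  apply Rle_div_l; [lra|]. apply le_epsilon. intros e2 He2.
  set (c := Rmax (/ 2) (Rmax (1 - d / 2) (1 - e2))).
  pose proof (cond_pos d) as Hdp.
  assert (/ 2 <= c) by apply Rmax_l.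
  assert (1 - d / 2 <= c) by (eapply Rle_trans; [|apply Rmax_r]; apply Rmax_l).
  assert (1 - e2 <= c) by (eapply Rle_trans; [|apply Rmax_r]; apply Rmax_r).
  assert (c < 1) by (unfold c; repeat apply Rmax_lub_lt; lra).
  specialize (HC c ltac:(lra) ltac:(lra)). lra.
Qed.

End Schwarz.

(** * Functions of two real variables on the disk *)

Lemma disk_sqr (x y : R) : disk (x, y) <-> x ^ 2 + y ^ 2 < 1.
Proof.
  unfold disk, Cmod. simpl fst; simpl snd.
  assert (H0 : 0 <= x ^ 2 + y ^ 2) by (pose proof (pow2_ge_0 x); pose proof (pow2_ge_0 y); lra).
  split; intros H.
  - apply sqrt_lt_0_alt. now rewrite sqrt_1.
  - rewrite <- sqrt_1. now apply sqrt_lt_1_alt.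
Qed.

Lemma disk_polar (s t : R) : -1 < s < 1 -> disk (s * cos t, s * sin t).
Proof.
  intros Hs. apply disk_sqr. pose proof (sin2_cos2 t) as H. unfold Rsqr in H.
  replace ((s * cos t) ^ 2 + (s * sin t) ^ 2)
    with (s ^ 2 * (sin t * sin t + cos t * cos t)) by ring.
  rewrite H. nra.
Qed.

Lemma locally_disk (x y : R) : disk (x, y) -> locally (x, y) disk.
Proof.
  intros H. apply disk_sqr in H.
  assert (Hc : continuous (fun p : R * R => fst p * fst p + snd p * snd p) (x, y)).
  { solve_continuous; (apply continuous_fst || apply continuous_snd). }
  assert (Hl : locally (x, y) (fun p : R * R => fst p * fst p + snd p * snd p < 1)).
  { refine (Hc (fun z => z < 1) _). apply (open_lt 1). simpl. lra. }
  revert Hl. apply filter_imp. intros [u v] Huv. apply disk_sqr. simpl in *. lra.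
Qed.

Definition C1_disk (k kx ky : R -> R -> R) : Prop :=
  forall x y, disk (x, y) ->
    is_derive (fun t => k t y) x (kx x y) /\ is_derive (fun t => k x t) y (ky x y) /\
    cont2 k x y /\ cont2 kx x y /\ cont2 ky x y.

Lemma C1_disk_chain (k kx ky : R -> R -> R) (a b : R -> R) (s da db : R) :
  C1_disk k kx ky -> disk (a s, b s) -> is_derive a s da -> is_derive b s db ->
  is_derive (fun s => k (a s) (b s)) s (da * kx (a s) (b s) + db * ky (a s) (b s)).
Proof.
  intros Hk Hd Ha Hb. destruct (Hk _ _ Hd) as (_ & Hy & _ & Hcx & _).
  assert (F : filterdiff (fun u : R * R => k (fst u) (snd u)) (locally (a s, b s))
     (fun u : R * R => plus (scal (fst u) (kx (a s) (b s))) (scal (snd u) (ky (a s) (b s))))).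
  { apply (is_derive_filterdiff k (a s) (b s) kx (ky (a s) (b s))).
    - generalize (locally_disk _ _ Hd). apply filter_imp. intros [u v] Huv.
      apply (Hk u v Huv).
    - exact Hy.
    - exact Hcx. }
  pose proof (filterdiff_comp'_2 (K := R_AbsRing) (T := R_NormedModule) (U := R_NormedModule)
    (V := R_NormedModule) (W := R_NormedModule) a b k s _ _
    (fun u v => plus (scal u (kx (a s) (b s))) (scal v (ky (a s) (b s)))) Ha Hb F) as G.
  apply filterdiff_ext_lin with (1 := G). intros y.
  unfold plus, scal; simpl; unfold mult; simpl. ring.
Qed.

Lemma cont2_polar (k : R -> R -> R) (c s t : R) :
  cont2 k (s * cos (c + t)) (s * sin (c + t)) ->
  cont2 (fun s t => k (s * cos (c + t)) (s * sin (c + t))) s t.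
Proof.
  intros H.
  apply (continuous_comp_2 (fun p : R * R => fst p * cos (c + snd p))
           (fun p : R * R => fst p * sin (c + snd p)) k (s, t)).
  - solve_continuous.
  - solve_continuous.
  - exact H.
Qed.

Ltac solve_is_derive :=
  lazymatch goal with
  | |- is_derive (fun x => @?f x + @?g x) _ _ => apply (is_derive_plusR f g); solve_is_derive
  | |- is_derive (fun x => @?f x * @?g x) _ _ => apply (is_derive_multR f g); solve_is_derive
  | |- _ => idtac
  end.

Ltac polar_leaf D1 Dc Ds H :=
  lazymatch goal with
  | |- is_derive (fun _ => ?k) _ _ => apply D1
  | |- is_derive (fun t => cos _) _ _ => apply Dc
  | |- is_derive (fun t => sin _) _ _ => apply Ds
  | |- _ => eapply H; eassumption
  end.

(** The rotation by [c] puts the chosen boundary point at [t = 0]. [Ur] and [Ut] are derivatives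
    along the radial and tangential unit vectors, [Y] and [X] the radial-radial and
    radial-tangential entries of the Hessian. Harmonicity enters in the angular derivative of [Ut].
    The form [- (1) * _] leaves only sums and products for the tactics. *)
Lemma polar_harmonic_of_C1_disk (g gx gy gxx gxy gyy : R -> R -> R) (c : R) :
  C1_disk g gx gy -> C1_disk gx gxx gxy -> C1_disk gy gxy gyy ->
  (forall x y, disk (x, y) -> gxx x y + gyy x y = 0) ->
  let P (k : R -> R -> R) := fun s t => k (s * cos (c + t)) (s * sin (c + t)) in
  polar_harmonic (P g)
    (fun s t => P gx s t * cos (c + t) + P gy s t * sin (c + t))
    (fun s t => - (1) * P gx s t * sin (c + t) + P gy s t * cos (c + t))
    (fun s t => - (1) * P gxx s t * (cos (c + t) * sin (c + t))
       + P gxy s t * (cos (c + t) * cos (c + t) + - (1) * (sin (c + t) * sin (c + t)))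
       + P gyy s t * (cos (c + t) * sin (c + t)))
    (fun s t => P gxx s t * (cos (c + t) * cos (c + t))
       + 2 * P gxy s t * (cos (c + t) * sin (c + t)) + P gyy s t * (sin (c + t) * sin (c + t))).
Proof.
  intros Hg Hgx Hgy Hlap P.
  assert (Hs : forall k kx ky, C1_disk k kx ky -> forall s t, -1 < s < 1 ->
    is_derive (fun s => P k s t) s (P kx s t * cos (c + t) + P ky s t * sin (c + t))).
  { intros k kx ky Hk s t Hst. evar_last.
    - apply (C1_disk_chain k kx ky (fun s => s * cos (c + t)) (fun s => s * sin (c + t)) s
               (cos (c + t)) (sin (c + t)) Hk (disk_polar s (c + t) Hst));
        (auto_derive; [trivial|ring]).
    - unfold P. ring. }
  assert (Ht : forall k kx ky, C1_disk k kx ky -> forall s t, -1 < s < 1 ->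
    is_derive (P k s) t (s * (- (1) * P kx s t * sin (c + t) + P ky s t * cos (c + t)))).
  { intros k kx ky Hk s t Hst. evar_last.
    - apply (C1_disk_chain k kx ky (fun t => s * cos (c + t)) (fun t => s * sin (c + t)) t
               (- s * sin (c + t)) (s * cos (c + t)) Hk (disk_polar s (c + t) Hst));
        (auto_derive; [trivial|ring]).
    - unfold P. ring. }
  assert (Hc : forall k, (forall x y, disk (x, y) -> cont2 k x y) ->
            forall s t, -1 < s < 1 -> cont2 (P k) s t).
  { intros k Hk s t Hst. apply cont2_polar, Hk. now apply disk_polar. }
  assert (Dc : forall t, is_derive (fun t => cos (c + t)) t (- sin (c + t)))
    by (intros; auto_derive; [trivial|ring]).
  assert (Ds : forall t, is_derive (fun t => sin (c + t)) t (cos (c + t)))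
    by (intros; auto_derive; [trivial|ring]).
  assert (D1 : forall k t, is_derive (fun _ : R => k) t 0)
    by (intros; apply (is_derive_const (V := R_NormedModule))).
  assert (Cg : forall s t, -1 < s < 1 -> cont2 (P g) s t)
    by (apply Hc; intros x y H; apply (Hg x y H)).
  assert (Cx : forall s t, -1 < s < 1 -> cont2 (P gx) s t)
    by (apply Hc; intros x y H; apply (Hgx x y H)).
  assert (Cy : forall s t, -1 < s < 1 -> cont2 (P gy) s t)
    by (apply Hc; intros x y H; apply (Hgy x y H)).
  assert (Cxx : forall s t, -1 < s < 1 -> cont2 (P gxx) s t)
    by (apply Hc; intros x y H; apply (Hgx x y H)).
  assert (Cxy : forall s t, -1 < s < 1 -> cont2 (P gxy) s t)
    by (apply Hc; intros x y H; apply (Hgx x y H)).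
  assert (Cyy : forall s t, -1 < s < 1 -> cont2 (P gyy) s t)
    by (apply Hc; intros x y H; apply (Hgy x y H)).
  assert (Ck : forall k s t, cont2 (fun _ _ : R => k) s t)
    by (intros; apply (cont2_fst (fun _ => k)), continuous_const).
  assert (Cc : forall s t, cont2 (fun _ t : R => cos (c + t)) s t)
    by (intros; unfold cont2; solve_continuous).
  assert (Cs : forall s t, cont2 (fun _ t : R => sin (c + t)) s t)
    by (intros; unfold cont2; solve_continuous).
  assert (Ec : forall x, cos (x + 2 * PI) = cos x)
    by (intros; rewrite cos_plus, cos_2PI, sin_2PI; ring).
  assert (Es : forall x, sin (x + 2 * PI) = sin x)
    by (intros; rewrite sin_plus, cos_2PI, sin_2PI; ring).
  constructor.
  - now apply Hs.
  - now apply Ht.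
  - intros s t Hst. evar_last; [solve_is_derive; polar_leaf D1 Dc Ds Hs|ring].
  - intros s t Hst. evar_last; [solve_is_derive; polar_leaf D1 Dc Ds Hs|ring].
  - intros s t Hst. evar_last; [solve_is_derive; polar_leaf D1 Dc Ds Ht|ring].
  - intros s t Hst. evar_last.
    + solve_is_derive; polar_leaf D1 Dc Ds Ht.
    + pose proof (Hlap _ _ (disk_polar s (c + t) Hst)) as HL.
      pose proof (sin2_cos2 (c + t)) as S. unfold Rsqr in S.
      assert (S' : sin (c + t) * sin (c + t) = 1 - cos (c + t) * cos (c + t)) by lra.
      change (gxx (s * cos (c + t)) (s * sin (c + t))) with (P gxx s t) in HL.
      change (gyy (s * cos (c + t)) (s * sin (c + t))) with (P gyy s t) in HL.
      replace (P gyy s t) with (- P gxx s t) by lra. ring_simplify. ring.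
  - exact Cg.
  - intros s t Hst. solve_cont2; auto.
  - intros s t Hst. solve_cont2; auto.
  - intros s t Hst. solve_cont2; auto.
  - intros s t Hst. solve_cont2; auto.
  - intros s t. unfold P. now rewrite <- Rplus_assoc, Ec, Es.
  - intros s. unfold P. now rewrite Rplus_0_r, Ec, Es.
  - intros s. unfold P. now rewrite Rplus_0_r, Ec, Es.
Qed.

Lemma C1_disk_schwarz (g gx gy gxx gxy gyx gyy : R -> R -> R) :
  C1_disk g gx gy -> C1_disk gx gxx gxy -> C1_disk gy gyx gyy ->
  forall x y, disk (x, y) -> gxy x y = gyx x y.
Proof.
  intros Hg Hgx Hgy x y Hd.
  assert (Hloc : forall u v, disk (u, v) -> locally u (fun z => disk (z, v)) /\
                                        locally v (fun z => disk (u, z))).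
  { intros u v Huv. destruct (locally_disk u v Huv) as [e He]. split; exists e; intros z Hz;
      apply He; split; simpl; auto; apply ball_center. }
  assert (E1 : forall u v, disk (u, v) -> Derive (fun t => g t v) u = gx u v)
    by (intros u v H; apply is_derive_unique, (Hg u v H)).
  assert (E2 : forall u v, disk (u, v) -> Derive (fun t => g u t) v = gy u v)
    by (intros u v H; apply is_derive_unique, (Hg u v H)).
  assert (D1 : forall u v, disk (u, v) ->
    is_derive (fun z => Derive (fun t => g z t) v) u (gyx u v)).
  { intros u v H. apply is_derive_ext_loc with (fun z => gy z v).
    - generalize (proj1 (Hloc u v H)). apply filter_imp. intros z Hz. symmetry. now apply E2.
    - apply (Hgy u v H). }
  assert (D2 : forall u v, disk (u, v) ->
    is_derive (fun z => Derive (fun t => g t z) u) v (gxy u v)).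
  { intros u v H. apply is_derive_ext_loc with (fun z => gx u z).
    - generalize (proj2 (Hloc u v H)). apply filter_imp. intros z Hz. symmetry. now apply E1.
    - apply (Hgx u v H). }
  assert (L2 : locally_2d (fun u v => disk (u, v)) x y).
  { apply locally_2d_locally. generalize (locally_disk x y Hd). apply filter_imp.
    now intros [u v]. }
  rewrite <- (is_derive_unique _ _ _ (D2 x y Hd)), <- (is_derive_unique _ _ _ (D1 x y Hd)).
  symmetry. apply (Schwarz g x y).
  - revert L2. apply locally_2d_impl, locally_2d_forall. intros u v H.
    repeat split; eexists.
    + apply (Hg u v H).
    + apply (Hg u v H).
    + apply (D1 u v H).
    + apply (D2 u v H).
  - apply continuity_2d_pt_ext_loc with gyx.
    + revert L2. apply locally_2d_impl, locally_2d_forall. intros u v H.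
      symmetry. apply is_derive_unique, (D1 u v H).
    + apply continuity_2d_pt_filterlim. apply (Hgy x y Hd).
  - apply continuity_2d_pt_ext_loc with gxy.
    + revert L2. apply locally_2d_impl, locally_2d_forall. intros u v H.
      symmetry. apply is_derive_unique, (D2 u v H).
    + apply continuity_2d_pt_filterlim. apply (Hgx x y Hd).
Qed.

(** * Complex-valued functions on the closed disk *)

Lemma norm_Cmod (z : C) : norm (K := R_AbsRing) (V := C_R_NormedModule) z = Cmod z.
Proof.
  destruct z as [x y]. unfold norm; simpl. unfold prod_norm, Cmod; simpl.
  f_equal. unfold norm; simpl. unfold abs; simpl.
  pose proof (pow2_abs x). pose proof (pow2_abs y). simpl in *. lra.
Qed.

Lemma is_linear_Cmult (c : C) :
  is_linear (K := R_AbsRing) (U := C_R_NormedModule) (V := C_R_NormedModule) (fun z : C => c * z)%C.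
Proof.
  constructor.
  - intros x y. apply injective_projections; simpl; unfold plus; simpl; ring.
  - intros k x. apply injective_projections; simpl; unfold scal; simpl; unfold mult; simpl; ring.
  - exists (Cmod c + 1). pose proof (Cmod_ge_0 c). split; [lra|].
    intros x. rewrite !norm_Cmod, Cmod_mult. pose proof (Cmod_ge_0 x).
    apply Rmult_le_compat_r; lra.
Qed.

(** Real functionals on [C]: [w = 1] and [w = - Ci] extract the coordinates, and the conjugate of a
    boundary value of [f] gives the real function studied at that point. *)
Lemma is_linear_Re_Cmult (w : C) :
  is_linear (K := R_AbsRing) (U := C_R_NormedModule) (V := R_NormedModule) (fun z : C => Re (w * z)%C).
Proof.
  apply (is_linear_comp (K := R_AbsRing) (U := C_R_NormedModule) (V := C_R_NormedModule)
           (fun z : C => w * z)%C (fun z : C => Re z)).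
  - apply is_linear_Cmult.
  - apply (is_linear_fst (K := R_AbsRing) (U := R_NormedModule) (V := R_NormedModule)).
Qed.

Lemma is_derive_linear {V W : NormedModule R_AbsRing} (l : V -> W) (h : R -> V) (x : R) (d : V) :
  is_linear l -> is_derive h x d -> is_derive (fun t => l (h t)) x (l d).
Proof.
  intros Hl Hh.
  pose proof (filterdiff_comp' h l x _ l Hh (filterdiff_linear l Hl)) as G.
  apply filterdiff_ext_lin with (1 := G). intros y. apply (linear_scal l Hl).
Qed.

Definition has_dx (h hx : C -> C) : Prop := forall x y, disk (x, y) ->
  is_derive (V := C_R_NormedModule) (fun t : R => h (t, y)) x (hx (x, y)).
Definition has_dy (h hy : C -> C) : Prop := forall x y, disk (x, y) ->
  is_derive (V := C_R_NormedModule) (fun t : R => h (x, t)) y (hy (x, y)).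

Lemma Re_one (z : C) : Re (RtoC 1 * z)%C = Re z.
Proof. destruct z; simpl; ring. Qed.

Lemma Re_minus_Ci (z : C) : Re (- Ci * z)%C = Im z.
Proof. destruct z; simpl; ring. Qed.

Lemma pdx_has_dx (h hx : C -> C) (z : C) : has_dx h hx -> disk z -> pdx h z = hx z.
Proof.
  intros H Hz. destruct z as [x y]. specialize (H x y Hz).
  apply injective_projections; apply is_derive_unique.
  - pose proof (is_derive_linear _ _ _ _ (is_linear_Re_Cmult (RtoC 1)) H) as G. cbv beta in G.
    rewrite Re_one in G. apply is_derive_ext with (2 := G). intros t. apply Re_one.
  - pose proof (is_derive_linear _ _ _ _ (is_linear_Re_Cmult (- Ci)%C) H) as G. cbv beta in G.
    rewrite Re_minus_Ci in G. apply is_derive_ext with (2 := G). intros t. apply Re_minus_Ci.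
Qed.

Lemma pdy_has_dy (h hy : C -> C) (z : C) : has_dy h hy -> disk z -> pdy h z = hy z.
Proof.
  intros H Hz. destruct z as [x y]. specialize (H x y Hz).
  apply injective_projections; apply is_derive_unique.
  - pose proof (is_derive_linear _ _ _ _ (is_linear_Re_Cmult (RtoC 1)) H) as G. cbv beta in G.
    rewrite Re_one in G. apply is_derive_ext with (2 := G). intros t. apply Re_one.
  - pose proof (is_derive_linear _ _ _ _ (is_linear_Re_Cmult (- Ci)%C) H) as G. cbv beta in G.
    rewrite Re_minus_Ci in G. apply is_derive_ext with (2 := G). intros t. apply Re_minus_Ci.
Qed.

Lemma locally_disk_lines (x y : R) : disk (x, y) ->
  locally x (fun t => disk (t, y)) /\ locally y (fun t => disk (x, t)).
Proof.
  intros H. destruct (locally_disk x y H) as [e He].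
  split; exists e; intros t Ht; apply He; split; simpl; auto; apply ball_center.
Qed.

Lemma has_dx_lin (h hx k kx m : C -> C) (c d : C) :
  has_dx h hx -> has_dx k kx ->
  (forall z, disk z -> m z = c * h z + d * k z)%C ->
  has_dx m (fun z => c * hx z + d * kx z)%C.
Proof.
  intros Hh Hk E x y Hd.
  apply is_derive_ext_loc with (fun t => c * h (t, y) + d * k (t, y))%C.
  - generalize (proj1 (locally_disk_lines x y Hd)). apply filter_imp. intros t Ht.
    symmetry. now apply E.
  - apply (is_derive_plus (V := C_R_NormedModule)
             (fun t => c * h (t, y))%C (fun t => d * k (t, y))%C).
    + apply (is_derive_linear _ _ _ _ (is_linear_Cmult c) (Hh x y Hd)).
    + apply (is_derive_linear _ _ _ _ (is_linear_Cmult d) (Hk x y Hd)).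
Qed.

Lemma has_dy_lin (h hy k ky m : C -> C) (c d : C) :
  has_dy h hy -> has_dy k ky ->
  (forall z, disk z -> m z = c * h z + d * k z)%C ->
  has_dy m (fun z => c * hy z + d * ky z)%C.
Proof.
  intros Hh Hk E x y Hd.
  apply is_derive_ext_loc with (fun t => c * h (x, t) + d * k (x, t))%C.
  - generalize (proj2 (locally_disk_lines x y Hd)). apply filter_imp. intros t Ht.
    symmetry. now apply E.
  - apply (is_derive_plus (V := C_R_NormedModule)
             (fun t => c * h (x, t))%C (fun t => d * k (x, t))%C).
    + apply (is_derive_linear _ _ _ _ (is_linear_Cmult c) (Hh x y Hd)).
    + apply (is_derive_linear _ _ _ _ (is_linear_Cmult d) (Hk x y Hd)).
Qed.

Definition closed_disk_cont (h : C -> C) : Prop := forall z, closed_disk z ->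
  filterlim h (within closed_disk (locally z)) (locally (h z)).

Lemma continuous_Re_Cmult (w z : C) :
  filterlim (fun z : C => Re (w * z)%C) (locally z) (locally (Re (w * z)%C)).
Proof.
  apply (linear_cont (K := R_AbsRing) (U := C_R_NormedModule) (V := R_NormedModule)
           (fun z : C => Re (w * z)%C) z (is_linear_Re_Cmult w)).
Qed.

Lemma closed_disk_cont_cont2 (h : C -> C) (w : C) (x y : R) :
  closed_disk_cont h -> disk (x, y) -> cont2 (fun x y => Re (w * h (x, y))%C) x y.
Proof.
  intros Hh Hd.
  assert (Hc : filterlim h (locally (x, y)) (locally (h (x, y)))).
  { intros P HP. pose proof (Hh (x, y) (Rlt_le _ _ Hd) P HP) as H.
    assert (HL := locally_disk x y Hd).
    unfold filtermap, within in H. unfold filtermap.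
    generalize (filter_and _ _ H HL). apply filter_imp.
    intros z [Hz1 Hz2]. apply Hz1. now apply Rlt_le. }
  intros P HP.
  assert (H : locally (x, y) (fun z : C => P (Re (w * h z)%C))).
  { apply (Hc (fun z => P (Re (w * z)%C))). now apply (continuous_Re_Cmult w (h (x, y))). }
  unfold filtermap. revert H. apply filter_imp. now intros [u v].
Qed.

Lemma filterlim_pair_C (a b : R -> R) (x : R) : continuous a x -> continuous b x ->
  filterlim (fun s => (a s, b s) : C) (locally x) (locally ((a x, b x) : C)).
Proof.
  intros Ha Hb P [e He]. unfold filtermap.
  pose proof (Ha _ (locally_ball (a x) e)) as H1. pose proof (Hb _ (locally_ball (b x) e)) as H2.
  unfold filtermap in H1, H2. generalize (filter_and _ _ H1 H2).
  apply filter_imp. intros s [H3 H4]. apply He. now split.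
Qed.

Lemma radial_lim (h : C -> C) (w : C) (theta : R) : closed_disk_cont h ->
  filterlim (fun s => Re (w * h (s * cos theta, s * sin theta)%R)%C) (at_left 1)
    (locally (Re (w * h (circ theta))%C)).
Proof.
  intros Hh.
  assert (Hcirc : circ theta = (1 * cos theta, 1 * sin theta)) by (unfold circ; now rewrite !Rmult_1_l).
  assert (Hcl : closed_disk (circ theta)).
  { unfold closed_disk. replace (circ theta) with (RtoC 1 * circ theta)%C by ring.
    rewrite Cmod_circ; lra. }
  assert (Hpath : filterlim (fun s : R => (s * cos theta, s * sin theta) : C) (at_left 1)
            (within closed_disk (locally (circ theta)))).
  { intros P HP. unfold within in HP.
    assert (H1 : filterlim (fun s : R => (s * cos theta, s * sin theta) : C) (at_left 1)
              (locally (circ theta))).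
    { rewrite Hcirc. apply (filterlim_filter_le_1 (F := locally 1) (G := at_left 1));
        [apply filter_le_within|].
      apply (filterlim_pair_C (fun s : R => s * cos theta) (fun s : R => s * sin theta) 1);
        solve_continuous. }
    pose proof (H1 _ HP) as H2. unfold filtermap in H2. unfold filtermap.
    generalize (filter_and _ _ H2 (at_left_1_interval 0 Rlt_0_1)). apply filter_imp. intros s [Hs1 Hs2]. apply Hs1.
    apply Rlt_le. apply disk_polar. lra. }
  apply (filterlim_comp _ _ _ _ (fun z : C => Re (w * h z)%C) _ _ _ Hpath).
  apply (filterlim_comp _ _ _ h (fun z : C => Re (w * z)%C) _ _ _ (Hh _ Hcl)). apply continuous_Re_Cmult.
Qed.

Lemma C1_disk_Re (w : C) (h hx hy : C -> C) :
  has_dx h hx -> has_dy h hy ->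
  closed_disk_cont h -> closed_disk_cont hx -> closed_disk_cont hy ->
  C1_disk (fun x y => Re (w * h (x, y))%C) (fun x y => Re (w * hx (x, y))%C)
    (fun x y => Re (w * hy (x, y))%C).
Proof.
  intros Hx Hy C0 C1 C2 x y Hd. split; [|split; [|split; [|split]]].
  - apply (is_derive_linear _ _ _ _ (is_linear_Re_Cmult w) (Hx x y Hd)).
  - apply (is_derive_linear _ _ _ _ (is_linear_Re_Cmult w) (Hy x y Hd)).
  - now apply closed_disk_cont_cont2.
  - now apply closed_disk_cont_cont2.
  - now apply closed_disk_cont_cont2.
Qed.

(** Boundary points adhere to the open disk, so limits from inside are unique and the [iota] in
    [disk_lim] returns them. *)
Lemma proper_within_disk (z : C) : unit_circle z -> ProperFilter' (within disk (locally z)).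
Proof.
  intros Hz. constructor; [|apply within_filter, locally_filter].
  intros [e He]. destruct z as [x y].
  (* The point [s z] lies within [e / 2] of [z] in each coordinate, and [1 / 2 <= s < 1] puts it
     inside the disk. *)
  set (s := 1 - Rmin (/ 2) (e / 2)).
  assert (0 < Rmin (/ 2) (e / 2)).
  { pose proof (cond_pos e). apply Rmin_glb_lt; lra. }
  pose proof (Rmin_l (/ 2) (e / 2)). pose proof (Rmin_r (/ 2) (e / 2)).
  unfold unit_circle, Cmod in Hz. simpl fst in Hz. simpl snd in Hz.
  assert (Hxy : x ^ 2 + y ^ 2 = 1).
  { rewrite <- (sqrt_sqrt (x ^ 2 + y ^ 2)); [rewrite Hz; ring|].
    pose proof (pow2_ge_0 x). pose proof (pow2_ge_0 y). lra. }
  pose proof (cond_pos e).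
  assert (Hb : forall u, u ^ 2 <= 1 -> Rabs (s * u - u) < e).
  { intros u Hu. replace (s * u - u) with (- (1 - s) * u) by ring.
    rewrite Rabs_mult, Rabs_Ropp, (Rabs_pos_eq (1 - s)) by (unfold s; lra).
    rewrite <- pow2_abs in Hu.
    assert (Rabs u <= 1) by (pose proof (Rabs_pos u); nra).
    assert ((1 - s) * Rabs u <= (1 - s) * 1) by (apply Rmult_le_compat_l; unfold s; lra).
    unfold s in *. lra. }
  apply (He (s * x, s * y)).
  - pose proof (pow2_ge_0 x). pose proof (pow2_ge_0 y).
    split; [apply (Hb x)|apply (Hb y)]; lra.
  - apply disk_sqr. replace ((s * x) ^ 2 + (s * y) ^ 2) with (s ^ 2 * (x ^ 2 + y ^ 2)) by ring.
    rewrite Hxy. unfold s. nra.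
Qed.

Lemma disk_lim_boundary (g h k : C -> C) (c d z : C) : unit_circle z ->
  closed_disk_cont h -> closed_disk_cont k ->
  (forall z, disk z -> g z = c * h z + d * k z)%C ->
  disk_lim g z = (c * h z + d * k z)%C.
Proof.
  intros Hz Hh Hk E.
  pose proof (proper_within_disk z Hz) as PF.
  assert (Hcl : closed_disk z) by (unfold closed_disk; rewrite Hz; lra).
  assert (Hsub : filter_le (within disk (locally z)) (within closed_disk (locally z))).
  { intros P. unfold within. apply filter_imp. intros u Hu Hd. apply Hu. now apply Rlt_le. }
  assert (Hlin : forall (c : C) (h : C -> C), closed_disk_cont h ->
     filterlim (fun z => c * h z)%C (within disk (locally z)) (locally (c * h z)%C)).
  { intros c0 h0 H0. apply (filterlim_filter_le_1 _ Hsub).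
    apply (filterlim_comp _ _ _ h0 (fun z : C => c0 * z)%C _ _ _ (H0 z Hcl)).
    apply (linear_cont (K := R_AbsRing) (U := C_R_NormedModule) (V := C_R_NormedModule)
             (fun z : C => c0 * z)%C (h0 z) (is_linear_Cmult c0)). }
  assert (Hlim : filterlim g (within disk (locally z)) (locally (c * h z + d * k z)%C)).
  { apply filterlim_within_ext with (fun z => c * h z + d * k z)%C.
    - intros u Hu. symmetry. now apply E.
    - apply filterlim_comp_2 with (1 := Hlin c h Hh) (2 := Hlin d k Hk).
      apply (filterlim_plus (V := C_R_NormedModule)). }
  exact (iota_filterlim_locally (V := C_R_CompleteNormedModule) g _ Hlim).
Qed.

(** * The equation in Cartesian coordinates and the norm of the differential *)

Section Solution.

Variables f fx fy fxx fxy fyx fyy : C -> C.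
Hypotheses (cf : closed_disk_cont f) (cfx : closed_disk_cont fx) (cfy : closed_disk_cont fy)
  (cfxx : closed_disk_cont fxx) (cfxy : closed_disk_cont fxy)
  (cfyx : closed_disk_cont fyx) (cfyy : closed_disk_cont fyy).
Hypotheses (dxf : has_dx f fx) (dyf : has_dy f fy)
  (dxfx : has_dx fx fxx) (dyfx : has_dy fx fxy) (dxfy : has_dx fy fyx) (dyfy : has_dy fy fyy).

Lemma dz_disk (z : C) : disk z ->
  dz f z = (RtoC (1 / 2) * fx z + (RtoC (- (1 / 2)) * Ci) * fy z)%C.
Proof.
  intros Hz. unfold dz. rewrite (pdx_has_dx f fx), (pdy_has_dy f fy) by assumption.
  apply injective_projections; simpl; field.
Qed.

Lemma dzbar_disk (z : C) : disk z ->
  dzbar f z = (RtoC (1 / 2) * fx z + (RtoC (1 / 2) * Ci) * fy z)%C.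
Proof.
  intros Hz. unfold dzbar. rewrite (pdx_has_dx f fx), (pdy_has_dy f fy) by assumption.
  apply injective_projections; simpl; field.
Qed.

Lemma mixed_partials (z : C) : disk z -> fxy z = fyx z.
Proof.
  intros Hz. destruct z as [x y].
  assert (H : forall w : C, Re (w * fxy (x, y))%C = Re (w * fyx (x, y))%C).
  { intros w.
    apply (C1_disk_schwarz (fun x y => Re (w * f (x, y))%C) (fun x y => Re (w * fx (x, y))%C)
      (fun x y => Re (w * fy (x, y))%C) (fun x y => Re (w * fxx (x, y))%C)
      (fun x y => Re (w * fxy (x, y))%C) (fun x y => Re (w * fyx (x, y))%C)
      (fun x y => Re (w * fyy (x, y))%C)); auto using C1_disk_Re. }
  pose proof (H (RtoC 1)) as H1. rewrite !Re_one in H1.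
  pose proof (H (- Ci)%C) as H2. rewrite !Re_minus_Ci in H2.
  now apply injective_projections.
Qed.

Lemma Laplacian_disk (z : C) : disk z -> Laplacian f z = (fxx z + fyy z)%C.
Proof.
  intros Hz. unfold Laplacian. unfold dz at 1.
  rewrite (pdx_has_dx (dzbar f) _ z (has_dx_lin _ _ _ _ _ _ _ dxfx dxfy dzbar_disk) Hz).
  rewrite (pdy_has_dy (dzbar f) _ z (has_dy_lin _ _ _ _ _ _ _ dyfx dyfy dzbar_disk) Hz).
  rewrite (mixed_partials z Hz).
  apply injective_projections; simpl; field.
Qed.

(** Cancelling [(1 - |z|^2)^(-a-1)] leaves coefficients that extend continuously to the circle, the
    form in which a radial limit can be taken. *)
Lemma T_op_disk (a x y : R) : disk (x, y) -> T_op a f (x, y) = RtoC 0 ->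
  (RtoC (- (a ^ 2 / 4)) * f (x, y)
   + RtoC (a / 2) * (RtoC x * fx (x, y) + RtoC y * fy (x, y))
   + RtoC (1 / 4 * (1 - (x ^ 2 + y ^ 2))) * (fxx (x, y) + fyy (x, y)))%C = RtoC 0.
Proof.
  intros Hz HT. pose proof (proj1 (disk_sqr x y) Hz) as Hs.
  assert (Hm : Cmod (x, y) ^ 2 = x ^ 2 + y ^ 2).
  { unfold Cmod. simpl fst; simpl snd. rewrite pow2_sqrt; [reflexivity|].
    pose proof (pow2_ge_0 x). pose proof (pow2_ge_0 y). lra. }
  unfold T_op in HT. cbv zeta in HT. rewrite Hm in HT.
  rewrite Laplacian_disk, dz_disk, dzbar_disk in HT by assumption.
  set (rho := 1 - (x ^ 2 + y ^ 2)) in *.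
  replace (- a) with (- a - 1 + 1) in HT at 3 by ring.
  rewrite Rpower_succ in HT by (unfold rho; lra).
  pose proof (Rpower_pos rho (- a - 1)) as Hq. set (q := Rpower rho (- a - 1)) in *.
  destruct (f (x, y)) as [f1 f2], (fx (x, y)) as [u1 u2], (fy (x, y)) as [v1 v2],
    (fxx (x, y)) as [p1 p2], (fyy (x, y)) as [r1 r2].
  apply injective_projections.
  - apply (f_equal fst) in HT. simpl in HT |- *.
    apply Rmult_eq_reg_l with q; [|lra]. rewrite Rmult_0_r.
    etransitivity; [|exact HT]. field.
  - apply (f_equal snd) in HT. simpl in HT |- *.
    apply Rmult_eq_reg_l with q; [|lra]. rewrite Rmult_0_r.
    etransitivity; [|exact HT]. field.
Qed.

(** With [e = circ theta], the radial derivative is [e f_z + conj(e) f_zbar], whose modulus is at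
    most [|f_z| + |f_zbar|]. *)
Lemma norm_D_ge (w : C) (theta : R) : Cmod w = 1 ->
  Re (w * fx (circ theta))%C * cos theta + Re (w * fy (circ theta))%C * sin theta
  <= norm_D f (circ theta).
Proof.
  intros Hw.
  assert (Hc : unit_circle (circ theta)).
  { unfold unit_circle. replace (circ theta) with (RtoC 1 * circ theta)%C by ring.
    rewrite Cmod_circ; lra. }
  unfold norm_D.
  rewrite (disk_lim_boundary _ _ _ _ _ _ Hc cfx cfy dz_disk).
  rewrite (disk_lim_boundary _ _ _ _ _ _ Hc cfx cfy dzbar_disk).
  set (A := (RtoC (1 / 2) * fx (circ theta) + RtoC (- (1 / 2)) * Ci * fy (circ theta))%C).
  set (B := (RtoC (1 / 2) * fx (circ theta) + RtoC (1 / 2) * Ci * fy (circ theta))%C).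
  set (e := circ theta) in *.
  replace (Re (w * fx e)%C * cos theta + Re (w * fy e)%C * sin theta)
    with (Re (w * (e * A + Cconj e * B))%C).
  2: { unfold A, B. destruct (fx e) as [u1 u2], (fy e) as [v1 v2], w as [w1 w2].
       unfold e. simpl. field. }
  apply Rle_trans with (Cmod (w * (e * A + Cconj e * B))%C).
  - apply Rle_trans with (1 := Rle_abs _). apply Rle_trans with (2 := Rmax_Cmod _). apply Rmax_l.
  - rewrite Cmod_mult, Hw, Rmult_1_l.
    apply Rle_trans with (1 := Cmod_triangle _ _).
    rewrite !Cmod_mult, Cmod_conj, Hc. lra.
Qed.

End Solution.

(** * Boundary derivative of the solution *)

Lemma Cmod_circ_1 (t : R) : Cmod (circ t) = 1.
Proof.
  replace (circ t) with (RtoC 1 * circ t)%C by ring. apply Cmod_circ. lra.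
Qed.

Lemma Re_conj_mult_unit (z : C) : Cmod z = 1 -> Re (Cconj z * z)%C = 1.
Proof.
  intros Hz. destruct z as [x y]. unfold Cmod in Hz. simpl fst in Hz. simpl snd in Hz.
  pose proof (pow2_ge_0 x). pose proof (pow2_ge_0 y).
  assert (Hxy : x ^ 2 + y ^ 2 = 1).
  { rewrite <- (sqrt_sqrt (x ^ 2 + y ^ 2)) by lra. rewrite Hz. ring. }
  simpl in *. lra.
Qed.

Lemma Re_mult_bound (w z : C) : Cmod w = 1 -> Cmod z <= 1 -> -1 <= Re (w * z)%C <= 1.
Proof.
  intros Hw Hz. apply Rabs_le_between. apply Rle_trans with (Cmod (w * z)%C).
  - apply Rle_trans with (2 := Rmax_Cmod _). apply Rmax_l.
  - rewrite Cmod_mult, Hw. lra.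
Qed.

Section Boundary.

Variables f fx fy fxx fxy fyx fyy : C -> C.
Hypotheses (cf : closed_disk_cont f) (cfx : closed_disk_cont fx) (cfy : closed_disk_cont fy)
  (cfxx : closed_disk_cont fxx) (cfxy : closed_disk_cont fxy)
  (cfyx : closed_disk_cont fyx) (cfyy : closed_disk_cont fyy).
Hypotheses (dxf : has_dx f fx) (dyf : has_dy f fy)
  (dxfx : has_dx fx fxx) (dyfx : has_dy fx fxy) (dxfy : has_dx fy fyx) (dyfy : has_dy fy fyy).
Variable a : R.
Hypothesis Hsol : forall z, disk z -> T_op a f z = RtoC 0.

Lemma T_op_Re (w : C) (x y : R) : disk (x, y) ->
  - (a ^ 2 / 4) * Re (w * f (x, y))%C
  + a / 2 * (x * Re (w * fx (x, y))%C + y * Re (w * fy (x, y))%C)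
  + 1 / 4 * (1 - (x ^ 2 + y ^ 2)) * (Re (w * fxx (x, y))%C + Re (w * fyy (x, y))%C) = 0.
Proof.
  intros Hd.
  pose proof (T_op_disk f fx fy fxx fxy fyx fyy cf cfx cfy cfxx cfxy cfyx cfyy
    dxf dyf dxfx dyfx dxfy dyfy a x y Hd (Hsol _ Hd)) as H.
  apply (f_equal (fun z => Re (w * z)%C)) in H.
  destruct (f (x, y)) as [f1 f2], (fx (x, y)) as [u1 u2], (fy (x, y)) as [v1 v2],
    (fxx (x, y)) as [p1 p2], (fyy (x, y)) as [r1 r2], w as [w1 w2].
  simpl in H |- *. rewrite !Rmult_0_r, Rminus_0_r in H.
  etransitivity; [|exact H]. field.
Qed.

(* At the boundary the Laplacian disappears from the equation, which becomes
   [r df/dr = (a / 2) f]. *)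
Lemma norm_D_ge_half (theta : R) : 0 < a -> Cmod (f (circ theta)) = 1 ->
  a / 2 <= norm_D f (circ theta).
Proof.
  intros Ha Hf. set (w := Cconj (f (circ theta))).
  assert (Hw : Cmod w = 1) by (unfold w; now rewrite Cmod_conj).
  apply Rle_trans with (2 := norm_D_ge f fx fy cfx cfy dxf dyf w theta Hw).
  set (p := Re (w * fx (circ theta))%C). set (q := Re (w * fy (circ theta))%C).
  (* The factors 1 and [1 - 1 ^ 2] are kept unsimplified, so that this is literally the limit of the
     equation along the radius. *)
  assert (E : - (a ^ 2 / 4) * Re (w * f (circ theta))%C
    + a / 2 * (1 * cos theta * p + 1 * sin theta * q)
    + 1 / 4 * (1 - 1 ^ 2) * (Re (w * fxx (circ theta))%C + Re (w * fyy (circ theta))%C) = 0).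
  { apply filterlim_at_left_unique with
      (fun s => - (a ^ 2 / 4) * Re (w * f (s * cos theta, s * sin theta)%R)%C
        + a / 2 * (s * cos theta * Re (w * fx (s * cos theta, s * sin theta)%R)%C
                   + s * sin theta * Re (w * fy (s * cos theta, s * sin theta)%R)%C)
        + 1 / 4 * (1 - s ^ 2) * (Re (w * fxx (s * cos theta, s * sin theta)%R)%C
                                 + Re (w * fyy (s * cos theta, s * sin theta)%R)%C)).
    - assert (Hl : forall h : R -> R, continuous h 1 -> filterlim h (at_left 1) (locally (h 1)))
        by exact continuous_at_left.
      repeat apply filterlim_at_left_plus.
      + apply filterlim_at_left_mult; [apply filterlim_const|now apply radial_lim].
      + apply filterlim_at_left_mult; [apply filterlim_const|].
        apply filterlim_at_left_plus; apply filterlim_at_left_mult;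
          try (now apply radial_lim).
        * apply (Hl (fun s => s * cos theta)). solve_continuous.
        * apply (Hl (fun s => s * sin theta)). solve_continuous.
      + apply filterlim_at_left_mult.
        * apply (Hl (fun s => 1 / 4 * (1 - s ^ 2))). solve_continuous.
        * apply filterlim_at_left_plus; now apply radial_lim.
    - apply filterlim_at_left_ext with (fun _ => 0); [|apply filterlim_const].
      intros s Hs. rewrite <- (T_op_Re w _ _ (disk_polar s theta ltac:(lra))).
      pose proof (sin2_cos2 theta) as S. unfold Rsqr in S.
      replace ((s * cos theta) ^ 2 + (s * sin theta) ^ 2)
        with (s ^ 2 * (sin theta * sin theta + cos theta * cos theta)) by ring.
      rewrite S, Rmult_1_r. reflexivity. }
  (* Now [E] reads [- a^2 / 4 + (a / 2) * (radial derivative) = 0], and [a / 2 > 0] cancels. *)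
  unfold w in E at 1. rewrite Re_conj_mult_unit in E by exact Hf.
  apply Rmult_le_reg_l with (a / 2); [lra|]. lra.
Qed.

Lemma norm_D_ge_harmonic (theta : R) : a = 0 -> f (RtoC 0) = RtoC 0 ->
  (forall z, disk z -> Cmod (f z) <= 1) -> Cmod (f (circ theta)) = 1 ->
  2 / PI <= norm_D f (circ theta).
Proof.
  intros Ha H0 Hb Hf. set (w := Cconj (f (circ theta))).
  assert (Hw : Cmod w = 1) by (unfold w; now rewrite Cmod_conj).
  apply Rle_trans with (2 := norm_D_ge f fx fy cfx cfy dxf dyf w theta Hw).
  assert (Hlap : forall x y, disk (x, y) ->
            Re (w * fxx (x, y))%C + Re (w * fyy (x, y))%C = 0).
  { intros x y Hd. pose proof (T_op_Re w x y Hd) as H. rewrite Ha in H.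
    pose proof (proj1 (disk_sqr x y) Hd).
    apply Rmult_eq_reg_l with (1 / 4 * (1 - (x ^ 2 + y ^ 2))); [lra|].
    apply Rmult_integral_contrapositive_currified; lra. }
  assert (Hgy : C1_disk (fun x y => Re (w * fy (x, y))%C) (fun x y => Re (w * fxy (x, y))%C)
                  (fun x y => Re (w * fyy (x, y))%C)).
  (* The symmetry of the mixed derivatives lets [fxy] stand for the [x]-derivative of [fy]. *)
  { apply C1_disk_Re; auto. intros x y Hd.
    rewrite (mixed_partials f fx fy fxx fxy fyx fyy); auto. }
  pose proof (polar_harmonic_of_C1_disk _ _ _ _ _ _ theta
    (C1_disk_Re w f fx fy dxf dyf cf cfx cfy)
    (C1_disk_Re w fx fxx fxy dxfx dyfx cfx cfxx cfxy) Hgy Hlap) as HP.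
  apply (schwarz_boundary_derivative _ _ _ _ _ HP).
  - intros s t Hs. apply Re_mult_bound; [exact Hw|]. apply Hb. apply disk_polar. lra.
  - intros t. rewrite !Rmult_0_l. change (0, 0) with (RtoC 0). rewrite H0, Cmult_0_r. reflexivity.
  - rewrite Rplus_0_r.
    replace 1 with (Re (w * f (circ theta))%C) at 2 by (now apply Re_conj_mult_unit).
    now apply radial_lim.
  - rewrite Rplus_0_r.
    apply filterlim_at_left_plus; (apply filterlim_at_left_mult;
      [now apply radial_lim|apply filterlim_const]).
Qed.

End Boundary.

(** [Derive] is total, so the clause [ex_derive] ensures that the limit is one of genuine
    derivatives. *)
Theorem theorem2 (alpha : R) (f : C -> C) (fstar : (R -> C) -> C)
    (alpha_ge0 : (0 <= alpha)%R)
    (f_C2 : Ck_closed_disk 2 f)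
    (fstar_distr : is_distribution fstar)
    (f_sol : Dirichlet_solution alpha f fstar)
    (f_0 : f (RtoC 0) = RtoC 0)
    (f_disk : is_image f closed_disk closed_disk)
    (f_circle : is_image f unit_circle unit_circle) :
  (alpha = 0%R ->
    forall theta : R, (0 <= theta <= 2 * PI)%R ->
      (norm_D f (circ theta) >= 2 / PI)%R)
  /\
  ((0 < alpha)%R ->
    (forall r : R, (0 <= r < 1)%R ->
      M_mean alpha r
      = (Gamma (1 + alpha / 2) ^ 2 / Gamma (1 + alpha)
         * hypergeometric (- (alpha / 2)) (- (alpha / 2)) 1 (r ^ 2))%R)
    /\ (forall r : R, (0 < r < 1)%R -> ex_derive (M_mean alpha) r)
    /\ filterlim (Derive (M_mean alpha)) (at_left 1%R) (locally (alpha / 2)%R)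
    /\ (forall theta : R, (0 <= theta <= 2 * PI)%R ->
          (norm_D f (circ theta) >= alpha / 2)%R)).
Proof.
  destruct f_sol as [HT _].
  destruct f_C2 as [cf (fx & fy & (cfx & fxx & fxy & Cxx & Cxy & Hfx) &
    (cfy & fyx & fyy & Cyx & Cyy & Hfy) & Hf)].
  destruct Cxx as [cfxx _], Cxy as [cfxy _], Cyx as [cfyx _], Cyy as [cfyy _].
  assert (Hcirc : forall theta, Cmod (f (circ theta)) = 1).
  { intros theta. apply f_circle. exists (circ theta). split; [apply Cmod_circ_1|reflexivity]. }
  assert (Hdisk : forall z, disk z -> Cmod (f z) <= 1).
  { intros z Hz. apply f_disk. exists z. split; [now apply Rlt_le|reflexivity]. }
  assert (dxf : has_dx f fx) by (intros x y H; apply (Hf x y H)).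
  assert (dyf : has_dy f fy) by (intros x y H; apply (Hf x y H)).
  assert (dxfx : has_dx fx fxx) by (intros x y H; apply (Hfx x y H)).
  assert (dyfx : has_dy fx fxy) by (intros x y H; apply (Hfx x y H)).
  assert (dxfy : has_dx fy fyx) by (intros x y H; apply (Hfy x y H)).
  assert (dyfy : has_dy fy fyy) by (intros x y H; apply (Hfy x y H)).
  split.
  - intros Ha theta _. apply Rle_ge.
    apply (norm_D_ge_harmonic f fx fy fxx fxy fyx fyy cf cfx cfy cfxx cfxy cfyx cfyy
      dxf dyf dxfx dyfx dxfy dyfy alpha HT theta Ha f_0 Hdisk (Hcirc theta)).
  - intros Ha. split; [|split; [|split]].
    + intros r Hr. now apply M_mean_hypergeometric.
    + intros r Hr. eexists. now apply is_derive_M_mean.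
    + now apply Derive_M_mean_lim.
    + intros theta _. apply Rle_ge.
      apply (norm_D_ge_half f fx fy fxx fxy fyx fyy cf cfx cfy cfxx cfxy cfyx cfyy
        dxf dyf dxfx dyfx dxfy dyfy alpha HT theta Ha (Hcirc theta)).
Qed.
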